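(* Let $c_1,\dots,c_m>0$ be constants and let $(A,D(A))$ be the operator on $X_2$ given by $Af=(c_1f_1'',\dots,c_mf_m'')^\top$ with domain $$D(A)=\{f\in (H^2(0,1))^m:\ \Phi_w^+f'(0)=\Phi_w^-f'(1)\text{ and }\exists d\in\mathbb{C}^n\text{ s.t. }(\Phi^+)^\top d=f(0)\text{ and }(\Phi^-)^\top d=f(1)\}.$$ Then $$\sigma(A)=\{0\}\cup\sigma_C\cup\sigma_{\mathcal{L}},$$ where $\sigma_C\subseteq\{-c_ik^2\pi^2:k\in\mathbb{Z}\setminus\{0\},\ i=1,\dots,m\}$ and $$\sigma_{\mathcal{L}}=\{-\lambda:\ \lambda>0,\ \lambda\ne c_ik^2\pi^2\text{ for all }k\in\mathbb{Z},\ i=1,\dots,m,\ \det\mathcal{L}_C(\lambda)=0\}.$$ Furthermore: 1. $0\in\sigma(A)$ is always an eigenvalue of geometric and algebraic multiplicity $1$, with eigenvector $f(x)\equiv\mathbf{1}$, the constant $1$ function. 2. Each $-\lambda\in\sigma_{\mathcal{L}}$ is an eigenvalue of $A$ with corresponding eigenvectors $$f(x)=\mathrm{Cos}(\sqrt\lambda x)(\Phi^+)^\top d+\mathrm{Sin}^{-1}(\sqrt\lambda)\,\mathrm{Sin}(\sqrt\lambda x)\big((\Phi^-)^\top-\mathrm{Cos}(\sqrt\lambda)(\Phi^+)^\top\big)d,$$ where $d\in\ker\mathcal{L}_C(\lambda)$ (nonzero), and so the multiplicity of this eigenvalue equals $\dim\ker\mathcal{L}_C(\lambda)$. 3. For $i\in\{1,\dots,m\}$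 and $k\in\mathbb{Z}\setminus\{0\}$, the number $-c_ik^2\pi^2$ is an eigenvalue of $A$ if and only if there exist $b\in\mathbb{C}^m$ and $d\in\mathbb{C}^n$, not both zero, such that for every $j\in\{1,\dots,m\}$, with $r,s$ the indices such that $\mathsf{e}_j(1)=\mathsf{v}_r$ and $\mathsf{e}_j(0)=\mathsf{v}_s$, $$\begin{cases} d_r=(-1)^{\sqrt{c_i/c_j}\,k}\,d_s, & \text{if }\sqrt{c_i/c_j}\,k\in\mathbb{Z},\\[2pt] b_j=\dfrac{1}{\sin(\sqrt{c_i/c_j}\,k\pi)}\,d_r-\cot\big(\sqrt{c_i/c_j}\,k\pi\big)\,d_s, & \text{otherwise},\end{cases}$$ and such that $$\Phi_w^-\,C\,\mathrm{Sin}(\sqrt{c_i}k\pi)(\Phi^+)^\top d=\big(\Phi_w^-\,C\,\mathrm{Cos}(\sqrt{c_i}k\pi)-\Phi_w^+\,C\big)b.$$ If the eigenvector exists, then it has the form $$f(x)=\mathrm{Cos}(\sqrt{c_i}k\pi x)(\Phi^+)^\top d+\mathrm{Sin}(\sqrt{c_i}k\pi x)\,b.$$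
   Context: $G$ is a finite connected simple graph (no loops, no multiple edges) with vertices $\mathsf{v}_1,\dots,\mathsf{v}_n$ and edges $\mathsf{e}_1,\dots,\mathsf{e}_m$, in which every vertex has degree at least 2. Each edge is parameterized on $[0,1]$, with endpoints $\mathsf{e}_j(0)$ and $\mathsf{e}_j(1)$. The $n\times m$ matrices $\Phi^{\pm}=(\phi^{\pm}_{ij})$ are: $\phi^+_{ij}=1$ if $\mathsf{e}_j(0)=\mathsf{v}_i$ and $0$ otherwise; $\phi^-_{ij}=1$ if $\mathsf{e}_j(1)=\mathsf{v}_i$ and $0$ otherwise. $\Gamma(\mathsf{v}_i)$ is the set of $j$ such that $\mathsf{v}_i$ is an endpoint of $\mathsf{e}_j$. The constants $\mu_1,\dots,\mu_m$ are strictly positive. The weighted incidence matrices are $\Phi_w^\pm=(\omega^\pm_{ij})$ with $\omega^\pm_{ij}=\mu_jc_j\phi^\pm_{ij}$. $X_2:=\prod_{j=1}^m L^2(0,1;\mu_j dx)$ (complex-valued). For $f=(f_1,\dots,f_m)^\top$, $f(0)=(f_1(0),\dots,f_m(0))^\top$, and similarly $f(1),f'(0),f'(1)$. $C:=\mathrm{diag}(1/\sqrt{c_1},\dots,1/\sqrt{c_m})$, $\mathrm{Sin}(x):=\mathrm{diag}(\sin\frac{x}{\sqrt{c_1}},\dots,\sin\frac{x}{\sqrt{c_m}})$, $\mathrm{Cos}(x):=\mathrm{diag}(\cos\frac{x}{\sqrt{c_1}},\dots,\cos\frac{x}{\sqrt{c_m}})$, and $\mathrm{Sin}^{-1}(x)$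 is the inverse matrix of $\mathrm{Sin}(x)$ when it exists. For $\lambda>0$ with $\lambda\ne c_jl^2\pi^2$ for all $j=1,\dots,m$, $l\in\mathbb{Z}$: $\mathcal{L}_C(\lambda):=D_C(\lambda)-\mathbb{A}_C(\lambda)$, where $D_C(\lambda)$ is the $n\times n$ diagonal matrix with $i$-th diagonal entry $\sum_{j\in\Gamma(\mathsf{v}_i)}\mu_j\sqrt{c_j}\cot\sqrt{\lambda/c_j}$, and $\mathbb{A}_C(\lambda)$ is the $n\times n$ matrix with zero diagonal whose $(i,k)$ entry for $i\ne k$ is $\mu_j\sqrt{c_j}/\sin\sqrt{\lambda/c_j}$ if $\mathsf{e}_j$ is the edge joining $\mathsf{v}_i$ and $\mathsf{v}_k$, and $0$ if there is no such edge. *)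

(* Defs.v *)
From mathcomp Require Export all_boot all_order all_algebra.
From mathcomp Require Export all_classical all_reals all_analysis.
From mathcomp Require Export complex.

Set Implicit Arguments.
Unset Strict Implicit.
Unset Printing Implicit Defensive.

Import Order.TTheory GRing.Theory Num.Theory.
Import numFieldNormedType.Exports.

Local Open Scope classical_set_scope.
Local Open Scope ring_scope.
Local Open Scope complex_scope.

(* An oriented graph on n vertices with m edges is a pair of maps
   e0 e1 : 'I_m -> 'I_n giving the endpoints e_j(0) and e_j(1). *)
Section Graph.
Variables (n m : nat) (e0 e1 : 'I_m -> 'I_n).

Definition joins (j : 'I_m) (u v : 'I_n) : bool :=
  ((e0 j == u) && (e1 j == v)) || ((e0 j == v) && (e1 j == u)).

Definition simple_graph : Prop :=
  (forall j, e0 j != e1 j) /\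
  (forall j k, joins k (e0 j) (e1 j) -> j = k).

(* The empty graph is not considered connected. *)
Definition connected_graph : Prop :=
  (0 < n)%N /\ (forall u v, connect (fun x y => [exists j, joins j x y]) u v).

(* Gamma v: indices of the edges incident to v.  In a simple graph its
   cardinality is the degree of v. *)
Definition Gamma (v : 'I_n) : {set 'I_m} := [set j | (e0 j == v) || (e1 j == v)].

End Graph.

(* Elements of L^2(0,1), complex valued, are represented by functions
   R -> R[i], of which only the restriction to ]0, 1[ up to almost everywhere
   equality is relevant. *)
Section Sobolev.
Variable R : realType.
Local Notation leb := (@lebesgue_measure R).
Implicit Types (u v U : R -> R[i]) (phi : R -> R).

Definition is_L2 u : Prop :=
  [/\ measurable_fun (`]0, 1[ : set R) (fun x => complex.Re (u x)),
      measurable_fun (`]0, 1[ : set R) (fun x => complex.Im (u x)) &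
      leb.-integrable `]0, 1[ (fun x => (Normc.normc (u x) ^+ 2)%:E)].

Definition Cintegral01 u : R[i] :=
  (\int[leb]_(x in `]0, 1[) complex.Re (u x)) +i*
  (\int[leb]_(x in `]0, 1[) complex.Im (u x)).

Definition test_fun phi : Prop :=
  (forall k x, derivable (derive1n k phi) x 1) /\
  closure [set x | phi x != 0] `<=` `]0, 1[.

Definition is_weak_derivative u v : Prop :=
  is_L2 v /\
  forall phi, test_fun phi ->
    Cintegral01 (fun x => u x * (derive1 phi x)%:C) =
    - Cintegral01 (fun x => v x * (phi x)%:C).

(* The weak derivative in L^2(0,1), which is unique almost everywhere
   (0 if there is none). *)
Definition weak_derivative u : R -> R[i] :=
  xget (fun=> 0) [set v | is_weak_derivative u v].

Definition is_H1 u : Prop := is_L2 u /\ exists v, is_weak_derivative u v.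

Definition is_H2 u : Prop := is_H1 u /\ is_H1 (weak_derivative u).

Definition is_continuous_rep u U : Prop :=
  [/\ {within `[0, 1], continuous (fun x => complex.Re (U x))},
      {within `[0, 1], continuous (fun x => complex.Im (U x))} &
      ae_eq leb (`]0, 1[%classic : set R) U u].

(* The continuous representative on [0, 1], unique there; it exists for every u
   in H^1(0,1), and the boundary values of u are its values at 0 and 1. *)
Definition continuous_rep u : R -> R[i] :=
  xget u [set U | is_continuous_rep u U].

End Sobolev.

(* X_2 is represented by vector-valued functions modulo almost everywhere
   equality on ]0, 1[. *)
Section X2.
Variables (R : realType) (m : nat).
Local Notation leb := (@lebesgue_measure R).
Local Notation C := R[i].
Local Notation X := (R -> 'cV[C]_m).
Implicit Types (f g : X) (z : C).

Definition entry f (j : 'I_m) : R -> C := fun x => f x j 0.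

Definition in_X2 f : Prop := forall j, is_L2 (entry f j).

Definition eq_X2 f g : Prop := ae_eq leb (`]0, 1[%classic : set R) f g.

Definition zero_X2 : X := fun=> 0.

Definition norm_X2 (mu : 'I_m -> R) f : R :=
  Num.sqrt (\sum_j mu j * \int[leb]_(x in `]0, 1[) Normc.normc (f x j 0) ^+ 2).

Definition wderiv f : X := fun x => \col_j weak_derivative (entry f j) x.

Definition value f (x : R) : 'cV[C]_m := \col_j continuous_rep (entry f j) x.

(* [has_dim P N]: the subspace P of X_2 has dimension N. *)
Definition has_dim (P : X -> Prop) (N : nat) : Prop :=
  exists F : 'I_N -> X,
    [/\ forall i, P (F i),
        forall a : 'I_N -> C,
          eq_X2 (fun x => \sum_i a i *: F i x) zero_X2 -> forall i, a i = 0 &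
        forall f, P f ->
          exists a : 'I_N -> C, eq_X2 f (fun x => \sum_i a i *: F i x)].

(* Spectral notions for an unbounded operator A on X_2 with domain D. *)
Variables (mu : 'I_m -> R) (D : X -> Prop) (A : X -> X).

Definition shifted z f : X := fun x => z *: f x - A f x.

(* z - A : D -> X_2 is bijective with bounded inverse. *)
Definition in_resolvent_set z : Prop :=
  [/\ forall f, D f -> eq_X2 (shifted z f) zero_X2 -> eq_X2 f zero_X2,
      forall g, in_X2 g -> exists2 f, D f & eq_X2 (shifted z f) g &
      exists M : R, forall f, D f -> norm_X2 mu f <= M * norm_X2 mu (shifted z f)].

Definition spectrum : set C := [set z | ~ in_resolvent_set z].

Definition eigenspace z f : Prop := D f /\ eq_X2 (A f) (fun x => z *: f x).

Definition is_eigenvector z f : Prop := eigenspace z f /\ ~ eq_X2 f zero_X2.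

Definition is_eigenvalue z : Prop := exists f, is_eigenvector z f.

(* ker (z - A)^k, with the natural domain of the power. *)
Fixpoint ker_pow z (k : nat) f : Prop :=
  if k is k'.+1 then D f /\ ker_pow z k' (shifted z f)
  else in_X2 f /\ eq_X2 f zero_X2.

Definition generalized_eigenspace z f : Prop := exists k, ker_pow z k f.

Definition geometric_multiplicity z N : Prop := has_dim (eigenspace z) N.

Definition algebraic_multiplicity z N : Prop := has_dim (generalized_eigenspace z) N.

End X2.

Section Network.
Variables (R : realType) (n m : nat) (e0 e1 : 'I_m -> 'I_n) (mu c : 'I_m -> R).
Local Notation C := R[i].

Definition Phi_plus : 'M[C]_(n, m) := \matrix_(i, j) (e0 j == i)%:R.
Definition Phi_minus : 'M[C]_(n, m) := \matrix_(i, j) (e1 j == i)%:R.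
Definition Phiw_plus : 'M[C]_(n, m) :=
  \matrix_(i, j) ((mu j * c j)%:C * Phi_plus i j).
Definition Phiw_minus : 'M[C]_(n, m) :=
  \matrix_(i, j) ((mu j * c j)%:C * Phi_minus i j).

Definition Cmx : 'M[C]_m := diag_mx (\row_j ((Num.sqrt (c j))^-1)%:C).
Definition Sin (x : R) : 'M[C]_m := diag_mx (\row_j (sin (x / Num.sqrt (c j)))%:C).
Definition Cos (x : R) : 'M[C]_m := diag_mx (\row_j (cos (x / Num.sqrt (c j)))%:C).

Definition opA (f : R -> 'cV[C]_m) : R -> 'cV[C]_m :=
  fun x => \col_j ((c j)%:C * wderiv (wderiv f) x j 0).

Definition domA (f : R -> 'cV[C]_m) : Prop :=
  [/\ forall j, is_H2 (entry f j),
      Phiw_plus *m value (wderiv f) 0 = Phiw_minus *m value (wderiv f) 1 &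
      exists d : 'cV[C]_n,
        Phi_plus^T *m d = value f 0 /\ Phi_minus^T *m d = value f 1].

Definition cot (x : R) : R := cos x / sin x.

Definition D_C (lam : R) : 'M[C]_n :=
  diag_mx (\row_i (\sum_(j in Gamma e0 e1 i)
                     mu j * Num.sqrt (c j) * cot (Num.sqrt (lam / c j)))%:C).

Definition A_C (lam : R) : 'M[C]_n :=
  \matrix_(i, k)
    if i == k then 0
    else if [pick j | joins e0 e1 j i k] is Some j
         then (mu j * Num.sqrt (c j) / sin (Num.sqrt (lam / c j)))%:C
         else 0.

Definition L_C (lam : R) : 'M[C]_n := D_C lam - A_C lam.

Definition candidates_C : set C :=
  [set z | exists (i : 'I_m) (k : int),
             k != 0 /\ z = (- (c i * k%:~R ^+ 2 * pi ^+ 2))%:C].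

Definition sigma_L : set C :=
  [set z | exists lam : R,
     [/\ z = (- lam)%:C, 0 < lam,
         forall (i : 'I_m) (k : int), lam != c i * k%:~R ^+ 2 * pi ^+ 2 &
         \det (L_C lam) = 0]].

Definition eigenfun_L (lam : R) (d : 'cV[C]_n) : R -> 'cV[C]_m :=
  fun x =>
    Cos (Num.sqrt lam * x) *m Phi_plus^T *m d +
    invmx (Sin (Num.sqrt lam)) *m Sin (Num.sqrt lam * x) *m
      (Phi_minus^T - Cos (Num.sqrt lam) *m Phi_plus^T) *m d.

Definition solves_C (i : 'I_m) (k : int) (b : 'cV[C]_m) (d : 'cV[C]_n) : Prop :=
  (forall j : 'I_m,
     let t := Num.sqrt (c i / c j) * k%:~R in
     let r := e1 j in
     let s := e0 j in
     if t \is a Num.int then d r 0 = (-1) ^ Num.floor t * d s 0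
     else b j 0 = ((sin (t * pi))^-1)%:C * d r 0 - (cot (t * pi))%:C * d s 0) /\
  Phiw_minus *m Cmx *m Sin (Num.sqrt (c i) * k%:~R * pi) *m Phi_plus^T *m d =
  (Phiw_minus *m Cmx *m Cos (Num.sqrt (c i) * k%:~R * pi) - Phiw_plus *m Cmx) *m b.

Definition eigenfun_C (i : 'I_m) (k : int) (b : 'cV[C]_m) (d : 'cV[C]_n) :
    R -> 'cV[C]_m :=
  fun x =>
    Cos (Num.sqrt (c i) * k%:~R * pi * x) *m Phi_plus^T *m d +
    Sin (Num.sqrt (c i) * k%:~R * pi * x) *m b.

End Network.

(* Main.v *)
(* Every element of the domain is an absolutely continuous function with an
   absolutely continuous derivative, so the resolvent equation (z - A) f = g is
   a system of linear second-order equations c_j f_j'' = z f_j - g_j, one on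
   each edge, coupled only through the vertex conditions.  A solution on an
   edge is determined by its initial data, hence the eigenvalue problem and the
   resolvent equation reduce to one and the same square linear system in the
   vertex values d and the initial slopes b; if it is injective it is
   invertible, so z is in the resolvent set as soon as it is not an eigenvalue.
   Green's formula has no boundary terms under the vertex conditions: this
   makes every eigenvalue real and nonpositive, and excludes Jordan chains.
   For z = -s^2 < 0 the solutions are combinations of cos (s x / sqrt c_j) and
   sin (s x / sqrt c_j).  Away from the zeros of the sines, b is a function of
   d and the Kirchhoff condition becomes L_C d = 0; at a zero the value at one
   end of the edge forces the value at the other.

   The link with weak derivatives is the du Bois-Reymond lemma, obtained from
   bump functions increasing to indicators of intervals, together with
   integration by parts for primitives of integrable functions, which is
   Fubini's theorem on a triangle. *)
From HB Require Import structures.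
Require Import Defs.
From mathcomp Require Import measurable_realfun ring lra.

Set Implicit Arguments.
Unset Strict Implicit.
Unset Printing Implicit Defensive.

Import Order.TTheory GRing.Theory Num.Theory.
Import numFieldNormedType.Exports.

Local Open Scope classical_set_scope.
Local Open Scope ring_scope.
Local Open Scope complex_scope.

(** * Primitives of integrable functions *)

Section RealPrimitive.
Variable R : realType.
Local Notation leb := (@lebesgue_measure R).
Implicit Types (u v w U V W : R -> R) (x y : R).

(** [weak_derivative] and [continuous_rep] are picked by choice inside almost-everywhere classes, so
    nothing can be computed from them. Each domain function is therefore traded for three functions
    per edge: continuous versions of $f_j$ and $f_j'$ and a version of $f_j''$, tied by integral
    formulas. A primitive of an integrable function need not be differentiable at every point; this
    is why the product rule, the uniqueness results and the energy identities are stated for the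
    relation between a function and its integral. The weights fit together: $\mu_j c_j$ in the
    Kirchhoff condition cancels the $1/c_j$ of the equation and leaves the $\mu_j$ of the inner
    product of $X_2$. One mechanism recurs: a boundary form takes equal values at 0 and 1 while its
    derivative is nonnegative, so this derivative vanishes. Applied to $f$ with itself it locates
    the eigenvalues; applied to $f$ and $g=(z-A)f$ with $z$ real and $(z-A)g=0$ it gives $\|g\|=0$.
    Bounds are kept linear in the $L^1$ norm of the data, because boundedness of the inverse is part
    of the definition of the resolvent set. *)

Definition int01 v : Prop := leb.-integrable `]0, 1[ (EFin \o v).

Definition prim v x : R := \int[leb]_(y in `]0, x[) v y.

(** Absolute continuity of [V] on $[0,1]$ with derivative [v] almost everywhere, encoded by the
    integral formula. [V] is unconstrained outside $[0,1]$. *)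
Definition isprim V v : Prop :=
  int01 v /\ forall x, 0 <= x <= 1 -> V x = V 0 + prim v x.

Lemma prim0 v : prim v 0 = 0.
Proof. by rewrite /prim set_itv_ge ?Rintegral_set0 ?bnd_simp. Qed.

Lemma int01_sub v x : x <= 1 -> int01 v -> leb.-integrable `]0, x[ (EFin \o v).
Proof.
move=> x1; apply: integrableS => //.
by apply: subset_itvl; rewrite bnd_simp.
Qed.

Lemma int01_meas v : int01 v -> measurable_fun (`]0, 1[ : set R) v.
Proof. by move=> /measurable_int/measurable_EFinP. Qed.

Lemma int01D u v : int01 u -> int01 v -> int01 (fun x => u x + v x).
Proof. exact: integrableD. Qed.

Lemma int01B u v : int01 u -> int01 v -> int01 (fun x => u x - v x).
Proof. exact: integrableB. Qed.

Lemma int01Z k u : int01 u -> int01 (fun x => k * u x).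
Proof. exact: integrableZl. Qed.

Lemma int01_ae u v : measurable_fun (`]0, 1[ : set R) v ->
  ae_eq leb (`]0, 1[%classic : set R) u v -> int01 u -> int01 v.
Proof.
move=> mv uv iu; apply/integrableP; split; first exact/measurable_EFinP.
have /integrableP[mu' fu] := iu.
rewrite (le_lt_trans _ fu)// le_eqVlt; apply/orP; left; apply/eqP.
apply: ae_eq_integral => //.
- by apply: measurableT_comp => //; exact/measurable_EFinP.
- by apply: measurableT_comp => //.
- by apply: filterS uv => x /= /[apply] ->.
Qed.

Lemma prim_ae u v x : int01 u -> int01 v -> x <= 1 ->
  ae_eq leb (`]0, 1[%classic : set R) u v -> prim u x = prim v x.
Proof.
move=> iu iv x1 uv; congr fine; apply: ae_eq_integral => //.
- exact: measurable_int (int01_sub x1 iu).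
- exact: measurable_int (int01_sub x1 iv).
- apply: filterS uv => y /= H; rewrite in_itv/= => /andP[y0 yx].
  by rewrite H// in_itv/= y0 (lt_le_trans yx).
Qed.

Lemma primD u v x : int01 u -> int01 v -> x <= 1 ->
  prim (fun x => u x + v x) x = prim u x + prim v x.
Proof. by move=> iu iv x1; rewrite /prim RintegralD//; exact: int01_sub. Qed.

Lemma primZ k u x : int01 u -> x <= 1 ->
  prim (fun x => k * u x) x = k * prim u x.
Proof. by move=> iu x1; rewrite /prim RintegralZl//; exact: int01_sub. Qed.

Lemma primB v x y : int01 v -> 0 <= x -> x <= y -> y <= 1 ->
  prim v y - prim v x = \int[leb]_(t in `]x, y[) v t.
Proof.
move=> iv x0 xy y1; rewrite /prim.
have iy := int01_sub y1 iv.
have ix : leb.-integrable `]0, x[ (EFin \o v) by apply: int01_sub iv; lra.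
have [->|xy'] := eqVneq x y.
  by rewrite subrr set_itv_ge ?Rintegral_set0 ?bnd_simp.
have xy2 : x < y by rewrite lt_neqAle xy'.
rewrite (Rintegral_itv_bndo_bndc ix).
have := @Rintegral_itvB R v (BRight 0) (BLeft y) x iy.
by rewrite !bnd_simp; apply.
Qed.

Lemma prim_le_norm v x : int01 v -> x <= 1 ->
  `|prim v x| <= \int[leb]_(t in `]0, 1[) `|v t|.
Proof.
move=> iv x1.
have ix := int01_sub x1 iv.
apply: le_trans (le_normr_Rintegral _ ix) _ => //.
rewrite /Rintegral fine_le//.
- exact: integrable_fin_num (integrable_norm ix).
- exact: integrable_fin_num (integrable_norm iv).
apply: ge0_subset_integral => //.
- by apply: measurable_int; exact: integrable_norm iv.
- by apply: subset_itvl; rewrite bnd_simp.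
Qed.

End RealPrimitive.

(** * Continuity of primitives and the product of two primitives *)

Section RealProduct.
Variable R : realType.
Local Notation leb := (@lebesgue_measure R).
Implicit Types (u v w U V W : R -> R) (x y : R).

(** The closed interval and the extension by zero give the shape required by the continuity theorem
    for parameterized integrals. *)
Lemma prim_cc v x : int01 v -> x <= 1 ->
  prim v x = \int[leb]_(t in `[0, x]) (v \_ `]0, 1[) t.
Proof.
move=> iv x1.
have h : leb.-integrable `[0, x] (EFin \o (v \_ `]0, 1[)).
  rewrite -restrict_EFin; apply/integrable_restrict => //.
  by apply: integrableS iv => //; exact: measurableI.
rewrite -Rintegral_itv_obnd_cbnd; last by apply: integrableS h => //; exact: subset_itv_oc_cc.
rewrite -Rintegral_itv_bndo_bndc; last by apply: integrableS h => //; exact: subset_itv_oo_cc.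
apply: eq_Rintegral => t; rewrite inE/= in_itv/= => /andP[t0 tx].
by rewrite patchE mem_set//= in_itv/= t0 (lt_le_trans tx).
Qed.

Lemma prim_continuous v : int01 v -> {within `[0, 1], continuous (prim v)}.
Proof.
move=> iv.
have h : leb.-integrable `[0, 1] (EFin \o (v \_ `]0, 1[)).
  rewrite -restrict_EFin; apply/integrable_restrict => //.
  by apply: integrableS iv => //; exact: measurableI.
have := parameterized_integral_continuous ler01 h.
apply: subspace_eq_continuous => t; rewrite inE/= in_itv/= => /andP[t0 t1].
by rewrite /from_subspace prim_cc.
Qed.

Lemma cont01_meas U : {within `[0, 1], continuous U} ->
  measurable_fun (`]0, 1[ : set R) U.
Proof.
move=> cU.
have m1 : measurable (`[0, 1]%classic : set R) by [].
have m2 := subspace_continuous_measurable_fun m1 cU.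
by apply: measurable_funS m2 => //; exact: subset_itv_oo_cc.
Qed.

Lemma cont01_bounded U : {within `[0, 1], continuous U} ->
  exists M, forall x, 0 <= x <= 1 -> `|U x| <= M.
Proof.
move=> cU.
have /compact_bounded[M [_ bM]] := continuous_compact cU (@segment_compact R 0 1).
exists (M + 1) => x x01; apply: (bM (M + 1)); first by rewrite ltrDl.
by exists x => //=; rewrite in_itv.
Qed.

Lemma int01M u U : int01 u -> {within `[0, 1], continuous U} ->
  int01 (fun x => u x * U x).
Proof.
move=> iu cU; have [M bM] := cont01_bounded cU.
suff : leb.-integrable `]0, 1[ ((EFin \o u) \* (EFin \o U))%E by [].
apply: integrableMl => //; first exact: cont01_meas.
exists M; split; first exact: num_real.
move=> K MK x /=; rewrite in_itv/= => /andP[x0 x1].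
by apply: le_trans (bM _ _) (ltW MK); rewrite !ltW.
Qed.

(** Fubini for $u(s)v(y)$ on the triangle $0<y<s<x$: integrating in $y$ first gives $\int
    u\cdot\mathrm{prim}\,v$, integrating in $s$ first gives $\int
    v\,(\mathrm{prim}\,u(x)-\mathrm{prim}\,u)$. *)
Lemma prim_mul u v x : int01 u -> int01 v -> 0 <= x <= 1 ->
  prim u x * prim v x =
  prim (fun s => u s * prim v s) x + prim (fun s => v s * prim u s) x.
Proof.
move=> iu iv /andP[x0 x1].
have iux := int01_sub x1 iu; have ivx := int01_sub x1 iv.
pose f : R -> R := u \_ `]0, x[; pose g : R -> R := v \_ `]0, x[.
have fi : leb.-integrable setT (EFin \o f).
  by rewrite -restrict_EFin; apply/(integrable_mkcond _ _).1.
have gi : leb.-integrable setT (EFin \o g).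
  by rewrite -restrict_EFin; apply/(integrable_mkcond _ _).1.
pose h (z : R * R) := f z.1 * g z.2.
pose k (z : R * R) := if (z.2 < z.1)%R then h z else 0.
have mf : measurable_fun setT f by move/integrableP : fi => -[/measurable_EFinP].
have mg : measurable_fun setT g by move/integrableP : gi => -[/measurable_EFinP].
have mh : measurable_fun setT h by apply: measurable_funM; apply: measurableT_comp.
have mk : measurable_fun setT k.
  by apply: measurable_fun_ifT => //; apply: measurable_fun_ltr.
(* Tonelli: the iterated integral of $|f(s)||g(y)|$ factors into two finite integrals; the
   restriction [k] to the triangle is then dominated by [h]. *)
have hi : (leb \x leb)%E.-integrable setT (EFin \o h).
  apply/integrable12ltyP; first exact/measurable_EFinP.
  have /integrableP[_ Fi] := fi.
  have /integrableP[_ Gi] := gi.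
  have mag : measurable_fun setT (fun y => `|g y|%:E).
    by apply/measurable_EFinP; exact: measurableT_comp.
  have maf : measurable_fun setT (fun y => `|f y|%:E).
    by apply/measurable_EFinP; exact: measurableT_comp.
  have gfin : (\int[leb]_x `|(EFin \o g) x|)%E \is a fin_num.
    by rewrite ge0_fin_numE ?integral_ge0.
  under eq_integral => s _.
    under eq_integral => y _ do rewrite /h /= normrM EFinM.
    rewrite (ge0_integralZl leb measurableT mag)// muleC.
    over.
  rewrite (ge0_integralZl leb measurableT maf) ?integral_ge0//.
  by rewrite lte_mul_pinfty ?integral_ge0.
have ki : (leb \x leb)%E.-integrable setT (EFin \o k).
  apply: le_integrable hi => //; first exact/measurable_EFinP.
  move=> z _ /=; rewrite /k lee_fin; case: (_ < _)%R => //.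
  by rewrite normr0.
(* Slice at fixed $s$: the triangle leaves $0<y<s$. *)
have A s : (\int[leb]_y (EFin \o k) (s, y))%E = (f s * prim v s)%:E.
  have [sD|sD] := boolP (s \in `]0, x[); last first.
    have -> : f s = 0 by rewrite /f patchE memNset//=; exact/negP.
    rewrite mul0r integral0_eq// => y _ /=.
    by rewrite /k /h /f /= patchE memNset ?mul0r ?if_same//=; exact/negP.
  have := sD; rewrite in_itv/= => /andP[s0 sx].
  have iv's : leb.-integrable `]0, s[ (EFin \o v).
    by apply: int01_sub iv; lra.
  transitivity ((f s)%:E * \int[leb]_(y in `]0%R, s[) (v y)%:E)%E.
    have iv2 : leb.-integrable setT ((EFin \o v) \_ `]0, s[).
      by apply/(integrable_mkcond _ _).1.
    rewrite [in RHS]integral_mkcond -integralZl//.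
    apply: eq_integral => y _ /=; rewrite patchE /k /h /g /= patchE.
    have [ys|sy] := ltP y s; last first.
      by rewrite memNset ?mule0//= in_itv/= => /andP[_]; rewrite ltNge sy.
    have [y0|y0] := ltP 0 y; last first.
      by rewrite !memNset ?mule0 ?mulr0//= in_itv/= => /andP[]; rewrite ltNge y0.
    by rewrite !mem_set//= in_itv/= y0//= (lt_trans ys).
  by rewrite EFinM fineK//; exact: integrable_fin_num.
(* Slice at fixed $y$: the triangle leaves $y<s<x$. *)
have B y : (\int[leb]_s (EFin \o k) (s, y))%E = (g y * (prim u x - prim u y))%:E.
  have [yD|yD] := boolP (y \in `]0, x[); last first.
    have -> : g y = 0 by rewrite /g patchE memNset//=; exact/negP.
    rewrite mul0r integral0_eq// => s _ /=.
    by rewrite /k /h /g /= patchE memNset ?mulr0 ?if_same//=; exact/negP.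
  have := yD; rewrite in_itv/= => /andP[y0 yx].
  rewrite primB//; [|exact: ltW|exact: ltW].
  have iu' : leb.-integrable `]y, x[ (EFin \o u).
    by apply: integrableS iux => //; apply: subset_itvr; rewrite bnd_simp ltW.
  transitivity ((g y)%:E * \int[leb]_(s in `]y, x[) (u s)%:E)%E.
    have iu2 : leb.-integrable setT ((EFin \o u) \_ `]y, x[).
      by apply/(integrable_mkcond _ _).1.
    rewrite [in RHS]integral_mkcond -integralZl//.
    apply: eq_integral => s _ /=; rewrite patchE /k /h /f /= patchE.
    have [ys|sy] := ltP y s; last first.
      by rewrite memNset ?mule0//= in_itv/= => /andP[]; rewrite ltNge sy.
    have [sx|sx] := ltP s x; last first.
      by rewrite !memNset ?mule0 ?mul0r//= in_itv/= => /andP[_]; rewrite ltNge sx.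
    by rewrite !mem_set//= ?in_itv/= ?ys ?sx// ?(lt_trans y0)// -EFinM mulrC.
  by rewrite EFinM fineK//; exact: integrable_fin_num.
have := Fubini ki.
under eq_integral do rewrite A.
under [in X in _ = X -> _]eq_integral do rewrite B.
move=> /(congr1 fine) H.
have H1 : \int[leb]_s (f s * prim v s) = prim (fun s => u s * prim v s) x.
  rewrite /prim [RHS]Rintegral_mkcond; apply: eq_Rintegral => s _.
  by rewrite /f !patchE; case: ifP; rewrite ?mul0r.
have H2 : \int[leb]_s (g s * (prim u x - prim u s)) =
    prim (fun s => v s * (prim u x - prim u s)) x.
  rewrite {1}/prim [RHS]Rintegral_mkcond; apply: eq_Rintegral => s _.
  by rewrite /g !patchE; case: ifP; rewrite ?mul0r.
have : prim (fun s => u s * prim v s) x =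
    prim (fun s => v s * (prim u x - prim u s)) x by rewrite -H1 -H2.
move=> ->.
rewrite (_ : (fun s => v s * (prim u x - prim u s)) =
  (fun s => prim u x * v s + - 1 * (v s * prim u s))); last first.
  by apply/funext => s; ring.
have ivu := int01M iv (prim_continuous iu).
rewrite primD//; [|exact: int01Z|exact: int01Z].
by rewrite !primZ//; ring.
Qed.

End RealProduct.

(** * Calculus of absolutely continuous functions *)

Section RealPrimitiveAlgebra.
Variable R : realType.
Local Notation leb := (@lebesgue_measure R).
Implicit Types (u v w U V W : R -> R) (x y : R).

Lemma isprim_int V v : isprim V v -> int01 v.
Proof. by case. Qed.

Lemma isprim_prim v : int01 v -> isprim (prim v) v.
Proof. by move=> iv; split=> // x _; rewrite prim0 add0r. Qed.

Lemma isprim_eq V W v w : (forall x, 0 <= x <= 1 -> V x = W x) ->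
  (forall x, 0 < x < 1 -> v x = w x) -> isprim V v -> isprim W w.
Proof.
move=> VW vw [iv pV]; split.
  apply: eq_integrable iv => // x; rewrite inE/= in_itv/= => xx.
  by rewrite vw.
move=> x x01; rewrite -!VW ?lexx ?ler01// pV//; congr (_ + _).
apply: eq_Rintegral => y; rewrite inE/= in_itv/= => /andP[y0 yx].
by rewrite vw// y0/= (lt_le_trans yx)//; case/andP: x01.
Qed.

Lemma isprim_ae V v w : measurable_fun (`]0, 1[ : set R) w ->
  ae_eq leb (`]0, 1[%classic : set R) v w -> isprim V v -> isprim V w.
Proof.
move=> mw vw [iv pV]; have iw := int01_ae mw vw iv.
by split=> // x x01; rewrite pV// (prim_ae iv iw)//; case/andP: x01.
Qed.

Lemma isprim_cont V v : isprim V v -> {within `[0, 1], continuous V}.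
Proof.
move=> [iv pV].
have : {within `[0, 1], continuous (fun x => V 0 + prim v x)}.
  have c := prim_continuous iv; move=> x.
  by apply: continuousD; [exact: cst_continuous|exact: c].
apply: subspace_eq_continuous => x; rewrite inE/= in_itv/= => x01.
by rewrite /from_subspace -pV.
Qed.

Lemma isprimD V W v w : isprim V v -> isprim W w ->
  isprim (fun x => V x + W x) (fun x => v x + w x).
Proof.
move=> [iv pV] [iw pW]; split; first exact: int01D.
move=> x x01; have /andP[_ x1] := x01.
by rewrite pV// pW// primD//; ring.
Qed.

Lemma isprimZ k V v : isprim V v -> isprim (fun x => k * V x) (fun x => k * v x).
Proof.
move=> [iv pV]; split; first exact: int01Z.
move=> x x01; have /andP[_ x1] := x01.
by rewrite pV// primZ//; ring.
Qed.

Lemma isprimN V v : isprim V v -> isprim (fun x => - V x) (fun x => - v x).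
Proof.
move=> /(isprimZ (-1)); apply: isprim_eq => x _; exact: mulN1r.
Qed.

Lemma isprimB V W v w : isprim V v -> isprim W w ->
  isprim (fun x => V x - W x) (fun x => v x - w x).
Proof. by move=> pv /isprimN; exact: isprimD. Qed.

Lemma isprim_cst (k : R) : isprim (fun=> k) (fun=> 0 : R).
Proof.
split; first by apply: (eq_integrable _ (cst 0%E)) => //; exact: integrable0.
by move=> x _; rewrite /prim Rintegral_cst// mul0r addr0.
Qed.

(** Writing $V=V(0)+\mathrm{prim}\,v$ and $W=W(0)+\mathrm{prim}\,w$ leaves one nonlinear term, the
    product of the two primitives, which is [prim_mul]. *)
Lemma isprimM V W v w : isprim V v -> isprim W w ->
  isprim (fun x => V x * W x) (fun x => v x * W x + w x * V x).
Proof.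
move=> pv pw; have cV := isprim_cont pv; have cW := isprim_cont pw.
have [iv pV] := pv; have [iw pW] := pw.
have ivW := int01M iv cW; have iwV := int01M iw cV.
split; first exact: int01D.
move=> x x01; have /andP[_ x1] := x01.
rewrite primD//.
have E1 : prim (fun x => v x * W x) x = W 0 * prim v x + prim (fun x => v x * prim w x) x.
  rewrite -(primZ (W 0) iv x1).
  rewrite -(primD (int01Z _ iv) (int01M iv (prim_continuous iw)) x1).
  apply: eq_Rintegral => y; rewrite inE/= in_itv/= => /andP[y0 yx].
  by rewrite (pW y) ?(ltW y0) ?(le_trans (ltW yx))//; ring.
have E2 : prim (fun x => w x * V x) x = V 0 * prim w x + prim (fun x => w x * prim v x) x.
  rewrite -(primZ (V 0) iw x1).
  rewrite -(primD (int01Z _ iw) (int01M iw (prim_continuous iv)) x1).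
  apply: eq_Rintegral => y; rewrite inE/= in_itv/= => /andP[y0 yx].
  by rewrite (pV y) ?(ltW y0) ?(le_trans (ltW yx))//; ring.
rewrite E1 E2 (pV x)// (pW x)// mulrDl !mulrDr (prim_mul iv iw x01).
by move: (prim _ _) (prim _ _) (prim _ _) (prim _ _) => a b c d; ring.
Qed.

(** The integral of [w] is $W(1)-W(0)=0$. In the energy arguments [W] is a boundary form and [w] an
    energy density. *)
Lemma isprim_ge0_eq0 W w : isprim W w -> (forall x, 0 < x < 1 -> 0 <= w x) ->
  W 1 = W 0 -> ae_eq leb (`]0, 1[%classic : set R) w (fun=> 0).
Proof.
move=> [iw pW] w0 W10.
have I0 : \int[leb]_(y in `]0, 1[) w y = 0.
  apply: (addrI (W 0)); rewrite addr0 -[RHS]W10.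
  by apply/esym/pW; rewrite lexx ler01.
have iw' : leb.-integrable `]0, 1[ (EFin \o w) := iw.
have fi : (\int[leb]_(x in `]0%R, 1%R[) (EFin \o w) x)%E \is a fin_num.
  exact: integrable_fin_num.
have J0 : (\int[leb]_(x in `]0%R, 1%R[) `|(EFin \o w) x| = 0)%E.
  transitivity (\int[leb]_(x in `]0%R, 1%R[) (w x)%:E)%E.
    apply: eq_integral => x; rewrite inE/= in_itv/= => x01.
    by rewrite ger0_norm// w0.
  by rewrite -(fineK fi) -/(Rintegral _ _ _) I0.
have mw : measurable_fun (`]0, 1[ : set R) (EFin \o w).
  exact: measurable_int iw'.
have := (ae_eq_integral_abs leb (measurable_itv `]0, 1[) mw).1 J0.
by apply: filterS => x /= /[apply] -[].
Qed.

Lemma isprim0_const W w : isprim W w -> (forall x, 0 < x < 1 -> w x = 0) ->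
  forall x, 0 <= x <= 1 -> W x = W 0.
Proof.
move=> [iw pW] w0 x x01; rewrite pW//.
have -> : prim w x = prim (fun=> 0) x.
  apply: eq_Rintegral => y; rewrite inE/= in_itv/= => /andP[y0 yx].
  by apply: w0; rewrite y0/= (lt_le_trans yx)//; case/andP: x01.
by have [_ /(_ x x01)/esym] := isprim_cst (W 0).
Qed.

(** Lebesgue differentiation: the zero extension of [v] has an identically vanishing integral
    function, and almost everywhere the derivative of that function is the integrand. *)
Lemma prim_eq0_ae v : int01 v -> (forall x, 0 <= x <= 1 -> prim v x = 0) ->
  ae_eq leb (`]0, 1[%classic : set R) v (fun=> 0).
Proof.
move=> iv v0.
pose f := v \_ `]0, 1[.
have fi : leb.-integrable setT (EFin \o f).
  by rewrite -restrict_EFin; apply/(integrable_mkcond _ _).1.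
have fl : locally_integrable setT f by apply: open_integrable_locally => //; exact: openT.
have fy y : leb.-integrable `]-oo, y] (EFin \o f) by apply: integrableS fi.
have := FTC1Ny fy fl.
have -> : (fun x => \int[leb]_(t in `]-oo, x]) f t) = fun=> 0.
  apply/funext => x.
  have -> : \int[leb]_(t in `]-oo, x]) f t = \int[leb]_(t in `]-oo, x] `&` `]0, 1[) v t.
    by rewrite Rintegral_mkcondr.
  have [x0|x0] := leP x 0.
    rewrite (_ : _ `&` _ = set0) ?Rintegral_set0//.
    rewrite -subset0 => t /= []; rewrite !in_itv/= => tx /andP[t0 _].
    by have := lt_le_trans t0 (le_trans tx x0); rewrite ltxx.
  have [x1|x1] := ltP x 1; last first.
    rewrite (_ : _ `&` _ = `]0, 1[%classic); first by apply: (v0 1); rewrite lexx ler01.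
    apply/seteqP; split=> [t []//|t]; rewrite /= !in_itv/= => t01; split=> //.
    by case/andP: t01 => _ /ltW/le_trans; apply.
  rewrite (_ : _ `&` _ = `]0, x]%classic); last first.
    apply/seteqP; split=> t; rewrite /= !in_itv/=.
      by move=> [-> /andP[->]].
    by move=> /andP[-> tx]; rewrite tx (le_lt_trans tx).
  rewrite -Rintegral_itv_bndo_bndc; first by apply: (v0 x); rewrite !ltW.
  exact: int01_sub (ltW x1) iv.
apply: filterS => [|x [_]]; first exact: (ae_filter_ringOfSetsType leb).
rewrite derive1_cst => fx x01.
by rewrite [RHS]fx /f patchE mem_set.
Qed.

Lemma isprim_uniq V v w : isprim V v -> isprim V w ->
  ae_eq leb (`]0, 1[%classic : set R) v w.
Proof.
move=> pv pw; have [ib pb] := isprimB pv pw.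
have : ae_eq leb (`]0, 1[%classic : set R) (fun x => v x - w x) (fun=> 0).
  by apply: prim_eq0_ae => // x /pb; rewrite !subrr add0r.
by apply: filterS => x /[apply] /= /eqP; rewrite subr_eq0 => /eqP.
Qed.

(** The bridge from pointwise calculus, by the fundamental theorem for continuous derivatives; the
    primitives of exponentials, sines, cosines and test functions come through it. *)
Lemma isprim_derive F f : (forall x, is_derive x 1 F (f x)) -> continuous f ->
  isprim F f.
Proof.
move=> dF cf.
have ic a b : leb.-integrable `[a, b] (EFin \o f).
  apply: continuous_compact_integrable; first exact: segment_compact.
  exact: continuous_subspaceT.
have if01 : int01 f by apply: integrableS (ic 0 1) => //; exact: subset_itv_oo_cc.
split=> // x /andP[x0 x1].
have [->|xn0] := eqVneq x 0; first by rewrite prim0 addr0.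
have xgt0 : 0 < x by rewrite lt_neqAle eq_sym xn0.
have dd y : derivable F y 1 by have := dF y; case.
have cF y : {for y, continuous F} by apply/differentiable_continuous/derivable1_diffP.
have := @continuous_FTC2 R f F 0 x xgt0 (continuous_subspaceT cf).
rewrite /prim Rintegral_itv_obnd_cbnd; last exact: int01_sub.
rewrite Rintegral_itv_bndo_bndc; last first.
  by apply: integrableS (ic 0 x) => //; exact: subset_itv_co_cc.
rewrite /Rintegral => ->; first by rewrite /=; ring.
- by split=> [y _||]; [exact: dd|exact/cvg_at_right_filter/cF|exact/cvg_at_left_filter/cF].
- by move=> y _; rewrite derive1E derive_val.
Qed.

End RealPrimitiveAlgebra.

(** * Primitives of complex-valued functions and the complex exponential *)

Section ComplexPrimitive.
Variable R : realType.
Local Notation leb := (@lebesgue_measure R).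
Local Notation C := R[i].
Local Notation Re := (@complex.Re R).
Local Notation Im := (@complex.Im R).
Implicit Types (u v w U V W : R -> C) (x y : R) (z : C).

Lemma cReD (a b : C) : Re (a + b) = Re a + Re b. Proof. by case: a; case: b. Qed.
Lemma cImD (a b : C) : Im (a + b) = Im a + Im b. Proof. by case: a; case: b. Qed.
Lemma cReN (a : C) : Re (- a) = - Re a. Proof. by case: a. Qed.
Lemma cImN (a : C) : Im (- a) = - Im a. Proof. by case: a. Qed.
Lemma cReM (a b : C) : Re (a * b) = Re a * Re b - Im a * Im b.
Proof. by case: a; case: b. Qed.
Lemma cImM (a b : C) : Im (a * b) = Re a * Im b + Im a * Re b.
Proof. by case: a; case: b. Qed.
Lemma cReJ (a : C) : Re a^* = Re a. Proof. by case: a. Qed.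
Lemma cImJ (a : C) : Im a^* = - Im a. Proof. by case: a. Qed.

Lemma complex_eqP (a b : C) : Re a = Re b -> Im a = Im b -> a = b.
Proof. by case: a => ? ?; case: b => ? ? /= -> ->. Qed.

Definition intC v : Prop := int01 (fun x => Re (v x)) /\ int01 (fun x => Im (v x)).

Definition cprim U v : Prop :=
  isprim (fun x => Re (U x)) (fun x => Re (v x)) /\
  isprim (fun x => Im (U x)) (fun x => Im (v x)).

Definition primC v x : C := prim (fun x => Re (v x)) x +i* prim (fun x => Im (v x)) x.

Lemma cprim_primC v : intC v -> cprim (primC v) v.
Proof. by move=> [iv jv]; split; exact: isprim_prim. Qed.

Lemma primC0 v : primC v 0 = 0.
Proof. by rewrite /primC !prim0. Qed.

Lemma cprim_eq V W v w : (forall x, 0 <= x <= 1 -> V x = W x) ->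
  (forall x, 0 < x < 1 -> v x = w x) -> cprim V v -> cprim W w.
Proof.
move=> VW vw [pR pI]; split.
  by apply: isprim_eq pR => x x01; rewrite ?VW ?vw.
by apply: isprim_eq pI => x x01; rewrite ?VW ?vw.
Qed.

Lemma cprim_ae V v w : measurable_fun (`]0, 1[ : set R) (fun x => Re (w x)) ->
  measurable_fun (`]0, 1[ : set R) (fun x => Im (w x)) ->
  ae_eq leb (`]0, 1[%classic : set R) v w -> cprim V v -> cprim V w.
Proof.
move=> mR mI vw [pR pI]; split.
  by apply: isprim_ae pR => //; apply: filterS vw => x /= /[apply] ->.
by apply: isprim_ae pI => //; apply: filterS vw => x /= /[apply] ->.
Qed.

Lemma cprimD V W v w : cprim V v -> cprim W w ->
  cprim (fun x => V x + W x) (fun x => v x + w x).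
Proof.
move=> [vR vI] [wR wI]; split.
  by apply: isprim_eq (isprimD vR wR) => x _; rewrite cReD.
by apply: isprim_eq (isprimD vI wI) => x _; rewrite cImD.
Qed.

Lemma cprimM V W v w : cprim V v -> cprim W w ->
  cprim (fun x => V x * W x) (fun x => v x * W x + w x * V x).
Proof.
move=> [vR vI] [wR wI]; split.
  apply: isprim_eq (isprimB (isprimM vR wR) (isprimM vI wI)) => x _.
    by rewrite cReM.
  by rewrite cReD !cReM; ring.
apply: isprim_eq (isprimD (isprimM vR wI) (isprimM vI wR)) => x _.
  by rewrite cImM.
by rewrite cImD !cImM; ring.
Qed.

Lemma cprim_cst z : cprim (fun=> z) (fun=> 0).
Proof. by split; exact: isprim_cst. Qed.

Lemma cprimZ z V v : cprim V v -> cprim (fun x => z * V x) (fun x => z * v x).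
Proof.
move=> pv; apply: cprim_eq (cprimM (cprim_cst z) pv) => x _ //.
by rewrite mul0r add0r mulrC.
Qed.

Lemma cprimN V v : cprim V v -> cprim (fun x => - V x) (fun x => - v x).
Proof. by move=> /(cprimZ (-1)); apply: cprim_eq => x _; rewrite mulN1r. Qed.

Lemma cprimB V W v w : cprim V v -> cprim W w ->
  cprim (fun x => V x - W x) (fun x => v x - w x).
Proof. by move=> pv /cprimN; exact: cprimD. Qed.

Lemma cprim_sum (I : Type) (r : seq I) (P : pred I) (V v : I -> R -> C) :
  (forall i, cprim (V i) (v i)) ->
  cprim (fun x => \sum_(i <- r | P i) V i x) (fun x => \sum_(i <- r | P i) v i x).
Proof.
move=> h; elim: r => [|i r IH].
  by apply: cprim_eq (cprim_cst 0) => x _; rewrite big_nil.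
case Pi: (P i).
  by apply: cprim_eq (cprimD (h i) IH) => x _; rewrite big_cons Pi.
by apply: cprim_eq IH => x _; rewrite big_cons Pi.
Qed.

Lemma cprimJ V v : cprim V v -> cprim (fun x => (V x)^*) (fun x => (v x)^*).
Proof.
move=> [vR vI]; split.
  by apply: isprim_eq vR => x _; rewrite cReJ.
by apply: isprim_eq (isprimN vI) => x _; rewrite cImJ.
Qed.

Lemma cprim_real (F f : R -> R) : isprim F f ->
  cprim (fun x => (F x)%:C) (fun x => (f x)%:C).
Proof. by move=> pF; split => //; exact: isprim_cst. Qed.

Lemma cprim_uniq V v w : cprim V v -> cprim V w ->
  ae_eq leb (`]0, 1[%classic : set R) v w.
Proof.
move=> [vR vI] [wR wI].
apply: filterS2 (isprim_uniq vR wR) (isprim_uniq vI wI) => x /= hR hI x01.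
by apply: complex_eqP; [exact: hR|exact: hI].
Qed.

Lemma cprim0_const W w : cprim W w -> (forall x, 0 < x < 1 -> w x = 0) ->
  forall x, 0 <= x <= 1 -> W x = W 0.
Proof.
move=> [wR wI] w0 x x01; apply: complex_eqP.
  by apply: (isprim0_const wR) x01 => y y01; rewrite w0.
by apply: (isprim0_const wI) x01 => y y01; rewrite w0.
Qed.

Lemma isprim_linear (F f : R -> R) (a : R) : (forall x, is_derive x 1 F (f x)) ->
  continuous f -> isprim (fun x => F (a * x)) (fun x => a * f (a * x)).
Proof.
move=> dF cf; apply: isprim_derive => [x|].
  have := dF (a * x) => d1.
  have d2 : is_derive x 1 (fun x => a * x) a.
    by apply: is_derive_eq; exact: mulr1.
  by have := is_derive1_comp d1 d2; rewrite /comp => h; apply: (is_derive_eq h); rewrite mulrC.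
move=> x; apply: continuousM; first exact: cst_continuous.
apply: continuous_comp; last exact: cf.
exact: mulrl_continuous.
Qed.

Lemma isprim_exp (a : R) : isprim (fun x => expR (a * x)) (fun x => a * expR (a * x)).
Proof. apply: isprim_linear; exact: continuous_expR. Qed.

Lemma isprim_cos (a : R) : isprim (fun x => cos (a * x)) (fun x => - (a * sin (a * x))).
Proof.
have := @isprim_linear (@cos R) (fun x => - sin x) a (@is_derive_cos R).
move=> h; apply: isprim_eq (h _) => // [x _|x].
  by rewrite mulrN.
by apply: continuousN; exact: continuous_sin.
Qed.

Lemma isprim_sin (a : R) : isprim (fun x => sin (a * x)) (fun x => a * cos (a * x)).
Proof. apply: isprim_linear; exact: continuous_cos. Qed.

(** This is $e^{zx}$ for real $x$, split into real and imaginary parts so that its primitive comes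
    from those of exp, cos and sin. It serves as integrating factor. *)
Definition cexp z x : C :=
  (expR (Re z * x) * cos (Im z * x)) +i* (expR (Re z * x) * sin (Im z * x)).

Lemma cexpN z x : cexp z x * cexp (- z) x = 1.
Proof.
rewrite /cexp cReN cImN !mulNr cosN sinN expRN.
have e0 : expR (Re z * x) != 0 by rewrite gt_eqF ?expR_gt0.
apply: complex_eqP; rewrite ?cReM ?cImM /=; last by ring.
have := cos2Dsin2 (Im z * x); set a := expR _ in e0 *; move=> h.
transitivity ((a / a) * (cos (Im z * x) ^+ 2 + sin (Im z * x) ^+ 2)); first by ring.
by rewrite h divff ?mulr1.
Qed.

Lemma cprim_cexp z : cprim (cexp z) (fun x => z * cexp z x).
Proof.
have pe := isprim_exp (Re z).
split.
  apply: isprim_eq (isprimM pe (isprim_cos (Im z))) => // x _.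
  by rewrite cReM /=; ring.
apply: isprim_eq (isprimM pe (isprim_sin (Im z))) => // x _.
by rewrite cImM /=; ring.
Qed.

End ComplexPrimitive.

(** * Smooth bump functions and the du Bois-Reymond lemma *)

Section Bump.
Variable R : realType.
Implicit Types (x y : R) (f g : R -> R).

(** $x^{-k}e^{-1/x}$ on the positive half-line, extended by 0. The powers are included so that
    derivatives stay in the linear span of the family. *)
Definition flat k x : R := if 0 < x then x^-1 ^+ k * expR (- x^-1) else 0.

(** With $y=1/x$, the Taylor term $y^{k+2}/(k+2)!\le e^y$ bounds $y^ke^{-y}$ by $(k+2)!\,y^{-2}$.
    The exponent 2 is what makes the difference quotient at 0 tend to 0. *)
Lemma flat_le k x : `|flat k x| <= (k.+2)`!%:R * x ^+ 2.
Proof.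
rewrite /flat; case: ifP => x0; last first.
  by rewrite normr0 mulr_ge0// exprn_even_ge0.
have xn0 : x != 0 by rewrite gt_eqF.
have y0 : 0 < x^-1 by rewrite invr_gt0.
set y := x^-1 in y0 *.
rewrite ger0_norm ?mulr_ge0 ?exprn_ge0 ?expR_ge0//; last exact: ltW.
rewrite expRN -ler_pdivlMr ?invr_gt0 ?expR_gt0// invrK.
have h := expR_ge1Dxn k.+1 (ltW y0).
have f0 : (0 : R) < k.+2`!%:R by rewrite ltr0n fact_gt0.
have x2 : x ^+ 2 = (y ^+ 2)^-1 by rewrite /y exprVn invrK.
rewrite x2 -ler_pdivrMl; last by rewrite mulr_gt0// invr_gt0 exprn_gt0.
rewrite invfM invrK -mulrA -exprD addnC mulrC addn2.
by apply: le_trans h; rewrite lerDr.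
Qed.

Lemma flat_derive k x :
  is_derive x 1 (flat k) (flat k.+2 x - k%:R * flat k.+1 x).
Proof.
have [x0|x0|->] := ltrgtP x 0.
- rewrite /flat ltNge (ltW x0)/= mulr0 subr0.
  apply: (@near_eq_is_derive _ _ _ (fun=> 0) (flat k)) => //.
  near=> y; rewrite /flat ltNge ltW//=.
  by near: y; exact: lt_nbhsl.
- have xn0 : x != 0 by rewrite gt_eqF.
  rewrite /flat x0.
  apply: (@near_eq_is_derive _ _ _ (fun y => y^-1 ^+ k * expR (- y^-1)) (flat k)) => //.
    near=> y; rewrite /flat ifT//.
    by near: y; exact: lt_nbhsr.
  have d1 : is_derive x 1 (fun y : R => y^-1) (- x ^- 2).
    have d0 := is_derive_id x 1.
    have := is_deriveV xn0 d0 => h; apply: (is_derive_eq h).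
    by rewrite /GRing.scale/= mulr1.
  have d2 : is_derive x 1 (fun y : R => expR (- y^-1)) (expR (- x^-1) * x ^- 2).
    have d3 : is_derive x 1 (fun y : R => - y^-1) (x ^- 2).
      by apply: is_derive_eq; rewrite opprK.
    have d4 := is_derive_expR (- x^-1).
    exact: (@is_derive1_comp R expR (fun y => - y^-1) x _ _ d4 d3).
  have d5 : is_derive x 1 (fun y : R => y^-1 ^+ k) (k%:R * x^-1 ^+ k.-1 * (- x ^- 2)).
    have -> : (fun y : R => y^-1 ^+ k) = (GRing.inv : R -> R) ^+ k.
      by apply/funext => y; rewrite exprfctE.
    exact: is_deriveX.
  have d6 := is_deriveM d5 d2; apply: (is_derive_eq d6).
  rewrite /GRing.scale/=.
  case: k {d5 d6} => [|k] /=.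
    by rewrite !expr0 !exprVn mul0r; ring.
  rewrite -[in LHS]exprVn; move: (expR _) k.+1%:R => E N.
  by rewrite !exprS expr0; ring.
- rewrite /flat ltxx mulr0 subrr.
  (* By [flat_le] the difference quotient at 0 is at most $(k+2)!\,|h|$ in absolute value. *)
  have dd : h^-1 *: ((flat k \o shift 0) (h *: 1) - flat k 0) @[h --> 0^'] --> (0 : R).
    apply/cvgrPdist_le => e e0.
    have f0 : (0 : R) < k.+2`!%:R by rewrite ltr0n fact_gt0.
    near=> h; rewrite /= addr0 /GRing.scale/= mulr1 {2}/flat ltxx subr0 sub0r normrN.
    rewrite normrM normfV.
    have h0 : h != 0 by near: h; exact: nbhs_dnbhs_neq.
    rewrite ler_pdivrMl ?normr_gt0//.
    apply: le_trans (flat_le k h) _.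
    rewrite -(real_normK (num_real h)) expr2 mulrCA ler_wpM2l//.
    rewrite mulrC -ler_pdivlMr//.
    near: h; apply: dnbhs0_le; exact: divr_gt0.
  apply: DeriveDef; first by apply/cvg_ex; exists 0.
  exact: cvg_lim dd.
Unshelve. all: by end_near. Qed.
End Bump.

(** * Bumps converging to indicators, and the fundamental lemma of the calculus of variations *)

Section FundamentalLemma.
Variable R : realType.
Local Notation leb := (@lebesgue_measure R).
Implicit Types (x y t : R) (f g u v : R -> R).

(** An algebra of functions containing the affine rescalings of all [flat k]. It is stable under
    differentiation, so smoothness of its members needs one first-derivative computation per
    constructor. *)
Inductive flat_alg : (R -> R) -> Prop :=
| flat_alg_flat k (a b : R) : flat_alg (fun x => flat k (a * x + b))
| flat_alg_cst (a : R) : flat_alg (fun=> a)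
| flat_alg_add f g : flat_alg f -> flat_alg g -> flat_alg (fun x => f x + g x)
| flat_alg_mul f g : flat_alg f -> flat_alg g -> flat_alg (fun x => f x * g x).

Lemma flat_alg_derive f : flat_alg f ->
  exists2 g, flat_alg g & forall x, is_derive x 1 f (g x).
Proof.
elim=> {f} [k a b|a|f g _ [f' sf' df] _ [g' sg' dg]|f g sf [f' sf' df] sg [g' sg' dg]].
- exists (fun x => a * (flat k.+2 (a * x + b) + (- k%:R) * flat k.+1 (a * x + b))).
    by do ![constructor].
  move=> x.
  have d1 : is_derive x 1 (fun x => a * x + b) a.
    by apply: is_derive_eq; rewrite addr0; exact: mulr1.
  have d2 := flat_derive k (a * x + b).
  have := @is_derive1_comp R (flat k) (fun x => a * x + b) x _ _ d2 d1.
  by move=> h; apply: (is_derive_eq h); ring.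
- by exists (fun=> 0) => [|x]; [constructor|exact: is_derive_cst].
- exists (fun x => f' x + g' x) => [|x]; first by constructor.
  by have := is_deriveD (df x) (dg x).
- exists (fun x => f x * g' x + g x * f' x) => [|x].
    by constructor; constructor.
  by have := is_deriveM (df x) (dg x).
Qed.

Lemma flat_alg_derive1n f : flat_alg f -> forall k, flat_alg (derive1n k f).
Proof.
move=> sf; elim=> [//|k IH]; rewrite derive1nS.
have [g sg dg] := flat_alg_derive IH.
suff -> : derive1 (derive1n k f) = g by [].
by apply/funext => x; rewrite derive1E; have [_ ->] := dg x.
Qed.

Lemma flat_alg_derivable f x : flat_alg f -> derivable f x 1.
Proof. by move=> /flat_alg_derive[g _ /(_ x)[]]. Qed.

Lemma derivable_cont f : (forall x, derivable f x 1) -> continuous f.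
Proof. by move=> df x; apply/differentiable_continuous/derivable1_diffP. Qed.

Lemma flat_alg_continuous f : flat_alg f -> continuous f.
Proof. by move=> sf; apply: derivable_cont => x; exact: flat_alg_derivable. Qed.

Lemma antideriv_smooth f F : flat_alg f -> (forall x, is_derive x 1 F (f x)) ->
  forall k x, derivable (derive1n k F) x 1.
Proof.
move=> sf dF [|k] x; first by case: (dF x).
have -> : derive1n k.+1 F = derive1n k f.
  rewrite /derive1n iterSr; congr iter.
  by apply/funext => y; rewrite derive1E; case: (dF y).
exact/flat_alg_derivable/flat_alg_derive1n.
Qed.

Lemma flat0_ge0 x : 0 <= flat 0 x.
Proof. by rewrite /flat; case: ifP; rewrite // expr0 mul1r expR_ge0. Qed.

Lemma flat0_le1 x : flat 0 x <= 1.
Proof.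
rewrite /flat; case: ifP; rewrite // expr0 mul1r => x0.
by rewrite expR_le1 oppr_le0 invr_ge0 ltW.
Qed.

Lemma flat0_gt0 x : 0 < x -> 0 < flat 0 x.
Proof. by move=> x0; rewrite /flat x0 expr0 mul1r expR_gt0. Qed.

Lemma flat_le0 k x : x <= 0 -> flat k x = 0.
Proof. by move=> x0; rewrite /flat ltNge x0. Qed.

(* As n tends to infinity these bumps increase to the indicator of ]0, t[,
   with supports inside [1/n, t - 1/n]. *)
Definition bump (n : nat) t x : R :=
  flat 0 (n%:R * (n%:R * x - 1)) * flat 0 (n%:R * (n%:R * (t - x) - 1)).

Lemma bump_flat_alg n t : flat_alg (bump n t).
Proof.
have -> : bump n t = fun x =>
    flat 0 (n%:R ^+ 2 * x + - n%:R) * flat 0 (- n%:R ^+ 2 * x + (n%:R ^+ 2 * t - n%:R)).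
  by apply/funext => x; congr (flat 0 _ * flat 0 _); ring.
by constructor; constructor.
Qed.

Lemma bump_cont n t : {within `[0, 1], continuous (bump n t)}.
Proof. apply: continuous_subspaceT; exact: flat_alg_continuous (bump_flat_alg n t). Qed.

Lemma bump_norm n t x : `|bump n t x| <= 1.
Proof.
rewrite ger0_norm ?mulr_ge0 ?flat0_ge0//.
by rewrite mulr_ile1 ?flat0_ge0 ?flat0_le1.
Qed.

Lemma bump_out n t x : (0 < n)%N -> x <= n%:R^-1 \/ t - n%:R^-1 <= x -> bump n t x = 0.
Proof.
move=> n0; have n0' : (0 : R) < n%:R by rewrite ltr0n.
have aux y : y <= n%:R^-1 -> flat 0 (n%:R * (n%:R * y - 1)) = 0 :> R.
  move=> yn; apply: flat_le0; rewrite pmulr_rle0// subr_le0 mulrC.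
  by rewrite -ler_pdivlMr// mul1r.
by case=> h; rewrite /bump;
  [rewrite [X in X * _]aux ?mul0r|rewrite [X in _ * X]aux ?mulr0//; lra].
Qed.

(** The argument grows without bound, and $e^{-1/y}$ tends to $e^0=1$ as $y$ tends to infinity. *)
Lemma flat0_cvg (a : R) : 0 < a -> flat 0 (n%:R * (n%:R * a - 1)) @[n --> \oo] --> (1 : R).
Proof.
move=> a0.
have h : expR (- (n%:R * (n%:R * a - 1))^-1) @[n --> \oo] --> expR (0 : R).
  apply: (@cvg_comp _ _ _ (fun n : nat => - (n%:R * (n%:R * a - 1))^-1) (@expR R));
    last exact: continuous_expR.
  rewrite -oppr0; apply: cvgN.
  apply/cvgrPdist_le => e e0; near=> n.
  rewrite sub0r normrN normfV.
  have n1 : (1 : R) <= n%:R by rewrite ler1n; near: n; exact: nbhs_infty_gt.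
  have n2 : e^-1 + 1 <= n%:R * a.
    rewrite -ler_pdivrMr//; near: n; exact: nbhs_infty_ger.
  have ei : 0 < e^-1 by rewrite invr_gt0.
  have n3 : e^-1 <= n%:R * a - 1 by lra.
  have n4 : e^-1 <= n%:R * (n%:R * a - 1).
    by apply: le_trans n3 _; rewrite ler_peMl//; lra.
  rewrite ger0_norm; last by apply: le_trans n4; exact: ltW.
  by rewrite invf_ple// posrE; exact: lt_le_trans n4.
rewrite -[X in _ --> X]expR0; apply: cvg_trans h.
apply: near_eq_cvg; near=> n.
have n1 : (1 : R) <= n%:R by rewrite ler1n; near: n; exact: nbhs_infty_gt.
have n2 : 1 + 1 <= n%:R * a by rewrite -ler_pdivrMr//; near: n; exact: nbhs_infty_ger.
by rewrite /flat ifT ?expr0 ?mul1r// mulr_gt0//; lra.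
Unshelve. all: by end_near. Qed.

Lemma bump_cvg t x : bump n t x @[n --> \oo] --> ((\1_`]0, t[ x)%R : R).
Proof.
rewrite indicE mem_setE in_itv/=.
have z0 (h : forall n, bump n t x = 0) : bump n t x @[n --> \oo] --> (0 : R).
  by under eq_cvg do rewrite h; exact: cvg_cst.
have [x0|x0] := ltP 0 x; last first.
  apply: z0 => n; rewrite /bump [X in X * _]flat_le0 ?mul0r//.
  by rewrite mulr_ge0_le0// subr_le0 (le_trans _ ler01)// mulr_ge0_le0.
have [xt|xt] /= := ltP x t; last first.
  apply: z0 => n; rewrite /bump [X in _ * X]flat_le0 ?mulr0//.
  by rewrite mulr_ge0_le0// subr_le0 (le_trans _ ler01)// mulr_ge0_le0// subr_le0.
have := cvgM (flat0_cvg x0) (@flat0_cvg (t - x) _).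
by rewrite mulr1; apply; rewrite subr_gt0.
Qed.

(** Dominated convergence with bound $|v|$: the bumps lie between 0 and 1 and tend to the indicator
    of $]0,t[$, so every [prim v t] is 0. *)
Lemma fundamental v : int01 v ->
  (forall n t, (0 < n)%N -> 0 <= t <= 1 -> \int[leb]_(x in `]0, 1[) (v x * bump n t x) = 0) ->
  ae_eq leb (`]0, 1[%classic : set R) v (fun=> 0).
Proof.
move=> iv vb; apply: prim_eq0_ae => // t t01.
have iv' : leb.-integrable `]0, 1[ (EFin \o v) := iv.
have mv := int01_meas iv.
(* The index is shifted to [n.+1] because the hypothesis is available for positive indices. *)
have : (\int[leb]_(x in `]0%R, 1%R[) (v x * bump n.+1 t x)%:E)%E @[n --> \oo] -->
    (\int[leb]_(x in `]0%R, 1%R[) (v x * \1_`]0, t[ x)%:E)%E.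
  have mb n : measurable_fun (`]0, 1[ : set R) (bump n t).
    apply: cont01_meas. exact: bump_cont.
  have := @dominated_convergence _ _ R leb `]0, 1[ (measurable_itv _)
    (fun n x => (v x * bump n.+1 t x)%:E) (fun x => (v x * \1_`]0, t[ x)%:E)
    (fun x => `|v x|%:E).
  case.
  - move=> n; apply/measurable_EFinP; apply: measurable_funM; [exact: mv|exact: mb].
  - apply/measurable_EFinP; apply: measurable_funM => //.
  - apply: aeW => x _; apply: cvg_EFin; first by near=> n.
    apply: cvgM; first exact: cvg_cst.
    have h := @bump_cvg t x.
    have := cvg_shiftS (fun n => bump n t x) (nbhs (\1_`]0, t[ x : R)).
    by move=> h'; move: h; rewrite -h'.
  - exact: integrable_norm iv'.
  - apply: aeW => x n _; rewrite lee_fin normrM ler_piMr//; exact: bump_norm.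
  by [].
have -> : (fun n => (\int[leb]_(x in `]0%R, 1%R[) (v x * bump n.+1 t x)%:E)%E) = fun=> 0%E.
  apply/funext => n.
  have hi : leb.-integrable `]0, 1[ (EFin \o (fun x => v x * bump n.+1 t x)).
    by apply: int01M => //; exact: bump_cont.
  have fi : (\int[leb]_(x in `]0%R, 1%R[) (v x * bump n.+1 t x)%:E)%E \is a fin_num.
    exact: integrable_fin_num hi.
  by rewrite -(fineK fi) -/(Rintegral _ _ _) vb.
move=> h; have {h} := cvg_unique (@ereal_hausdorff R) (cvg_cst _) h.
move=> h0.
rewrite /prim; transitivity (\int[leb]_(x in `]0, 1[) (v x * \1_`]0, t[ x)).
  rewrite [LHS]Rintegral_mkcond [RHS]Rintegral_mkcond; apply: eq_Rintegral => x _.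
  rewrite !patchE indicE; case: ifPn => xt; last first.
    by rewrite mulr0 if_same.
  rewrite mulr1 ifT//; move: xt; rewrite !inE/= !in_itv/= => /andP[->]/= xt.
  by apply: lt_le_trans xt _; case/andP: t01.
by rewrite /Rintegral -h0.
Unshelve. all: by end_near. Qed.

(** A nonzero difference at one point persists on a nonempty open subinterval of $]0,1[$, which has
    positive measure. *)
Lemma cont_ae_eq (U W : R -> R) :
  {within `[0, 1], continuous U} -> {within `[0, 1], continuous W} ->
  ae_eq leb (`]0, 1[%classic : set R) U W -> forall x, 0 <= x <= 1 -> U x = W x.
Proof.
move=> cU cW UW x0 x01; apply/eqP; rewrite -subr_eq0; apply/negPn/negP => D0.
pose D x := U x - W x.
have cD : {within `[0, 1], continuous D}.
  by move=> x; apply: continuousB; [exact: (cU x)|exact: (cW x)].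
have /(_ x0) := (@subspace_continuousP R (`[0, 1]%classic : set R) R D).1 cD.
rewrite /= in_itv/= => /(_ x01).
move=> /cvgrPdist_lt /(_ `|D x0|); rewrite normr_gt0 => /(_ D0).
rewrite near_withinE => /nbhs_ballP[e /= e0 be].
(* The ball around [x0] is cut down to $]0,1[$; the result is a nondegenerate interval even when
   [x0] is 0 or 1. *)
pose a := Num.max 0 (x0 - e); pose b := Num.min 1 (x0 + e).
have ab : a < b.
  rewrite /a /b gt_max !lt_min; case/andP: x01 => h1 h2.
  by rewrite ltr01/=; apply/andP; split; [lra|apply/andP; split; lra].
have [N [mN N0 sN]] := UW.
have sub : (`]a, b[ : set R) `<=` N.
  move=> y; rewrite /= in_itv/= gt_max lt_min => /andP[/andP[y0 y1] /andP[y2 y3]].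
  apply: sN => /= UWy; have := be y; rewrite /ball/=.
  have -> : `|x0 - y| < e by rewrite ltr_norml; apply/andP; split; lra.
  rewrite in_itv/= !ltW// /D UWy ?in_itv/= ?y0//.
  by rewrite subrr subr0 ltxx => /(_ isT isT).
have : (leb `]a, b[ <= leb N)%E by apply: le_measure => //; rewrite inE.
by rewrite N0 lebesgue_measure_itv/= lte_fin ab -EFinD lee_fin leNgt subr_gt0 ab.
Qed.

End FundamentalLemma.

(** * The du Bois-Reymond lemma *)

Section DuBoisReymond.
Variable R : realType.
Local Notation leb := (@lebesgue_measure R).
Implicit Types (x y t d : R) (f g u v F : R -> R).

Lemma flat_alg_int01 f : flat_alg f -> int01 f.
Proof.
move=> sf; apply: (@integrableS _ _ _ leb `[0, 1]%classic) => //.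
  exact: subset_itv_oo_cc.
apply: continuous_compact_integrable; first exact: segment_compact.
exact/continuous_subspaceT/flat_alg_continuous.
Qed.

(** The integral of [f] from the left vanishes up to $d$, and from $1-d$ on it equals the total
    integral, hence vanishes there as well: the zero mean makes the support compact. *)
Lemma flat_alg_antiderivative f d : flat_alg f -> 0 < d ->
  (forall x, x <= d \/ 1 - d <= x -> f x = 0) -> prim f 1 = 0 ->
  exists2 F, test_fun F & derive1 F = f.
Proof.
move=> sf d0 fd f1; have if01 := flat_alg_int01 sf.
pose F y := \int[leb]_(t in `]-oo, y]) f t.
have f01 x : ~~ (0 < x < 1) -> f x = 0.
  by rewrite negb_and -!leNgt => /orP[] x1; apply: fd; [left|right]; lra.
have fi : leb.-integrable setT (EFin \o f).
  have -> : EFin \o f = (EFin \o f) \_ `]0, 1[.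
    apply/funext => x; rewrite patchE; case: ifPn => //.
    by rewrite notin_setE/= in_itv/= => /negP/f01 ->.
  exact/(integrable_mkcond _ _).1.
have dF x : is_derive x 1 F (f x).
  have [||||h1 h2] := @continuous_FTC1 R f -oo%O x (x + 1).
  - by rewrite ltrDl.
  - exact: integrableS fi.
  - exact: ltNyr.
  - exact: flat_alg_continuous.
  by apply: DeriveDef; [exact: h1|rewrite -derive1E; exact: h2].
exists F; last by apply/funext => x; rewrite derive1E; case: (dF x).
have F0 x : x <= d -> F x = 0.
  move=> xd; rewrite /F (_ : \int[leb]_(t in _) f t = \int[leb]_(t in `]-oo, x]) cst 0 t).
    by rewrite Rintegral_cst// mul0r.
  apply: eq_Rintegral => t; rewrite inE/= in_itv/= => tx; apply: fd.
  by left; exact: le_trans tx xd.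
have F1 x : 1 - d <= x -> F x = 0.
  move=> xd.
  rewrite -f1 /prim /F Rintegral_mkcond [RHS]Rintegral_mkcond.
  apply: eq_Rintegral => t _; rewrite !patchE.
  case: ifPn => tx; case: ifPn => t1 //.
    by apply: f01; move: t1; rewrite notin_setE/= in_itv/= => /negP.
  rewrite fd//; right; apply: (le_trans xd); rewrite ltW//.
  by move: tx; rewrite notin_setE/= in_itv/= => /negP; rewrite -ltNge.
split; first exact: antideriv_smooth sf dF.
have : closure [set x | F x != 0] `<=` `[d, 1 - d].
  have cl : closed (`[d, 1 - d]%classic : set R) by exact: itv_closed.
  rewrite [X in _ `<=` X]((closure_id _).1 cl).
  apply: closure_subset => x /= Fx; rewrite in_itv/=; apply/andP; split.
    by rewrite leNgt; apply: contra Fx => xd; rewrite F0// ltW.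
  by rewrite leNgt; apply: contra Fx => xd; rewrite F1// ltW.
move=> h x /h; rewrite /= !in_itv/= => /andP[h1 h2].
by apply/andP; split; lra.
Qed.

(** [bump n 1] is positive on $]1/n,1-1/n[$, which is nonempty from $n=3$ on; positivity at $1/2$
    contradicts a zero integral of a continuous nonnegative function. *)
Lemma bump_prim_neq0 : prim (bump 3 1) 1 != 0 :> R.
Proof.
have ib := flat_alg_int01 (@bump_flat_alg R 3 1).
apply/eqP => b0.
have := isprim_ge0_eq0 (isprim_prim ib); rewrite prim0 => /(_ _ b0) h.
have {}h : ae_eq leb (`]0, 1[%classic : set R) (bump 3 1) (fun=> 0).
  by apply: h => x _; rewrite mulr_ge0// flat0_ge0.
have := @cont_ae_eq R _ _ (@bump_cont R 3 1) _ h 2^-1.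
move=> /(_ (isprim_cont (isprim_cst 0))).
have -> : 0 <= (2^-1 : R) <= 1 by apply/andP; split; lra.
move=> /(_ isT)/eqP; rewrite gt_eqF//.
by rewrite mulr_gt0// flat0_gt0//; lra.
Qed.

(** A bump corrected by a multiple of the fixed bump [rho] to have mean zero is the derivative of a
    test function. Hence [u - K], with [K] the [rho]-weighted mean of [u], annihilates every
    bump. *)
Lemma du_bois_reymond u : int01 u ->
  (forall phi, test_fun phi -> \int[leb]_(x in `]0, 1[) (u x * derive1 phi x) = 0) ->
  exists K : R, ae_eq leb (`]0, 1[%classic : set R) u (fun=> K).
Proof.
move=> iu uphi.
pose rho := @bump R 3 1; have I0 := bump_prim_neq0; rewrite -/rho in I0.
have irho : int01 rho by exact/flat_alg_int01/bump_flat_alg.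
pose K := prim (fun x => u x * rho x) 1 / prim rho 1.
have iub n t : int01 (fun x => u x * bump n t x) by exact/int01M/bump_cont.
exists K.
suff : ae_eq leb (`]0, 1[%classic : set R) (fun x => u x - K) (fun=> 0).
  by apply: filterS => x /[apply] /eqP; rewrite subr_eq0 => /eqP.
have iK : int01 (fun=> K : R) by exact/flat_alg_int01/flat_alg_cst.
apply: fundamental; first exact: int01B.
move=> n t n0 t01.
have ib : int01 (@bump R n t) by exact/flat_alg_int01/bump_flat_alg.
(* The multiple of [rho] that cancels the integral of the bump. *)
pose c := prim (bump n t) 1 / prim rho 1.
pose f x := bump n t x + (- c) * rho x.
have sf : flat_alg f :=
  flat_alg_add (bump_flat_alg n t) (flat_alg_mul (flat_alg_cst (- c)) (bump_flat_alg 3 1)).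
(* [bump n t] keeps the margin $1/n$ from both ends and [rho] the margin $1/3$; the minimum serves
   both. *)
have d0 : 0 < Num.min (n%:R^-1) (3^-1 : R).
  by rewrite lt_min !invr_gt0 ltr0n n0/=; lra.
have fout x : x <= Num.min (n%:R^-1) 3^-1 \/ 1 - Num.min (n%:R^-1) 3^-1 <= x -> f x = 0.
  have m1 : Num.min (n%:R^-1) (3^-1 : R) <= n%:R^-1 by rewrite ge_min lexx.
  have m2 : Num.min (n%:R^-1) (3^-1 : R) <= 3^-1 by rewrite ge_min lexx orbT.
  move=> hx; rewrite /f /rho !bump_out ?mulr0 ?addr0//.
    by case: hx => hx; [left|right]; lra.
  by case/andP: t01 => _ t1; case: hx => hx; [left|right]; lra.
have f1 : prim f 1 = 0.
  rewrite /f (primD ib (int01Z _ irho) (lexx 1)) (primZ _ irho (lexx 1)) /c.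
  by move: (prim _ _) (prim _ _) I0 => a b b0; field.
have [F tF dF] := flat_alg_antiderivative sf d0 fout f1.
have := uphi F tF; rewrite dF => h.
have h1 : prim (fun x => u x * bump n t x) 1 = c * prim (fun x => u x * rho x) 1.
  apply/eqP; rewrite -subr_eq0 -mulNr -(primZ _ (iub 3 1) (lexx 1)).
  rewrite -(primD (iub n t) (int01Z _ (iub 3 1)) (lexx 1)).
  rewrite -{}[X in _ == X]h; apply/eqP/eq_Rintegral => x _.
  by rewrite /f /rho; ring.
transitivity (prim (fun x => u x * bump n t x + (- K) * bump n t x) 1).
  by apply: eq_Rintegral => x _; ring.
rewrite (primD (iub n t) (int01Z _ ib) (lexx 1)) (primZ _ ib (lexx 1)) h1 /K /c.
by move: (prim (bump n t) 1) (prim rho 1) I0 (prim _ 1) => a b b0 d; field.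
Qed.

End DuBoisReymond.

(** * Weak derivatives and continuous representatives *)

Section WeakDerivatives.
Variable R : realType.
Local Notation leb := (@lebesgue_measure R).
Local Notation C := R[i].
Local Notation Re := (@complex.Re R).
Local Notation Im := (@complex.Im R).
Local Notation I01 := (`]0, 1[%classic : set R).
Implicit Types (u v w U V W : R -> C) (x y : R) (z : C) (phi : R -> R).

Lemma normc_sqr z : Normc.normc z ^+ 2 = Re z ^+ 2 + Im z ^+ 2.
Proof. by case: z => a b /=; rewrite sqr_sqrtr// addr_ge0// sqr_ge0. Qed.

Lemma L2_measRe u : is_L2 u -> measurable_fun I01 (fun x => Re (u x)).
Proof. by case. Qed.

Lemma L2_measIm u : is_L2 u -> measurable_fun I01 (fun x => Im (u x)).
Proof. by case. Qed.

Lemma L2_int u : is_L2 u -> int01 (fun x => Normc.normc (u x) ^+ 2).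
Proof. by case. Qed.

Lemma int01_cst (k : R) : int01 (fun=> k).
Proof. exact/flat_alg_int01/flat_alg_cst. Qed.

Lemma int01_le (f g : R -> R) : measurable_fun I01 f ->
  (forall x, 0 < x < 1 -> `|f x| <= g x) -> int01 g -> int01 f.
Proof.
move=> mf fg; apply: le_integrable => //; first exact/measurable_EFinP.
move=> x; rewrite /= in_itv/= => x01; rewrite lee_fin.
by apply: le_trans (fg _ x01) _; exact: ler_norm.
Qed.

(** The interval has finite measure and $|a|\le 1+a^2$. *)
Lemma L2_intC u : is_L2 u -> intC u.
Proof.
move=> L2u; have := int01D (int01_cst 1) (L2_int L2u) => ig.
have sq (a : R) : `|a| <= 1 + a ^+ 2.
  rewrite -(real_normK (num_real a)).
  have := sqr_ge0 (`|a| - 1); rewrite sqrrB1.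
  by have := normr_ge0 a; move: `|a| => t t0; rewrite mulr2n; nra.
split.
  apply: int01_le ig => [|x _]; first exact: L2_measRe.
  by rewrite normc_sqr; apply: le_trans (sq _) _; rewrite lerD2l lerDl sqr_ge0.
apply: int01_le ig => [|x _]; first exact: L2_measIm.
by rewrite normc_sqr; apply: le_trans (sq _) _; rewrite lerD2l lerDr sqr_ge0.
Qed.

Lemma meas_normc_sqr u : measurable_fun I01 (fun x => Re (u x)) ->
  measurable_fun I01 (fun x => Im (u x)) ->
  measurable_fun I01 (fun x => Normc.normc (u x) ^+ 2).
Proof.
move=> mR mI.
have -> : (fun x => Normc.normc (u x) ^+ 2) = (fun x => Re (u x) ^+ 2 + Im (u x) ^+ 2).
  by apply/funext => x; rewrite normc_sqr.
by apply: measurable_funD; apply: measurable_funX.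
Qed.

Lemma L2D u v : is_L2 u -> is_L2 v -> is_L2 (fun x => u x + v x).
Proof.
move=> L2u L2v.
have mR : measurable_fun I01 (fun x => Re (u x + v x)).
  have -> : (fun x => Re (u x + v x)) = (fun x => Re (u x) + Re (v x)).
    by apply/funext => x; rewrite cReD.
  by apply: measurable_funD; exact: L2_measRe.
have mI : measurable_fun I01 (fun x => Im (u x + v x)).
  have -> : (fun x => Im (u x + v x)) = (fun x => Im (u x) + Im (v x)).
    by apply/funext => x; rewrite cImD.
  by apply: measurable_funD; exact: L2_measIm.
split=> //.
have ig := int01D (int01Z 2 (L2_int L2u)) (int01Z 2 (L2_int L2v)).
apply: int01_le ig => [|x _].
  exact: meas_normc_sqr.
rewrite ger0_norm ?sqr_ge0// !normc_sqr cReD cImD.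
have h (a b : R) : (a + b) ^+ 2 <= 2 * a ^+ 2 + 2 * b ^+ 2.
  by have := sqr_ge0 (a - b); rewrite -subr_ge0 -[in X in _ -> X]subr_ge0; nra.
have := h (Re (u x)) (Re (v x)); have := h (Im (u x)) (Im (v x)); lra.
Qed.

Lemma L2Z z u : is_L2 u -> is_L2 (fun x => z * u x).
Proof.
move=> L2u.
have mR : measurable_fun I01 (fun x => Re (z * u x)).
  have -> : (fun x => Re (z * u x)) = (fun x => Re z * Re (u x) - Im z * Im (u x)).
    by apply/funext => x; rewrite cReM.
  apply: measurable_funB; apply: measurable_funM => //.
    exact: L2_measRe. exact: L2_measIm.
have mI : measurable_fun I01 (fun x => Im (z * u x)).
  have -> : (fun x => Im (z * u x)) = (fun x => Re z * Im (u x) + Im z * Re (u x)).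
    by apply/funext => x; rewrite cImM.
  apply: measurable_funD; apply: measurable_funM => //.
    exact: L2_measIm. exact: L2_measRe.
split=> //.
have ig := int01Z (Normc.normc z ^+ 2) (L2_int L2u).
by apply: eq_integrable ig => // x _ /=; rewrite Normc.normcM exprMn.
Qed.

Lemma L2_cont U : {within `[0, 1], continuous (fun x => Re (U x))} ->
  {within `[0, 1], continuous (fun x => Im (U x))} -> is_L2 U.
Proof.
move=> cR cI; split; [exact: cont01_meas|exact: cont01_meas|].
have ig : int01 (fun x => Re (U x) * Re (U x) + Im (U x) * Im (U x)).
  have h (F : R -> R) : {within `[0, 1], continuous F} -> int01 (fun x => F x * F x).
    move=> cF; apply: int01M => //.
    have := int01M (int01_cst 1) cF; apply: eq_integrable => // x _ /=.
    by rewrite mul1r.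
  by apply: int01D; exact: h.
by apply: eq_integrable ig => // x _ /=; rewrite normc_sqr !expr2.
Qed.

Lemma L2_cprim U v : cprim U v -> is_L2 U.
Proof. by move=> [/isprim_cont ? /isprim_cont ?]; exact: L2_cont. Qed.

Lemma test_fun_derive phi : test_fun phi -> isprim phi (derive1 phi).
Proof.
move=> [dphi _]; apply: isprim_derive => [x|].
  by rewrite derive1E; apply: DeriveDef => //; exact: (dphi 0).
by apply: derivable_cont => x; exact: (dphi 1).
Qed.

Lemma test_fun_out phi x : test_fun phi -> ~~ (0 < x < 1) -> phi x = 0.
Proof.
move=> [_ sphi] x01; apply/eqP/negPn/negP => px; move/negP : x01; apply.
have := sphi x; rewrite /= in_itv/=; apply; exact: subset_closure.
Qed.

(** Integrate the product rule for [U] and [phi]; the boundary terms vanish because a test function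
    is 0 at both ends. *)
Lemma isprim_by_parts (U v : R -> R) phi : isprim U v -> test_fun phi ->
  \int[leb]_(x in `]0, 1[) (U x * derive1 phi x) =
  - \int[leb]_(x in `]0, 1[) (v x * phi x).
Proof.
move=> pU tphi; have pp := test_fun_derive tphi.
have [_ /(_ 1)] := isprimM pU pp.
have p0 : phi 0 = 0 by apply: test_fun_out; rewrite // ltxx.
have p1 : phi 1 = 0 by apply: test_fun_out; rewrite // ltxx andbF.
rewrite lexx ler01 p0 p1 !mulr0 => /(_ isT).
have [i1 i2] := (isprim_int pU, isprim_int pp).
have i3 := int01M i1 (isprim_cont pp); have i4 := int01M i2 (isprim_cont pU).
rewrite primD// add0r => /esym/eqP; rewrite addrC addr_eq0 => /eqP h.
by rewrite -[X in _ = - X]/(prim _ 1) -h; apply: eq_Rintegral => x _; rewrite mulrC.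
Qed.

Lemma Cintegral_real u phi : Cintegral01 (fun x => u x * (phi x)%:C) =
  (\int[leb]_(x in `]0, 1[) (Re (u x) * phi x)) +i*
  (\int[leb]_(x in `]0, 1[) (Im (u x) * phi x)).
Proof.
by congr (_ +i* _); apply: eq_Rintegral => x _; case: (u x) => a b /=; ring.
Qed.

Lemma cprim_weak U u v : cprim U v -> is_L2 v -> is_L2 u ->
  ae_eq leb I01 u U -> is_weak_derivative u v.
Proof.
move=> [pR pI] L2v L2u uU; split=> // phi tphi.
have pp := test_fun_derive tphi; have [ip _] := pp.
have [uR uI] := L2_intC L2u.
have cdphi : {within `[0, 1], continuous (derive1 phi)}.
  apply: continuous_subspaceT; apply: derivable_cont => x.
  by have [/(_ 1 x)] := tphi.
rewrite !Cintegral_real.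
have E (F G : R -> R) : int01 F -> int01 G -> ae_eq leb I01 F G ->
    \int[leb]_(x in `]0, 1[) (F x * derive1 phi x) =
    \int[leb]_(x in `]0, 1[) (G x * derive1 phi x).
  move=> iF iG FG; apply: (prim_ae (int01M iF cdphi) (int01M iG cdphi) (lexx 1)).
  by apply: filterS FG => x /= /[apply] ->.
have [UR UI] := L2_intC (@L2_cont U (isprim_cont pR) (isprim_cont pI)).
rewrite (E _ (fun x => Re (U x)) uR UR); last first.
  by apply: filterS uU => x /= /[apply] ->.
rewrite (E _ (fun x => Im (U x)) uI UI); last first.
  by apply: filterS uU => x /= /[apply] ->.
rewrite (isprim_by_parts pR tphi) (isprim_by_parts pI tphi).
by [].
Qed.

(** The difference between [u] and the primitive of [v] pairs to zero with all derivatives of test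
    functions. By du Bois-Reymond, applied to real and imaginary parts, it is constant almost
    everywhere. *)
Lemma weak_cprim u v : is_L2 u -> is_weak_derivative u v ->
  exists2 U, cprim U v & ae_eq leb I01 u U.
Proof.
move=> L2u [L2v wv].
have pP := cprim_primC (L2_intC L2v); have [pR pI] := pP.
have [PR PI] := L2_intC (L2_cprim pP).
have [uR uI] := L2_intC L2u.
have h phi : test_fun phi ->
  \int[leb]_(x in `]0, 1[) ((Re (u x) - Re (primC v x)) * derive1 phi x) = 0 /\
  \int[leb]_(x in `]0, 1[) ((Im (u x) - Im (primC v x)) * derive1 phi x) = 0.
  move=> tphi; have := wv _ tphi; rewrite !Cintegral_real => -[].
  rewrite -(isprim_by_parts pR tphi) -(isprim_by_parts pI tphi) => h1 h2.
  have cdphi : {within `[0, 1], continuous (derive1 phi)}.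
    apply: continuous_subspaceT; apply: derivable_cont => x.
    by have [/(_ 1 x)] := tphi.
  split.
    under eq_Rintegral do rewrite mulrBl.
    rewrite RintegralB//; [|exact: int01M..].
    by rewrite h1 subrr.
  under eq_Rintegral do rewrite mulrBl.
  rewrite RintegralB//; [|exact: int01M..].
  by rewrite h2 subrr.
have [a ha] := du_bois_reymond (int01B uR PR) (fun phi t => (h phi t).1).
have [b hb] := du_bois_reymond (int01B uI PI) (fun phi t => (h phi t).2).
exists (fun x => primC v x + (a +i* b)).
  by apply: cprim_eq (cprimD pP (cprim_cst (a +i* b))) => // x _; rewrite addr0.
apply: filterS2 ha hb => x /= ha hb x01.
apply: complex_eqP; rewrite ?cReD ?cImD /=.
  by rewrite -ha// addrC subrK.
by rewrite -hb// addrC subrK.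
Qed.

End WeakDerivatives.

(** * Second-order Sobolev functions and the domain in terms of continuous versions *)

Section Sobolev2.
Variable R : realType.
Local Notation leb := (@lebesgue_measure R).
Local Notation C := R[i].
Local Notation Re := (@complex.Re R).
Local Notation Im := (@complex.Im R).
Local Notation I01 := (`]0, 1[%classic : set R).
Implicit Types (u v w U V W : R -> C) (x y : R) (z : C).

(** Existence of one weak derivative controls the one picked by choice: its continuous primitive
    also represents [u], so it agrees with [U] on $[0,1]$, and the density of [U] is unique almost
    everywhere. *)
Lemma weak_derivativeP U u v : cprim U v -> is_L2 v -> is_L2 u ->
  ae_eq leb I01 u U ->
  is_weak_derivative u (weak_derivative u) /\ ae_eq leb I01 (weak_derivative u) v.
Proof.
move=> pU L2v L2u uU.
have wv := cprim_weak pU L2v L2u uU.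
have ww : is_weak_derivative u (weak_derivative u).
  exact: (@xgetPex _ (fun=> 0) [set v | is_weak_derivative u v] (ex_intro _ _ wv)).
split=> //.
have [W pW uW] := weak_cprim L2u ww.
have UW : ae_eq leb I01 U W by apply: filterS2 uU uW => x /= + + x01 => -> // ->.
have [[UR UI] [WR WI]] := (pU, pW).
have ER := cont_ae_eq (isprim_cont UR) (isprim_cont WR).
have EI := cont_ae_eq (isprim_cont UI) (isprim_cont WI).
have pU' : cprim U (weak_derivative u).
  apply: cprim_eq pW => // x x01; apply/esym/complex_eqP.
    by apply: ER => //; apply: filterS UW => y /= /[apply] ->.
  by apply: EI => //; apply: filterS UW => y /= /[apply] ->.
exact: cprim_uniq pU' pU.
Qed.

Lemma is_continuous_rep_eq U v u W x : cprim U v -> ae_eq leb I01 u U ->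
  is_continuous_rep u W -> 0 <= x <= 1 -> W x = U x.
Proof.
move=> [UR UI] uU [cR cI Wu] x01.
have UW : ae_eq leb I01 W U by apply: filterS2 uU Wu => y /= + + y01 => -> // ->.
apply: complex_eqP.
  apply: (cont_ae_eq cR (isprim_cont UR)) x01.
  by apply: filterS UW => y /= /[apply] ->.
apply: (cont_ae_eq cI (isprim_cont UI)) x01.
by apply: filterS UW => y /= /[apply] ->.
Qed.

Lemma continuous_rep_eq U v u x : cprim U v -> ae_eq leb I01 u U ->
  0 <= x <= 1 -> continuous_rep u x = U x.
Proof.
move=> pU uU; apply: (is_continuous_rep_eq pU uU).
apply: (@xgetPex _ u [set W | is_continuous_rep u W]).
exists U; have [UR UI] := pU.
split; [exact: isprim_cont UR|exact: isprim_cont UI|].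
by apply: filterS uU => y /= /[apply] ->.
Qed.

(** [U] and [V] are the continuous versions of $u$ and $u'$, and [v] is a version of $u''$; later
    arguments use this triple in place of the derivatives obtained by choice. *)
Definition H2rep u U V v : Prop :=
  [/\ is_L2 u, cprim U V, cprim V v, is_L2 v & ae_eq leb I01 u U].

Lemma is_H2P u : is_H2 u <-> exists U V v, H2rep u U V v.
Proof.
split=> [[[L2u [v1 wv1]] [L2w [v wv]]]|[U [V [v [L2u pU pV L2v uU]]]]].
  have [U pU uU] := weak_cprim L2u wv1.
  have L2v1 : is_L2 v1 by case: wv1.
  have [ww wv1E] := weak_derivativeP pU L2v1 L2u uU.
  have [V pV wV] := weak_cprim L2w wv.
  exists U, V, v; split=> //; last by case: wv.
  have [mR mI] := L2_intC (L2_cprim pV).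
  (* The weak derivative under the integral is replaced by its continuous version [V], equal to it
     almost everywhere. *)
  apply: (cprim_ae _ _ _ pU); [exact: int01_meas mR|exact: int01_meas mI|].
  by apply: filterS2 wv1E wV => x /= h1 h2 x01; rewrite -h1// h2.
have L2V := L2_cprim pV.
have [ww wV] := weak_derivativeP pU L2V L2u uU.
split; first by split=> //; exists V; exact: cprim_weak pU L2V L2u uU.
have L2w : is_L2 (weak_derivative u) by case: ww.
by split=> //; exists v; exact: cprim_weak pV L2v L2w wV.
Qed.

Lemma H2rep_weak u U V v : H2rep u U V v ->
  ae_eq leb I01 (weak_derivative u) V /\
  ae_eq leb I01 (weak_derivative (weak_derivative u)) v.
Proof.
move=> [L2u pU pV L2v uU].
have [ww wV] := weak_derivativeP pU (L2_cprim pV) L2u uU.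
have L2w : is_L2 (weak_derivative u) by case: ww.
by have [] := weak_derivativeP pV L2v L2w wV.
Qed.

Lemma H2rep_value u U V v x : H2rep u U V v -> 0 <= x <= 1 ->
  continuous_rep u x = U x /\ continuous_rep (weak_derivative u) x = V x.
Proof.
move=> h x01; have [wV _] := H2rep_weak h.
have [L2u pU pV L2v uU] := h.
by rewrite (continuous_rep_eq pU uU)// (continuous_rep_eq pV wV).
Qed.

Lemma H2rep_L2 u U V v : H2rep u U V v -> is_L2 (weak_derivative (weak_derivative u)).
Proof.
move=> [L2u pU pV L2v uU].
have [ww wV] := weak_derivativeP pU (L2_cprim pV) L2u uU.
have L2w : is_L2 (weak_derivative u) by case: ww.
by have [[]] := weak_derivativeP pV L2v L2w wV.
Qed.

Section NetworkDomain.
Variables (n m : nat) (e0 e1 : 'I_m -> 'I_n) (mu c : 'I_m -> R).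
Implicit Types (f g : R -> 'cV[C]_m).

Definition kirchhoff (V : 'I_m -> R -> C) : Prop :=
  forall i, \sum_(j | e0 j == i) (mu j * c j)%:C * V j 0 =
            \sum_(j | e1 j == i) (mu j * c j)%:C * V j 1.

Definition node_values (U : 'I_m -> R -> C) (d : 'cV[C]_n) : Prop :=
  forall j, U j 0 = d (e0 j) 0 /\ U j 1 = d (e1 j) 0.

Definition rep f (U V v : 'I_m -> R -> C) : Prop :=
  forall j, H2rep (entry f j) (U j) (V j) (v j).

Lemma entry_wderiv f j : entry (wderiv f) j = weak_derivative (entry f j).
Proof. by apply/funext => x; rewrite /entry mxE. Qed.

Lemma sum_indic (F : 'I_m -> C) (P : pred 'I_m) :
  \sum_j F j * (P j)%:R = \sum_(j | P j) F j.
Proof.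
rewrite [RHS]big_mkcond; apply: eq_bigr => j _.
by case: (P j); rewrite ?mulr1 ?mulr0.
Qed.

Lemma Phiw_plusE (w : 'cV[C]_m) i :
  (Phiw_plus e0 mu c *m w) i 0 = \sum_(j | e0 j == i) (mu j * c j)%:C * w j 0.
Proof.
rewrite mxE -[RHS]sum_indic; apply: eq_bigr => j _; rewrite !mxE; exact: mulrAC.
Qed.

Lemma Phiw_minusE (w : 'cV[C]_m) i :
  (Phiw_minus e1 mu c *m w) i 0 = \sum_(j | e1 j == i) (mu j * c j)%:C * w j 0.
Proof.
rewrite mxE -[RHS]sum_indic; apply: eq_bigr => j _; rewrite !mxE; exact: mulrAC.
Qed.

Lemma trPhi_plusE (d : 'cV[C]_n) j : ((Phi_plus R e0)^T *m d) j 0 = d (e0 j) 0.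
Proof.
rewrite mxE (bigD1 (e0 j))//= !mxE eqxx mul1r big1 ?addr0// => i ij.
by rewrite !mxE eq_sym (negPf ij) mul0r.
Qed.

Lemma trPhi_minusE (d : 'cV[C]_n) j : ((Phi_minus R e1)^T *m d) j 0 = d (e1 j) 0.
Proof.
rewrite mxE (bigD1 (e1 j))//= !mxE eqxx mul1r big1 ?addr0// => i ij.
by rewrite !mxE eq_sym (negPf ij) mul0r.
Qed.

Lemma eq_X2P f g : eq_X2 f g <-> forall j, ae_eq leb I01 (entry f j) (entry g j).
Proof.
split=> [fg j|fg].
  by apply: filterS fg => x /= /[apply] h; rewrite /entry h.
have : \forall x \ae leb, forall j, I01 x -> entry f j x = entry g j x.
  by apply: filter_forall => j; exact: (fg j).
apply: (@filterS _ _ (ae_filter_ringOfSetsType leb)) => x h x01.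
by apply/colP => j; exact: h.
Qed.

Lemma rep_value f (U V v : 'I_m -> R -> C) x : rep f U V v -> 0 <= x <= 1 ->
  (forall j, value f x j 0 = U j x) /\ (forall j, value (wderiv f) x j 0 = V j x).
Proof.
move=> rf x01; split=> j; rewrite mxE ?entry_wderiv.
  by have [] := H2rep_value (rf j) x01.
by have [] := H2rep_value (rf j) x01.
Qed.

(** The boundary values of $f$ and $f'$ are those of the continuous versions, so the matrix
    conditions can be read vertex by vertex and edge by edge. *)
Lemma domAP f : domA e0 e1 mu c f <-> exists U V v : 'I_m -> R -> C,
  [/\ rep f U V v, kirchhoff V & exists d, node_values U d].
Proof.
have x0 : 0 <= (0 : R) <= 1 by rewrite lexx ler01.
have x1 : 0 <= (1 : R) <= 1 by rewrite lexx ler01.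
split=> [[H2f kf [d [d0 d1]]]|[U [V [v [rf kV [d dU]]]]]].
  have /choice[T hT] : forall j, exists T : (R -> C) * (R -> C) * (R -> C),
      H2rep (entry f j) T.1.1 T.1.2 T.2.
    by move=> j; have /is_H2P[U [V [v h]]] := H2f j; exists (U, V, v).
  exists (fun j => (T j).1.1), (fun j => (T j).1.2), (fun j => (T j).2).
  have rf : rep f (fun j => (T j).1.1) (fun j => (T j).1.2) (fun j => (T j).2) := hT.
  have [U0 V0] := rep_value rf x0; have [U1 V1] := rep_value rf x1.
  split=> //.
    move=> i; have /colP/(_ i) := kf; rewrite Phiw_plusE Phiw_minusE.
    under eq_bigr do rewrite V0.
    by under [in X in _ = X -> _]eq_bigr do rewrite V1.
  exists d => j; rewrite -U0 -U1.
  by have [/colP/(_ j) <- /colP/(_ j) <-] := (d0, d1); rewrite trPhi_plusE trPhi_minusE.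
have [U0 V0] := rep_value rf x0; have [U1 V1] := rep_value rf x1.
split.
- by move=> j; apply/is_H2P; exists (U j), (V j), (v j).
- apply/colP => i; rewrite Phiw_plusE Phiw_minusE.
  under eq_bigr do rewrite V0.
  by under [in X in _ = X]eq_bigr do rewrite V1.
- exists d; split; apply/colP => j.
    by rewrite trPhi_plusE U0; have [] := dU j.
  by rewrite trPhi_minusE U1; have [] := dU j.
Qed.

Lemma opA_rep f (U V v : 'I_m -> R -> C) : rep f U V v ->
  eq_X2 (opA c f) (fun x => \col_j ((c j)%:C * v j x)).
Proof.
move=> rf; apply/eq_X2P => j; have [_ +] := H2rep_weak (rf j).
apply: filterS => x /= /[apply] h.
rewrite [LHS]mxE [wderiv _ _ _ _]mxE entry_wderiv h.
by rewrite [RHS]mxE.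
Qed.

Lemma opA_L2 f (U V v : 'I_m -> R -> C) : rep f U V v -> in_X2 (opA c f).
Proof.
move=> rf j; have := L2Z (c j)%:C (H2rep_L2 (rf j)).
by congr is_L2; apply/funext => x; rewrite [RHS]mxE [wderiv _ _ _ _]mxE entry_wderiv.
Qed.

End NetworkDomain.
End Sobolev2.

(** * Linear second-order equations on an edge *)

Section ODE.
Variable R : realType.
Local Notation leb := (@lebesgue_measure R).
Local Notation C := R[i].
Local Notation Re := (@complex.Re R).
Local Notation Im := (@complex.Im R).
Local Notation normc := (@Normc.normc R).
Local Notation I01 := (`]0, 1[%classic : set R).
Implicit Types (u v w h U V W Q : R -> C) (x y : R) (z a : C).

Definition normC1 h : R := \int[leb]_(x in `]0, 1[) normc (h x).

Lemma normc_ge0 z : 0 <= normc z.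
Proof. by case: z => p q /=; rewrite sqrtr_ge0. Qed.

Lemma Re_le_normc z : `|Re z| <= normc z.
Proof.
rewrite -(ler_pXn2r (n := 2))// ?nnegrE ?normc_ge0//.
by rewrite normc_sqr real_normK ?num_real// lerDl sqr_ge0.
Qed.

Lemma Im_le_normc z : `|Im z| <= normc z.
Proof.
rewrite -(ler_pXn2r (n := 2))// ?nnegrE ?normc_ge0//.
by rewrite normc_sqr real_normK ?num_real// lerDr sqr_ge0.
Qed.

Lemma normc_le z : normc z <= `|Re z| + `|Im z|.
Proof.
rewrite -(ler_pXn2r (n := 2))// ?nnegrE ?normc_ge0 ?addr_ge0//.
rewrite normc_sqr sqrrD !real_normK ?num_real// lerD2r lerDl.
by rewrite mulrn_wge0// mulr_ge0.
Qed.

Lemma int01_normc h : intC h -> int01 (fun x => normc (h x)).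
Proof.
move=> [hR hI].
have ig := int01D (integrable_norm hR) (integrable_norm hI).
apply: int01_le ig => [|x _]; last by rewrite ger0_norm ?normc_ge0// normc_le.
have -> : (fun x => normc (h x)) = Num.sqrt \o (fun x => normc (h x) ^+ 2).
  by apply/funext => x; rewrite /= sqrtr_sqr ger0_norm// normc_ge0.
apply: measurableT_comp.
  by apply: continuous_measurable_fun; exact: sqrt_continuous.
by apply: meas_normc_sqr; exact: int01_meas.
Qed.

Lemma normC1_ge0 h : 0 <= normC1 h.
Proof. by apply: Rintegral_ge0 => x _; exact: normc_ge0. Qed.

Lemma normC1_le h (g : R -> R) : intC h -> int01 g ->
  (forall x, 0 < x < 1 -> normc (h x) <= g x) ->
  normC1 h <= \int[leb]_(x in `]0, 1[) g x.
Proof.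
move=> ih ig hg; apply: le_Rintegral => //; first exact: int01_normc.
Qed.

(** The factor 2 comes from bounding the modulus by the sum of the real and imaginary parts. *)
Lemma normc_primC h x : intC h -> x <= 1 -> normc (primC h x) <= 2 * normC1 h.
Proof.
move=> ih x1; apply: le_trans (normc_le _) _; have [hR hI] := ih.
have aux (f : R -> R) : int01 f -> (forall x, `|f x| <= normc (h x)) ->
    `|prim f x| <= normC1 h.
  move=> jf fh; apply: le_trans (prim_le_norm jf x1) _.
  apply: le_Rintegral => //; first exact: integrable_norm.
  exact: int01_normc.
rewrite mulr2n mulrDl mul1r; apply: lerD; apply: aux => // t.
  exact: Re_le_normc.
exact: Im_le_normc.
Qed.

Lemma intC_M E e h : cprim E e -> intC h -> intC (fun x => E x * h x).
Proof.
move=> [/isprim_cont cR /isprim_cont cI] [hR hI]; split.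
  apply: eq_integrable (int01B (int01M hR cR) (int01M hI cI)) => // x _ /=.
  by rewrite cReM; congr (_%:E); ring.
apply: eq_integrable (int01D (int01M hI cR) (int01M hR cI)) => // x _ /=.
by rewrite cImM; congr (_%:E); ring.
Qed.

Lemma isprim_id : isprim (fun x => x) (fun=> 1 : R).
Proof. by apply: isprim_derive => // x; exact: cst_continuous. Qed.

Lemma Rintegral01_cst (k : R) : \int[leb]_(x in `]0, 1[) k = k.
Proof.
have [_ /(_ 1)] := isprimZ k isprim_id.
rewrite lexx ler01 mulr0 add0r mulr1 => /(_ isT) E.
exact: esym E.
Qed.

Lemma cprim_bounded U v : cprim U v ->
  exists2 M, 0 <= M & forall x, 0 <= x <= 1 -> normc (U x) <= M.
Proof.
move=> [/isprim_cont/cont01_bounded[M1 h1] /isprim_cont/cont01_bounded[M2 h2]].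
have UM x : 0 <= x <= 1 -> normc (U x) <= M1 + M2.
  move=> x01; apply: le_trans (normc_le _) _.
  by apply: lerD; [exact: h1|exact: h2].
exists (M1 + M2) => //; apply: le_trans (UM 0 _); rewrite ?normc_ge0//.
by rewrite lexx ler01.
Qed.

(** $e^{-ax}Q$ has derivative 0, hence keeps its initial value 0. *)
Lemma ode1_uniq a Q : cprim Q (fun x => a * Q x) -> Q 0 = 0 ->
  forall x, 0 <= x <= 1 -> Q x = 0.
Proof.
move=> pQ Q0 x x01.
have := cprim0_const (cprimM (cprim_cexp (- a)) pQ) _ x01.
rewrite Q0 mulr0 => /(_ _)/wrap[].
  by move=> y _; ring.
move=> h; have := cexpN a x => e.
by rewrite -(mul1r (Q x)) -e -mulrA h mulr0.
Qed.

(** Variation of constants, $Q(x)=e^{ax}\int_0^x e^{-at}h(t)\,dt$. The constant is chosen before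
    [h], as the resolvent estimate requires. *)
Lemma ode1_exists a : exists2 M, 0 <= M & forall h, intC h ->
  exists Q, [/\ cprim Q (fun x => a * Q x + h x), Q 0 = 0 &
    forall x, 0 <= x <= 1 -> normc (Q x) <= M * normC1 h].
Proof.
have [M1 M10 hM1] := cprim_bounded (cprim_cexp a).
have [M2 M20 hM2] := cprim_bounded (cprim_cexp (- a)).
exists (M1 * (2 * M2)) => [|h ih]; first by rewrite !mulr_ge0.
have ieh := intC_M (cprim_cexp (- a)) ih.
exists (fun x => cexp a x * primC (fun x => cexp (- a) x * h x) x); split.
- apply: cprim_eq (cprimM (cprim_cexp a) (cprim_primC ieh)) => // x _.
  have e := cexpN a x; rewrite -[X in _ = _ + X]mul1r -e; ring.
- by rewrite primC0 mulr0.
move=> x x01; rewrite Normc.normcM -!mulrA.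
apply: ler_pM; rewrite ?normc_ge0//; first exact: hM1.
apply: le_trans (normc_primC ieh _) _; first by case/andP: x01.
rewrite ler_pM2l//.
have -> : M2 * normC1 h = \int[leb]_(x in `]0, 1[) (M2 * normc (h x)).
  by rewrite RintegralZl//; exact: int01_normc.
apply: normC1_le => //; first exact/int01Z/int01_normc.
move=> y /andP[y0 y1]; rewrite Normc.normcM ler_wpM2r ?normc_ge0//.
by apply: hM2; rewrite !ltW.
Qed.

(** With $w^2=z$ the operator factors as $(\partial+w)(\partial-w)$: $Q=V-wU$ solves $Q'=-wQ$, and
    then $U'=wU$. Both have zero initial value. The case $w=0$ needs no separate treatment. *)
Lemma ode2_uniq z U V : cprim U V -> cprim V (fun x => z * U x) ->
  U 0 = 0 -> V 0 = 0 -> forall x, 0 <= x <= 1 -> U x = 0.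
Proof.
move=> pU pV U0 V0; have wz := sqr_sqrtc z; set w := sqrtc z in wz.
have Q0 : forall x, 0 <= x <= 1 -> V x - w * U x = 0.
  apply: (@ode1_uniq (- w)); last by rewrite U0 V0 mulr0 subr0.
  apply: cprim_eq (cprimB pV (cprimZ w pU)) => // x _.
  by rewrite -wz; ring.
apply: (@ode1_uniq w) => //.
apply: cprim_eq pU => // x /andP[x0 x1].
by apply/eqP; rewrite -subr_eq0 Q0// !ltW.
Qed.

(** The same factorization solved in two stages: $Q'=-wQ+h$, then $U'=wU+Q$, with $V=wU+Q$. The
    summands of [M] bound $U$ and $V$ respectively. *)
Lemma ode2_exists z : exists2 M, 0 <= M & forall h, intC h ->
  exists U V, [/\ cprim U V, cprim V (fun x => z * U x + h x), U 0 = 0, V 0 = 0 &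
    forall x, 0 <= x <= 1 -> normc (U x) <= M * normC1 h /\ normc (V x) <= M * normC1 h].
Proof.
have wz := sqr_sqrtc z; set w := sqrtc z in wz.
have [M1 M10 hM1] := ode1_exists (- w).
have [M2 M20 hM2] := ode1_exists w.
pose M := M2 * M1 + (normc w * (M2 * M1) + M1).
have M0 : 0 <= M by rewrite !addr_ge0// ?mulr_ge0// ?normc_ge0// mulr_ge0.
exists M => // h ih.
have [Q [pQ Q0 bQ]] := hM1 h ih.
have iQ : intC Q by exact/L2_intC/(L2_cprim pQ).
have [U [pU U0 bU]] := hM2 Q iQ.
exists U, (fun x => w * U x + Q x).
have N0 := normC1_ge0 h.
have NQ : normC1 Q <= M1 * normC1 h.
  have -> : M1 * normC1 h = \int[leb]_(x in `]0, 1[) (M1 * normC1 h).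
    by rewrite Rintegral01_cst.
  apply: normC1_le => //; first exact: int01_cst.
  by move=> x /andP[x0 x1]; apply: bQ; rewrite !ltW.
have bU' x : 0 <= x <= 1 -> normc (U x) <= M2 * M1 * normC1 h.
  by move=> x01; apply: le_trans (bU x x01) _; rewrite -mulrA ler_wpM2l.
split => //.
- apply: cprim_eq (cprimD (cprimZ w pU) pQ) => // x _.
  by rewrite -wz; ring.
- by rewrite U0 Q0 mulr0 addr0.
move=> x x01; split.
  apply: le_trans (bU' x x01) _; rewrite ler_wpM2r// lerDl.
  by rewrite addr_ge0// !mulr_ge0// normc_ge0.
apply: le_trans (le_normcD _ _) _.
apply: (@le_trans _ _ ((normc w * (M2 * M1) + M1) * normC1 h)); last first.
  by rewrite ler_wpM2r// lerDr mulr_ge0.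
rewrite mulrDl; apply: lerD; last exact: bQ.
by rewrite Normc.normcM -mulrA ler_wpM2l ?normc_ge0// bU'.
Qed.

(** The solutions with initial data $(1,0)$ and $(0,1)$, found as corrections of $1$ and $x$: the
    remainder solves the inhomogeneous equation with source $z$, respectively $zx$, and zero data.
    No case distinction on $z$ arises. *)
Lemma ode2_fundamental z : exists T : (R -> C) * (R -> C) * ((R -> C) * (R -> C)),
  [/\ cprim T.1.1 T.1.2, cprim T.1.2 (fun x => z * T.1.1 x), T.1.1 0 = 1 & T.1.2 0 = 0] /\
  [/\ cprim T.2.1 T.2.2, cprim T.2.2 (fun x => z * T.2.1 x), T.2.1 0 = 0 & T.2.2 0 = 1].
Proof.
have [M _ hM] := ode2_exists z.
have pid : cprim (fun x => x%:C) (fun=> 1).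
  by have := cprim_real isprim_id.
have p1 := cprim_cst (1 : C).
have [U [V [pU pV U0 V0 _]]] := hM _ (L2_intC (L2_cprim (cprim_cst z))).
have [U' [V' [pU' pV' U0' V0' _]]] := hM _ (L2_intC (L2_cprim (cprimZ z pid))).
exists (fun x => 1 + U x, V, (fun x => x%:C + U' x, fun x => 1 + V' x)); split=> /=; split.
- by apply: cprim_eq (cprimD p1 pU) => // x _; rewrite add0r.
- by apply: cprim_eq pV => // x _; ring.
- by rewrite U0 addr0.
- exact: V0.
- exact: cprimD.
- by apply: cprim_eq (cprimD p1 pV') => // x _; ring.
- by rewrite U0' addr0.
- by rewrite V0' addr0.
Qed.

(** Uniqueness of the density gives $V=0$ almost everywhere; being a primitive itself, [V] is
    continuous, so it vanishes at every point, ends included. *)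
Lemma cprim_eq0 U V v : cprim U V -> cprim V v -> (forall x, 0 <= x <= 1 -> U x = 0) ->
  forall x, 0 <= x <= 1 -> V x = 0.
Proof.
move=> pU [cR cI] U0.
have p0 : cprim U (fun=> 0) by apply: cprim_eq (cprim_cst 0) => // x x01; rewrite U0.
have ae0 := cprim_uniq pU p0.
move=> x x01; apply: complex_eqP.
  apply: (cont_ae_eq (isprim_cont cR) (isprim_cont (isprim_cst 0))) x01.
  by apply: filterS ae0 => y /= /[apply] ->.
apply: (cont_ae_eq (isprim_cont cI) (isprim_cont (isprim_cst 0))) x01.
by apply: filterS ae0 => y /= /[apply] ->.
Qed.

(** The complex order makes [w] real and nonnegative. That [w] is itself a primitive gives its
    continuity, which turns almost everywhere into everywhere. *)
Lemma cprim_ge0_eq0 W w w' : cprim W w -> cprim w w' ->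
  (forall x, 0 <= x <= 1 -> 0 <= w x) -> W 1 = W 0 ->
  forall x, 0 <= x <= 1 -> w x = 0.
Proof.
move=> [WR _] [wR _] w0 W10 x x01.
have wIm y : 0 <= y <= 1 -> Im (w y) = 0 by move=> /w0; exact: ger0_Im.
apply: complex_eqP; last exact: wIm.
apply: (cont_ae_eq (isprim_cont wR) (isprim_cont (isprim_cst 0))) x01.
apply: (isprim_ge0_eq0 WR); last by rewrite W10.
move=> y /andP[y0 y1]; have y01 : 0 <= y <= 1 by rewrite !ltW.
by have := w0 y y01; rewrite lecE => /andP[].
Qed.

End ODE.

(** * Reality of the eigenvalues and absence of Jordan chains *)

Section Spectral.
Variables (R : realType) (n m : nat) (e0 e1 : 'I_m -> 'I_n) (mu c : 'I_m -> R).
Local Notation leb := (@lebesgue_measure R).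
Local Notation C := R[i].
Local Notation I01 := (`]0, 1[%classic : set R).
Local Notation D := (domA e0 e1 mu c).
Local Notation A := (opA c).
Implicit Types (f g : R -> 'cV[C]_m) (z : C) (x : R) (U V : 'I_m -> R -> C).
Hypothesis mu_gt0 : forall j, 0 < mu j.
Hypothesis c_gt0 : forall j, 0 < c j.

(* [U j] and [V j] are the continuous versions of [f_j] and [f_j'] for a
   solution [f] of [(z - A) f = g]. *)
Definition netsol z g f U V : Prop :=
  [/\ forall j, is_L2 (entry f j) /\ ae_eq leb I01 (entry f j) (U j),
      forall j, cprim (U j) (V j),
      forall j, cprim (V j) (fun x => ((c j)^-1)%:C * (z * U j x - entry g j x)),
      kirchhoff e0 e1 mu c V & exists d, node_values e0 e1 U d].

Lemma conj_herm (a : R) (u v : C) : (a%:C * (u * v^*))^* = a%:C * (v * u^*).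
Proof. by apply: complex_eqP; rewrite !(cReJ, cImJ, cReM, cImM)/=; ring. Qed.

Lemma cC_neq0 j : (c j)%:C != 0 :> C.
Proof. by rewrite fmorph_eq0 gt_eqF. Qed.

Lemma zero_X2_L2 : in_X2 (@zero_X2 R m).
Proof.
move=> j; have := L2_cprim (cprim_cst (0 : C)).
by congr is_L2; apply/funext => x; rewrite /entry mxE.
Qed.

Lemma entry_shifted z f j x :
  entry (shifted A z f) j x = z * entry f j x - entry (A f) j x.
Proof. by rewrite /entry /shifted !mxE. Qed.

Lemma entry_col (v : 'I_m -> R -> C) j x :
  entry (fun x => \col_i ((c i)%:C * v i x)) j x = (c j)%:C * v j x.
Proof. by rewrite /entry mxE. Qed.

(** Replaces an equation modulo null sets between derivatives chosen abstractly by integral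
    equations for continuous versions, with vertex conditions on their actual values. *)
Lemma netsolP f z g : in_X2 g ->
  (D f /\ eq_X2 (shifted A z f) g) <-> exists U V, netsol z g f U V.
Proof.
move=> L2g; split=> [[/domAP[U [V [v [rf kV nU]]]]]|[U [V [fU pU pV kV nU]]]].
  move=> /eq_X2P fg; exists U, V; split=> //; first by move=> j; have [] := rf j.
    by move=> j; have [] := rf j.
  move=> j; have [L2f pU pV L2v fU] := rf j.
  have L2h : is_L2 (fun x => ((c j)^-1)%:C * (z * U j x - entry g j x)).
    have := L2Z ((c j)^-1)%:C (L2D (L2Z z (L2_cprim pU)) (L2Z (-1) (L2g j))).
    by congr is_L2; apply/funext => x; rewrite mulN1r.
  apply: (cprim_ae (L2_measRe L2h) (L2_measIm L2h) _ pV).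
  have /eq_X2P/(_ j) Af := opA_rep c rf.
  have fgj := fg j.
  apply: filterS3 fU fgj Af => x /= fU fg' Af x01.
  rewrite -fg'// entry_shifted Af// entry_col fU//.
  by rewrite fmorphV; have := cC_neq0 j => cj; field.
pose v j x := ((c j)^-1)%:C * (z * U j x - entry g j x).
have rf : rep f U V v.
  move=> j; have [L2f fUj] := fU j; split=> //.
  have := L2Z ((c j)^-1)%:C (L2D (L2Z z (L2_cprim (pU j))) (L2Z (-1) (L2g j))).
  by congr is_L2; apply/funext => x; rewrite /v mulN1r.
split; first by apply/domAP; exists U, V, v.
apply/eq_X2P => j; have /eq_X2P/(_ j) := opA_rep c rf.
have [_ fUj] := fU j.
move=> Af; apply: filterS2 fUj Af => x /= fUj Af x01.
rewrite entry_shifted Af// entry_col fUj// /v.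
by rewrite fmorphV; have := cC_neq0 j => cj; field.
Qed.

Lemma eigenspaceP z f : eigenspace D A z f <-> exists U V, netsol z (@zero_X2 R m) f U V.
Proof.
split=> [[Df Af]|/(netsolP _ _ zero_X2_L2)[Df sf]].
  apply/(netsolP _ _ zero_X2_L2); split=> //.
  by apply: filterS Af => x /= /[apply] Af; rewrite /shifted Af subrr.
split=> //; apply: filterS sf => x /= /[apply] /eqP.
by rewrite /shifted subr_eq0 => /eqP.
Qed.

Lemma netsol_ae0 z g f U V : netsol z g f U V -> eq_X2 f (@zero_X2 R m) ->
  forall j x, 0 <= x <= 1 -> U j x = 0.
Proof.
move=> [fU pU _ _ _] /eq_X2P f0 j x x01.
have [L2f fUj] := fU j; have f0j := f0 j.
rewrite -(continuous_rep_eq (pU j) fUj x01).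
apply: (continuous_rep_eq (cprim_cst (0 : C))) x01.
by apply: filterS f0j => y /= /[apply] ->; rewrite /entry mxE.
Qed.

Lemma netsol_U0 z g f U V : netsol z g f U V ->
  (forall j x, 0 <= x <= 1 -> U j x = 0) -> eq_X2 f (@zero_X2 R m).
Proof.
move=> [fU _ _ _ _] U0; apply/eq_X2P => j; have [_ fUj] := fU j.
apply: filterS fUj => x /= + x01 => ->//.
rewrite U0 ?/entry ?mxE//; move: x01; rewrite in_itv/= => /andP[x0 x1].
by rewrite !ltW.
Qed.

(* Summation by parts over the nodes: the boundary terms of Green's formula
   vanish under the vertex conditions. *)
Lemma green_boundary (U V : 'I_m -> R -> C) d :
  kirchhoff e0 e1 mu c V -> node_values e0 e1 U d ->
  \sum_j (mu j * c j)%:C * (V j 1 * (U j 1)^*) = \sum_j (mu j * c j)%:C * (V j 0 * (U j 0)^*).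
Proof.
move=> kV nU.
rewrite (partition_big e1 predT)//= [RHS](partition_big e0 predT)//=.
apply: eq_bigr => i _.
transitivity ((d i 0)^* * \sum_(j | e1 j == i) (mu j * c j)%:C * V j 1).
  rewrite mulr_sumr; apply: eq_bigr => j /eqP <-.
  by have [_ ->] := nU j; ring.
rewrite -kV mulr_sumr; apply: eq_bigr => j /eqP <-.
by have [-> _] := nU j; ring.
Qed.

Lemma sum_sqr_eq0 (a : 'I_m -> R) (U : 'I_m -> C) : (forall j, 0 < a j) ->
  \sum_j (a j)%:C * (U j * (U j)^*) = 0 -> forall j, U j = 0.
Proof.
move=> a0 s0 j.
have h0 i : 0 <= (a i)%:C * (U i * (U i)^*) by rewrite mulr_ge0 ?mulcJ_ge0// ler0c ltW.
have /(_ j isT)/eqP := psumr_eq0P (fun i _ => h0 i) s0.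
by rewrite !mulf_eq0 conjc_eq0 orbb fmorph_eq0 gt_eqF//= => /eqP.
Qed.

Lemma sum_sqr_ge0 (a : 'I_m -> R) (U : 'I_m -> C) : (forall j, 0 < a j) ->
  0 <= \sum_j (a j)%:C * (U j * (U j)^*).
Proof.
by move=> a0; rewrite sumr_ge0// => j _; rewrite mulr_ge0 ?mulcJ_ge0// ler0c ltW.
Qed.

Lemma cprim_sum_sqr (a : 'I_m -> R) U V : (forall j, cprim (U j) (V j)) ->
  exists w, cprim (fun x => \sum_j (a j)%:C * (U j x * (U j x)^*)) w.
Proof.
move=> pU; eexists; apply: cprim_sum => j; apply: cprimZ.
by apply: cprimM; [exact: pU|apply: cprimJ; exact: pU].
Qed.

Section Eigen.
Variables (z : C) (f : R -> 'cV[C]_m) (U V : 'I_m -> R -> C).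
Hypothesis sol : netsol z (@zero_X2 R m) f U V.

(** [P] is the density of the squared norm in $X_2$, [Q] that of the Dirichlet energy, and [W] the
    boundary form of Green's formula, with $W'=zP+Q$ and $W(0)=W(1)$. *)
Let P x := \sum_j (mu j)%:C * (U j x * (U j x)^*).
Let Q x := \sum_j (mu j * c j)%:C * (V j x * (V j x)^*).
Let W x := \sum_j (mu j * c j)%:C * (V j x * (U j x)^*).

Lemma eigen_ode j : cprim (V j) (fun x => (z / (c j)%:C) * U j x).
Proof.
have [_ _ pV _ _] := sol; apply: cprim_eq (pV j) => // x _.
by rewrite /entry mxE subr0 fmorphV; ring.
Qed.

Let W_prim : cprim W (fun x => z * P x + Q x).
Proof.
have [fU pU pV kV nU] := sol.
apply: cprim_eq (cprim_sum (index_enum 'I_m) xpredT (fun j =>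
  cprimZ (mu j * c j)%:C (cprimM (eigen_ode j) (cprimJ (pU j))))) => // x _.
rewrite /P /Q mulr_sumr -big_split/=; apply: eq_bigr => j _.
by rewrite rmorphM/=; have := cC_neq0 j => cj; field.
Qed.

Let W_bnd : W 1 = W 0.
Proof. by have [_ _ _ kV [d nU]] := sol; exact: green_boundary kV nU. Qed.

(** [P] and [Q] are real, so $W-\overline W$ has derivative $(z-\bar z)P$. If $z\neq\bar z$,
    dividing gives a function with equal end values and derivative $P\ge 0$, so $P=0$. *)
Lemma eigen_real : (exists j x, 0 <= x <= 1 /\ U j x != 0) -> z^* = z.
Proof.
move=> [j [x [x01 Ux]]]; apply/eqP; rewrite -subr_eq0; apply/negPn/negP => zz.
have zz' : z - z^* != 0 by rewrite -opprB oppr_eq0.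
have PJ y : (P y)^* = P y.
  by rewrite /P rmorph_sum; apply: eq_bigr => i _; exact: conj_herm.
have QJ y : (Q y)^* = Q y.
  by rewrite /Q rmorph_sum; apply: eq_bigr => i _; exact: conj_herm.
have pW2 := cprimZ (z - z^*)^-1 (cprimB W_prim (cprimJ W_prim)).
have [_ pU _ _ _] := sol; have [w pP] := cprim_sum_sqr mu pU.
have P0 : P x = 0.
  have pW3 : cprim (fun x => (z - z^*)^-1 * (W x - (W x)^*)) P.
    apply: cprim_eq pW2 => // y _; rewrite rmorphD rmorphM/= PJ QJ; field.
    by [].
  apply: (cprim_ge0_eq0 pW3 pP) x01; last by rewrite W_bnd.
  by move=> y _; exact: sum_sqr_ge0.
by move/eqP : Ux; apply; exact: (sum_sqr_eq0 mu_gt0 P0).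
Qed.

(** For $z>0$ the derivative $zP+Q$ of [W] is a sum of nonnegative terms, so equal end values force
    $P=0$. *)
Lemma eigen_le0 : (exists j x, 0 <= x <= 1 /\ U j x != 0) -> z <= 0.
Proof.
move=> Ux; have zz := eigen_real Ux.
have zr : z = (complex.Re z)%:C.
  by move: zz; case: (z) => a b /= [] h; congr (_ +i* _); lra.
rewrite zr lecR leNgt; apply/negP => z0.
have [j [x [x01 /eqP]]] := Ux; apply.
have [_ pU _ _ _] := sol; have [w pP] := cprim_sum_sqr mu pU.
have [w' pQ] := cprim_sum_sqr (fun j => mu j * c j) (fun j => eigen_ode j).
have mc i : 0 < mu i * c i by rewrite mulr_gt0.
have z0' : 0 < z by rewrite zr ltcR.
have h0 y : 0 <= y <= 1 -> 0 <= z * P y + Q y.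
  by move=> _; rewrite addr_ge0 ?mulr_ge0 ?sum_sqr_ge0// ltW.
have := cprim_ge0_eq0 W_prim (cprimD (cprimZ z pP) pQ) h0 W_bnd x01 => /eqP.
rewrite paddr_eq0 ?mulr_ge0 ?sum_sqr_ge0// ?(ltW z0')// mulf_eq0 gt_eqF//= => /andP[/eqP P0 _].
exact: (sum_sqr_eq0 mu_gt0 P0).
Qed.

(** At $z=0$ the derivative of [W] is the energy density [Q] alone. *)
Lemma eigen0_derivative : z = 0 -> forall j x, 0 <= x <= 1 -> V j x = 0.
Proof.
move=> z0 j x x01.
have mc i : 0 < mu i * c i by rewrite mulr_gt0.
have [w' pQ] := cprim_sum_sqr (fun j => mu j * c j) (fun j => eigen_ode j).
have pW : cprim W Q.
  by apply: cprim_eq W_prim => // y _; rewrite z0 mul0r add0r.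
have Q0 := cprim_ge0_eq0 pW pQ (fun y _ => sum_sqr_ge0 _ mc) W_bnd x01.
exact: (sum_sqr_eq0 mc Q0).
Qed.

End Eigen.

(** Symmetry of $A$: for real $z$, $\|g\|^2=\langle(z-A)f,g\rangle=\langle f,(z-A)g\rangle=0$. This
    excludes Jordan chains of length two, hence all longer ones. *)
Lemma kernel_shift z f g U V U' V' : z^* = z -> in_X2 g ->
  netsol z g f U V -> netsol z (@zero_X2 R m) g U' V' ->
  forall j x, 0 <= x <= 1 -> U' j x = 0.
Proof.
move=> zz L2g [fU pU pV kV [d nU]] sg j x x01.
have [gU' pU' _ kV' [d' nU']] := sg.
have pV' := eigen_ode sg.
have pV1 i : cprim (V i) (fun x => ((c i)^-1)%:C * (z * U i x - U' i x)).
  have L2h : is_L2 (fun x => ((c i)^-1)%:C * (z * U i x - U' i x)).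
    have := L2Z ((c i)^-1)%:C (L2D (L2Z z (L2_cprim (pU i))) (L2Z (-1) (L2_cprim (pU' i)))).
    by congr is_L2; apply/funext => y; rewrite mulN1r.
  apply: (cprim_ae (L2_measRe L2h) (L2_measIm L2h) _ (pV i)).
  by have [_ gUi] := gU' i; apply: filterS gUi => y /= /[apply] ->.
have zcJ i : (z / (c i)%:C)^* = z / (c i)%:C.
  rewrite -fmorphV [LHS]rmorphM; congr (_ * _); first exact: zz.
  exact: conjc_real.
(* The Wronskian-type form of $f$ and $g$; the terms with $z$ and with products of derivatives
   cancel in $W'$, leaving the density of $\|g\|^2$. *)
pose W x : C := \sum_i (mu i * c i)%:C * (U i x * (V' i x)^* - V i x * (U' i x)^*).
have pW : cprim W (fun x => \sum_i (mu i)%:C * (U' i x * (U' i x)^*)).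
  apply: cprim_eq (cprim_sum (index_enum 'I_m) xpredT (fun i =>
    cprimZ (mu i * c i)%:C (cprimB (cprimM (pU i) (cprimJ (pV' i)))
      (cprimM (pV1 i) (cprimJ (pU' i)))))) => // y _.
  apply: eq_bigr => i _.
  have cm : (z / (c i)%:C * U' i y)^* = z / (c i)%:C * (U' i y)^*.
    by rewrite [LHS]rmorphM; congr (_ * _); exact: zcJ.
  rewrite cm.
  have E1 : (mu i * c i)%:C = (mu i)%:C * (c i)%:C := rmorphM (real_complex R) _ _.
  have E2 : ((c i)^-1)%:C = ((c i)%:C)^-1 := fmorphV (real_complex R) _.
  rewrite E1 E2; have := cC_neq0 i; move: (c i)%:C (mu i)%:C => ci mi ci0.
  by field.
have [w pP] := cprim_sum_sqr mu pU'.
have P0 := cprim_ge0_eq0 pW pP (fun y _ => sum_sqr_ge0 _ mu_gt0).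
apply: (sum_sqr_eq0 mu_gt0 (P0 _ _ x01)).
have bE y (G : 'I_m -> R -> C) (H : 'I_m -> R -> C) :
  \sum_i (mu i * c i)%:C * (G i y * (H i y)^*) =
    (\sum_i (mu i * c i)%:C * (H i y * (G i y)^*))^*.
  by rewrite rmorph_sum; apply: eq_bigr => i _; exact/esym/conj_herm.
pose G1 y : C := \sum_i (mu i * c i)%:C * (V' i y * (U i y)^*).
pose G2 y : C := \sum_i (mu i * c i)%:C * (V i y * (U' i y)^*).
have WE y : W y = conjc (G1 y) - G2 y.
  rewrite -(bE y U V' : _ = conjc (G1 y)) /G2 -sumrB.
  by apply: eq_bigr => i _; rewrite mulrBr.
by rewrite !WE /G1 /G2 (green_boundary kV' nU) (green_boundary kV nU').
Qed.

End Spectral.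

(** * Resolvent away from the eigenvalues *)

Section Resolvent.
Variables (R : realType) (n m : nat) (e0 e1 : 'I_m -> 'I_n) (mu c : 'I_m -> R).
Local Notation leb := (@lebesgue_measure R).
Local Notation C := R[i].
Local Notation normc := (@Normc.normc R).
Local Notation I01 := (`]0, 1[%classic : set R).
Local Notation D := (domA e0 e1 mu c).
Local Notation A := (opA c).
Local Notation netsol := (netsol e0 e1 mu c).
Implicit Types (f g : R -> 'cV[C]_m) (z : C) (x : R) (U V : 'I_m -> R -> C).
Hypothesis mu_gt0 : forall j, 0 < mu j.
Hypothesis c_gt0 : forall j, 0 < c j.
Hypothesis covered : forall i, exists j, e0 j = i \/ e1 j = i.

Lemma normc_sum (I : Type) (r : seq I) (P : pred I) (F : I -> C) :
  normc (\sum_(i <- r | P i) F i) <= \sum_(i <- r | P i) normc (F i).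
Proof.
elim/big_ind2 : _ => [|a b p q pa qb|//]; first by rewrite Normc.normc0.
by apply: le_trans (le_normcD _ _) _; exact: lerD.
Qed.

(** An injective endomorphism in finite dimension has an invertible matrix; [K] is the sum of the
    moduli of all entries of the inverse, a crude bound in the sup norm. *)
Lemma linear_inj_solve N (T : 'rV[C]_N -> 'rV[C]_N) : linear T ->
  (forall x : 'rV[C]_N, T x = 0 -> x = 0) ->
  exists2 K, 0 <= K & forall y, exists2 x : 'rV[C]_N, T x = y &
    forall B, (forall i, normc (y 0 i) <= B) -> forall i, normc (x 0 i) <= K * B.
Proof.
move=> linT injT.
pose Tl : {linear 'rV[C]_N -> 'rV[C]_N} := HB.pack T (GRing.isLinear.Build _ _ _ _ T linT).
pose M := lin1_mx Tl.
have ME (x : 'rV[C]_N) : x *m M = T x by rewrite mul_rV_lin1.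
have uM : M \in unitmx.
  rewrite -row_free_unit -kermx_eq0; apply/rowV0P => v /sub_kermxP.
  by rewrite ME => /injT.
exists (\sum_i \sum_k normc (invmx M k i)).
  by rewrite sumr_ge0// => i _; rewrite sumr_ge0// => k _; exact: normc_ge0.
move=> y; exists (y *m invmx M) => [|B yB i]; first by rewrite -ME mulmxKV.
rewrite mxE; apply: le_trans (normc_sum _ _ _) _.
have B0 : 0 <= B by apply: le_trans (normc_ge0 _) (yB i).
apply: (@le_trans _ _ ((\sum_k normc (invmx M k i)) * B)).
  rewrite mulr_suml; apply: ler_sum => k _.
  by rewrite Normc.normcM mulrC ler_wpM2l ?normc_ge0.
rewrite ler_wpM2r// [X in _ <= X](bigD1 i)//= lerDl sumr_ge0// => l _.
by rewrite sumr_ge0// => k _; exact: normc_ge0.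
Qed.

(** With $a=\int|h|$, expanding $0\le\int(|h|-a)^2$ over the unit interval gives $\int|h|^2-a^2\ge
    0$. *)
Lemma normC1_sqr_le (h : R -> C) : is_L2 h ->
  normC1 h ^+ 2 <= \int[leb]_(x in `]0, 1[) normc (h x) ^+ 2.
Proof.
move=> L2h; have i1 := int01_normc (L2_intC L2h); have i2 := L2_int L2h.
set a := normC1 h.
have : 0 <= \int[leb]_(x in `]0, 1[) (normc (h x) ^+ 2 + ((- 2 * a) * normc (h x) + a ^+ 2)).
  apply: Rintegral_ge0 => x _.
  have -> : normc (h x) ^+ 2 + (- 2 * a * normc (h x) + a ^+ 2) = (normc (h x) - a) ^+ 2.
    by ring.
  exact: sqr_ge0.
have i3 := int01Z (- 2 * a) i1; have i4 := @int01_cst R (a ^+ 2).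
rewrite RintegralD//; last exact: int01D.
rewrite RintegralD// RintegralZl// Rintegral01_cst -/(normC1 h) -/a.
set b := \int[_]_(_ in _) _; nra.
Qed.

Lemma normC1_norm_X2 g j : in_X2 g ->
  normC1 (entry g j) <= (Num.sqrt (mu j))^-1 * norm_X2 mu g.
Proof.
move=> L2g.
have smu : 0 < Num.sqrt (mu j) by rewrite sqrtr_gt0.
rewrite ler_pdivlMl//.
rewrite -(ler_pXn2r (n := 2))// ?nnegrE ?mulr_ge0 ?sqrtr_ge0 ?normC1_ge0//.
have t0 i : 0 <= mu i * \int[leb]_(x in `]0, 1[) normc (g x i 0) ^+ 2.
  rewrite mulr_ge0 ?(ltW (mu_gt0 _))//; apply: Rintegral_ge0 => x _; exact: sqr_ge0.
rewrite exprMn !sqr_sqrtr ?(ltW (mu_gt0 j)) ?sumr_ge0//.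
rewrite (bigD1 j)//= -[X in X <= _]addr0; apply: lerD; last exact: sumr_ge0.
by rewrite ler_pM2l//; exact: normC1_sqr_le (L2g j).
Qed.

Lemma norm_X2_le f U B : (forall j, is_L2 (entry f j) /\ ae_eq leb I01 (entry f j) (U j)) ->
  (forall j, exists v, cprim (U j) v) -> 0 <= B ->
  (forall j x, 0 <= x <= 1 -> normc (U j x) <= B) ->
  norm_X2 mu f <= Num.sqrt (\sum_j mu j) * B.
Proof.
move=> fU pU B0 UB.
have s0 : 0 <= \sum_j mu j by rewrite sumr_ge0// => j _; exact: ltW.
rewrite -(ler_pXn2r (n := 2))// ?nnegrE ?mulr_ge0 ?sqrtr_ge0//.
have t0 i : 0 <= mu i * \int[leb]_(x in `]0, 1[) normc (f x i 0) ^+ 2.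
  rewrite mulr_ge0 ?(ltW (mu_gt0 _))//; apply: Rintegral_ge0 => x _; exact: sqr_ge0.
rewrite exprMn (sqr_sqrtr s0) sqr_sqrtr ?sumr_ge0// mulr_suml.
apply: ler_sum => j _; rewrite ler_pM2l//.
have [L2f fUj] := fU j; have [v pUj] := pU j.
have -> : \int[leb]_(x in `]0, 1[) normc (f x j 0) ^+ 2 =
    \int[leb]_(x in `]0, 1[) normc (U j x) ^+ 2.
  apply: (prim_ae (L2_int L2f) (L2_int (L2_cprim pUj)) (lexx 1)).
  by apply: filterS fUj => x /= /[apply] <-.
rewrite -[X in _ <= X]Rintegral01_cst; apply: le_Rintegral => //.
- exact: L2_int (L2_cprim pUj).
- exact: int01_cst.
move=> x; rewrite /= in_itv/= => /andP[x0 x1].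
rewrite ler_pXn2r// ?nnegrE ?normc_ge0//.
by apply: UB; rewrite !ltW.
Qed.

Section Fredholm.
Variable z : C.
Hypothesis inj : forall f U V, netsol z (@zero_X2 R m) f U V ->
  forall j x, 0 <= x <= 1 -> U j x = 0.

(** Particular solutions with zero initial data on each edge are corrected by homogeneous solutions.
    The correction solves a linear system with $m+n$ unknowns and as many equations, injective by
    the uniqueness hypothesis [inj]. *)
Lemma netsol_solve : exists2 M, 0 <= M & forall g, in_X2 g -> exists f U V,
  netsol z g f U V /\
  forall j x, 0 <= x <= 1 -> normc (U j x) <= M * \sum_i normC1 (entry g i).
Proof.
have /choice[T hT] := fun j => ode2_fundamental (z / (c j)%:C).
pose Cc j := (T j).1.1; pose Cd j := (T j).1.2.
pose Sc j := (T j).2.1; pose Sd j := (T j).2.2.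
have pC j : cprim (Cc j) (Cd j) by case: (hT j) => [[]].
have pCd j : cprim (Cd j) (fun x => z / (c j)%:C * Cc j x) by case: (hT j) => [[]].
have C0 j : Cc j 0 = 1 by case: (hT j) => [[]].
have Cd0 j : Cd j 0 = 0 by case: (hT j) => [[]].
have pS j : cprim (Sc j) (Sd j) by case: (hT j) => [_ []].
have pSd j : cprim (Sd j) (fun x => z / (c j)%:C * Sc j x) by case: (hT j) => [_ []].
have S0 j : Sc j 0 = 0 by case: (hT j) => [_ []].
have Sd0 j : Sd j 0 = 1 by case: (hT j) => [_ []].
(* A vector of unknowns holds the $m$ initial slopes, then the $n$ vertex values. *)
pose dd (y : 'rV[C]_(m + n)) i := y 0 (rshift m i).
pose bb (y : 'rV[C]_(m + n)) j := y 0 (lshift n j).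
pose U0 y j x := dd y (e0 j) * Cc j x + bb y j * Sc j x.
pose V0 y j x := dd y (e0 j) * Cd j x + bb y j * Sd j x.
have pU0 y j : cprim (U0 y j) (V0 y j).
  exact: cprimD (cprimZ _ (pC j)) (cprimZ _ (pS j)).
have pV0 y j : cprim (V0 y j) (fun x => z / (c j)%:C * U0 y j x).
  apply: cprim_eq (cprimD (cprimZ _ (pCd j)) (cprimZ _ (pSd j))) => // x _.
  by rewrite /U0; ring.
(* The value at the start of each edge is built into [U0]. What remains is matching at the far end,
   $m$ equations, and the Kirchhoff condition, $n$ equations. *)
pose T1 y : 'rV[C]_(m + n) := row_mx
  (\row_j (U0 y j 1 - dd y (e1 j)))
  (\row_i (\sum_(j | e0 j == i) (mu j * c j)%:C * V0 y j 0 -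
           \sum_(j | e1 j == i) (mu j * c j)%:C * V0 y j 1)).
have U0lin a u v j x : U0 (a *: u + v) j x = a * U0 u j x + U0 v j x.
  by rewrite /U0 /dd /bb !mxE; ring.
have V0lin a u v j x : V0 (a *: u + v) j x = a * V0 u j x + V0 v j x.
  by rewrite /V0 /dd /bb !mxE; ring.
have linT : linear T1.
  move=> a u v; rewrite /T1 scale_row_mx add_row_mx; congr row_mx; apply/rowP => k.
    by rewrite !mxE U0lin /dd !mxE; ring.
  rewrite !mxE.
  under eq_bigr do rewrite V0lin mulrDr mulrCA.
  under [X in _ - X = _]eq_bigr do rewrite V0lin mulrDr mulrCA.
  by rewrite !big_split/= -!mulr_sumr; ring.
have sol0 y : T1 y = 0 -> netsol z (@zero_X2 R m) (fun x => \col_j U0 y j x) (U0 y) (V0 y).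
  move=> /rowP Ty; split.
  - move=> j; have E : entry (fun x => \col_j U0 y j x) j = U0 y j.
      by apply/funext => x; rewrite /entry mxE.
    by rewrite E; split; [exact: L2_cprim (pU0 y j)|exact: ae_eq_refl].
  - exact: pU0.
  - move=> j; apply: cprim_eq (pV0 y j) => // x _.
    by rewrite /entry mxE subr0 fmorphV; ring.
  - move=> i; have := Ty (rshift m i); rewrite /T1 row_mxEr !mxE => /eqP.
    by rewrite subr_eq0 => /eqP.
  - exists (\col_i dd y i) => j; rewrite !mxE; split.
      by rewrite /U0 C0 S0 mulr1 mulr0 addr0.
    have := Ty (lshift n j); rewrite /T1 row_mxEl !mxE => /eqP.
    by rewrite subr_eq0 => /eqP.
have x0 : 0 <= (0 : R) <= 1 by rewrite lexx ler01.
have x1 : 0 <= (1 : R) <= 1 by rewrite lexx ler01.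
have injT y : T1 y = 0 -> y = 0.
  (* A kernel vector yields a null solution. Its vertex values vanish because every vertex is an end
     of some edge, its slopes because the derivative vanishes too. *)
  move=> Ty; have s := sol0 y Ty; have Uy := inj s.
  have Vy j := cprim_eq0 (pU0 y j) (pV0 y j) (Uy j).
  have [_ _ _ _ [d nU]] := s.
  have dy i : dd y i = 0.
    have [j [<-|<-]] := covered i.
      by have := Uy j 0 x0; rewrite /U0 C0 S0 mulr1 mulr0 addr0.
    have /rowP/(_ (lshift n j)) := Ty; rewrite /T1 row_mxEl !mxE Uy// sub0r => /eqP.
    by rewrite oppr_eq0 => /eqP.
  have by_ j : bb y j = 0.
    by have := Vy j 0 x0; rewrite /V0 Cd0 Sd0 mulr1 mulr0 add0r.
  by apply/rowP => k; rewrite mxE; case: (split_ordP k) => i ->; [exact: by_|exact: dy].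
have [K K0 hK] := linear_inj_solve linT injT.
have /choice[Mp hMp] : forall j, exists M, 0 <= M /\ forall h, intC h ->
    exists UV : (R -> C) * (R -> C), [/\ cprim UV.1 UV.2,
    cprim UV.2 (fun x => z / (c j)%:C * UV.1 x + h x), UV.1 0 = 0, UV.2 0 = 0 &
    forall x, 0 <= x <= 1 -> normc (UV.1 x) <= M * normC1 h /\ normc (UV.2 x) <= M * normC1 h].
  move=> j; have [M M0 hM] := ode2_exists (z / (c j)%:C); exists M; split=> // h ih.
  by have [U [V hUV]] := hM h ih; exists (U, V).
have /choice[BC hBC] : forall j, exists B, 0 <= B /\
    forall x, 0 <= x <= 1 -> normc (Cc j x) <= B.
  by move=> j; have [B B0 hB] := cprim_bounded (pC j); exists B.
have /choice[BS hBS] : forall j, exists B, 0 <= B /\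
    forall x, 0 <= x <= 1 -> normc (Sc j x) <= B.
  by move=> j; have [B B0 hB] := cprim_bounded (pS j); exists B.
(* [Kp] bounds the particular solutions, [Kb] the fundamental ones, and [Ks] the right-hand side of
   the system: the 1 accounts for the matching rows, the sum for the Kirchhoff weights. *)
pose Kp := \sum_j Mp j * (c j)^-1.
pose Kb := \sum_j (BC j + BS j).
pose Ks := 1 + \sum_j mu j * c j.
have tp j : 0 <= Mp j * (c j)^-1.
  by rewrite mulr_ge0 ?invr_ge0 ?(ltW (c_gt0 _))//; case: (hMp j).
have tb j : 0 <= BC j + BS j by rewrite addr_ge0//; [case: (hBC j)|case: (hBS j)].
have ts j : 0 <= mu j * c j by rewrite mulr_ge0 ?ltW.
have Kp0 : 0 <= Kp by rewrite sumr_ge0.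
have Kb0 : 0 <= Kb by rewrite sumr_ge0.
have Ks1 : 1 <= Ks by rewrite lerDl sumr_ge0.
have Ks0 : 0 <= Ks by apply: le_trans Ks1.
exists (Kb * (K * (Ks * Kp)) + Kp); first by rewrite addr_ge0// !mulr_ge0.
move=> g L2g.
set N := \sum_i normC1 (entry g i).
have N0 : 0 <= N by rewrite sumr_ge0// => j _; exact: normC1_ge0.
(* From $c_ju''=zu-g_j$, the source term is $-g_j/c_j$. *)
pose h j x := (- (c j)^-1)%:C * entry g j x.
have ih j : intC (h j) by exact/L2_intC/L2Z.
have hN j : normC1 (h j) <= (c j)^-1 * N.
  have -> : normC1 (h j) = (c j)^-1 * normC1 (entry g j).
    rewrite /normC1 -RintegralZl//; last exact/int01_normc/L2_intC.
    apply: eq_Rintegral => x _; rewrite Normc.normcM; congr (_ * _).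
    rewrite /= expr0n addr0 sqrtr_sqr normrN ger0_norm// invr_ge0.
    exact: ltW.
  rewrite ler_pM2l ?invr_gt0// /N (bigD1 j)//= lerDl sumr_ge0// => i _.
  exact: normC1_ge0.
have /choice[UVp hUVp] := fun j => (hMp j).2 (h j) (ih j).
pose Up j := (UVp j).1; pose Vp j := (UVp j).2.
have pUp j : cprim (Up j) (Vp j) by case: (hUVp j).
have pVp j : cprim (Vp j) (fun x => z / (c j)%:C * Up j x + h j x) by case: (hUVp j).
have Up0 j : Up j 0 = 0 by case: (hUVp j).
have Vp0 j : Vp j 0 = 0 by case: (hUVp j).
have MN j : Mp j * normC1 (h j) <= Kp * N.
  apply: (@le_trans _ _ (Mp j * (c j)^-1 * N)).
    by rewrite -mulrA ler_wpM2l//; case: (hMp j).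
  by rewrite ler_wpM2r// /Kp (bigD1 j)//= lerDl sumr_ge0.
have Upb j x : 0 <= x <= 1 -> normc (Up j x) <= Kp * N.
  by move=> x01; have [_ _ _ _ /(_ x x01)[h1 _]] := hUVp j; exact: le_trans h1 (MN j).
have Vpb j x : 0 <= x <= 1 -> normc (Vp j x) <= Kp * N.
  by move=> x01; have [_ _ _ _ /(_ x x01)[_ h1]] := hUVp j; exact: le_trans h1 (MN j).
(* The defect of the particular solution in the vertex conditions, moved to the right-hand side; its
   initial values and slopes are 0, so only the far ends contribute. *)
pose y0 : 'rV[C]_(m + n) := row_mx (\row_j (- Up j 1))
  (\row_i \sum_(j | e1 j == i) (mu j * c j)%:C * Vp j 1).
have [y Ty yb] := hK y0.
have KN0 : 0 <= Kp * N by rewrite mulr_ge0.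
have {}yb i : normc (y 0 i) <= K * (Ks * (Kp * N)).
  apply: yb => k; rewrite /y0; case: (split_ordP k) => l ->.
    rewrite row_mxEl mxE normcN; apply: le_trans (Upb l 1 x1) _.
    by rewrite ler_peMl.
  rewrite row_mxEr mxE; apply: le_trans (normc_sum _ _ _) _.
  rewrite /Ks mulrDl mul1r -[X in X <= _]add0r; apply: lerD => //.
  rewrite big_mkcond mulr_suml; apply: ler_sum => j _.
  have b0 := le_trans (normc_ge0 _) (Vpb j 1 x1).
  case: ifP => _; last by rewrite mulr_ge0.
  rewrite Normc.normcM; apply: ler_pM; rewrite ?normc_ge0 ?Vpb//.
  by rewrite /= expr0n addr0 sqrtr_sqr ger0_norm.
pose U j x := U0 y j x + Up j x; pose V j x := V0 y j x + Vp j x.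
have pU j : cprim (U j) (V j) by exact: cprimD.
have UE j : entry (fun x => \col_j U j x) j = U j.
  by apply/funext => x; rewrite /entry mxE.
exists (fun x => \col_j U j x), U, V; split.
  split.
  - by move=> j; rewrite UE; split; [exact: L2_cprim (pU j)|exact: ae_eq_refl].
  - exact: pU.
  - move=> j; apply: cprim_eq (cprimD (pV0 y j) (pVp j)) => // x _.
    have E1 : (- (c j)^-1)%:C = - ((c j)^-1)%:C := rmorphN (real_complex R) _.
    have E2 : ((c j)^-1)%:C = ((c j)%:C)^-1 := fmorphV (real_complex R) _.
    by rewrite /U /h E1 E2; ring.
  - move=> i; rewrite /V.
    under eq_bigr do rewrite Vp0 addr0.
    under [X in _ = X]eq_bigr do rewrite mulrDr.
    rewrite big_split/=; have /rowP/(_ (rshift m i)) := Ty.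
    rewrite /T1 /y0 !row_mxEr !mxE => /eqP; rewrite subr_eq => /eqP ->.
    by rewrite addrC.
  - exists (\col_i dd y i) => j; rewrite !mxE /U Up0; split.
      by rewrite /U0 C0 S0 mulr1 mulr0 !addr0.
    have /rowP/(_ (lshift n j)) := Ty.
    rewrite /T1 /y0 !row_mxEl !mxE => /eqP; rewrite subr_eq => /eqP ->.
    by rewrite addrAC addNr add0r.
move=> j x x01; rewrite /U mulrDl; apply: le_trans (le_normcD _ _) _.
apply: lerD; last exact: Upb.
set B := K * (Ks * (Kp * N)) in yb.
have B0 : 0 <= B by rewrite !mulr_ge0.
apply: (@le_trans _ _ ((BC j + BS j) * B)).
  rewrite /U0 mulrDl; apply: le_trans (le_normcD _ _) _.
  by apply: lerD; rewrite Normc.normcM mulrC; apply: ler_pM; rewrite ?normc_ge0//;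
    [exact: (hBC j).2|exact: yb|exact: (hBS j).2|exact: yb].
rewrite -!mulrA; apply: ler_wpM2r => //.
by rewrite /Kb (bigD1 j)//= lerDl sumr_ge0.
Qed.

End Fredholm.

Lemma shifted_L2 z f : D f -> in_X2 (shifted A z f).
Proof.
move=> /domAP[U [V [v [rf _ _]]]] j; have [L2f _ _ _ _] := rf j.
have := L2D (L2Z z L2f) (L2Z (-1) (opA_L2 c rf j)).
by congr is_L2; apply/funext => x; rewrite entry_shifted mulN1r.
Qed.

Lemma netsolB z g f U V f' U' V' : netsol z g f U V -> netsol z g f' U' V' ->
  netsol z (@zero_X2 R m) (fun x => f x - f' x) (fun j x => U j x - U' j x)
    (fun j x => V j x - V' j x).
Proof.
move=> [fU pU pV kV [d nU]] [fU' pU' pV' kV' [d' nU']]; split.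
- move=> j; have [L2f fUj] := fU j; have [L2f' fUj'] := fU' j.
  have E : entry (fun x => f x - f' x) j = fun x => entry f j x - entry f' j x.
    by apply/funext => x; rewrite /entry !mxE.
  rewrite E; split; last by apply: filterS2 fUj fUj' => x /= + + x01 => -> // ->.
  have := L2D L2f (L2Z (-1) L2f').
  by congr is_L2; apply/funext => x; rewrite mulN1r.
- by move=> j; exact: cprimB.
- move=> j; apply: cprim_eq (cprimB (pV j) (pV' j)) => // x _.
  by rewrite /entry mxE; ring.
- move=> i; under eq_bigr do rewrite mulrBr.
  under [in X in _ = X]eq_bigr do rewrite mulrBr.
  by rewrite !sumrB kV kV'.
- exists (d - d') => j; rewrite !mxE.
  by have [-> ->] := nU j; have [-> ->] := nU' j.
Qed.

(** Absence of eigenvectors is the injectivity that [netsol_solve] asks for. The bound on the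
    inverse then combines its estimate with the Cauchy-Schwarz comparison of the $L^1$ and $X_2$
    norms. *)
Lemma resolventP z : ~ is_eigenvalue D A z -> in_resolvent_set mu D A z.
Proof.
move=> noeig.
have inj f U V : netsol z (@zero_X2 R m) f U V -> forall j x, 0 <= x <= 1 -> U j x = 0.
  move=> s; have [/(netsol_ae0 s)//|nf] := pselect (eq_X2 f (@zero_X2 R m)).
  exfalso; apply: noeig; exists f; split=> //.
  by apply/(eigenspaceP e0 e1 mu c_gt0); exists U, V.
have [M M0 hM] := netsol_solve inj.
split.
- move=> f Df sf.
  have [U [V s]] := (netsolP e0 e1 mu c_gt0 f z (@zero_X2_L2 R m)).1 (conj Df sf).
  exact: netsol_U0 s (inj _ _ _ s).
- move=> g L2g; have [f [U [V [s _]]]] := hM g L2g.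
  have [Df sf] := (netsolP e0 e1 mu c_gt0 f z L2g).2 (ex_intro _ U (ex_intro _ V s)).
  by exists f.
exists (Num.sqrt (\sum_j mu j) * (M * \sum_j (Num.sqrt (mu j))^-1)) => f Df.
set g := shifted A z f.
have L2g : in_X2 g by exact: shifted_L2.
have [U [V s]] := (netsolP e0 e1 mu c_gt0 f z L2g).1 (conj Df (ae_eq_refl _ _ _)).
(* The given [f] coincides with the constructed solution by uniqueness, and so inherits its
   bound. *)
have [f' [U' [V' [s' b']]]] := hM g L2g.
have UU' j x : 0 <= x <= 1 -> U j x = U' j x.
  by move=> x01; apply/eqP; rewrite -subr_eq0; apply/eqP; exact: inj (netsolB s s') j x x01.
have [fU pU _ _ _] := s.
rewrite -!mulrA; apply: (norm_X2_le fU) => [j||]; first by exists (V j); exact: pU.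
  have nn : 0 <= norm_X2 mu g by exact: sqrtr_ge0.
  have si : 0 <= \sum_j (Num.sqrt (mu j))^-1.
    by rewrite sumr_ge0// => j _; rewrite invr_ge0 sqrtr_ge0.
  by rewrite !mulr_ge0.
move=> j x x01; rewrite UU'//; apply: le_trans (b' j x x01) _.
rewrite ler_wpM2l// mulr_suml; apply: ler_sum => i _.
exact: normC1_norm_X2.
Qed.

End Resolvent.

(** * Trigonometric eigenfunctions *)

Section TrigSolutions.
Variables (R : realType) (n m : nat) (e0 e1 : 'I_m -> 'I_n) (mu c : 'I_m -> R).
Local Notation leb := (@lebesgue_measure R).
Local Notation C := R[i].
Local Notation I01 := (`]0, 1[%classic : set R).
Local Notation D := (domA e0 e1 mu c).
Local Notation A := (opA c).
Local Notation netsol := (netsol e0 e1 mu c).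
Implicit Types (f g : R -> 'cV[C]_m) (z : C) (x : R) (U V : 'I_m -> R -> C).
Hypothesis mu_gt0 : forall j, 0 < mu j.
Hypothesis c_gt0 : forall j, 0 < c j.
Hypothesis covered : forall i, exists j, e0 j = i \/ e1 j = i.

Variable s : R.
Hypothesis s_neq0 : s != 0.

Definition freq j : R := s / Num.sqrt (c j).

Lemma freq_neq0 j : freq j != 0.
Proof. by rewrite mulf_neq0// invr_eq0 gt_eqF// sqrtr_gt0. Qed.

Lemma freq_sqr j : (- (freq j) ^+ 2)%:C = (- s ^+ 2)%:C / (c j)%:C :> C.
Proof.
rewrite -[RHS](_ : (- s ^+ 2 / c j)%:C = _).
  by rewrite /freq exprMn exprVn sqr_sqrtr ?mulNr// ltW.
by rewrite (rmorphM (real_complex R)) (fmorphV (real_complex R)).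
Qed.

(** The general solution of $c_ju''=-s^2u$, with [p] the value at 0 and [q] the sine amplitude, that
    is, the initial slope divided by [freq j]. *)
Definition wave (p q : C) j x : C :=
  (cos (freq j * x))%:C * p + (sin (freq j * x))%:C * q.

Definition dwave (p q : C) j x : C :=
  (freq j)%:C * ((cos (freq j * x))%:C * q - (sin (freq j * x))%:C * p).

Lemma wave_prim p q j : cprim (wave p q j) (dwave p q j).
Proof.
have pc := cprim_real (isprim_cos (freq j)).
have ps := cprim_real (isprim_sin (freq j)).
apply: cprim_eq (cprimD (cprimZ p pc) (cprimZ q ps)) => x _.
  by rewrite /wave mulrC [X in _ + X]mulrC.
rewrite /dwave (rmorphN (real_complex R)) !(rmorphM (real_complex R)); ring.
Qed.

Lemma dwave_prim p q j :
  cprim (dwave p q j) (fun x => (- s ^+ 2)%:C / (c j)%:C * wave p q j x).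
Proof.
have pc := cprim_real (isprim_cos (freq j)).
have ps := cprim_real (isprim_sin (freq j)).
apply: cprim_eq (cprimZ (freq j)%:C (cprimB (cprimZ q pc) (cprimZ p ps))) => x _.
  by rewrite /dwave mulrC [q * _]mulrC [p * _]mulrC mulrC.
rewrite -freq_sqr /wave !(rmorphN (real_complex R)) !(rmorphM (real_complex R)).
ring.
Qed.

Lemma wave0 p q j : wave p q j 0 = p.
Proof. by rewrite /wave mulr0 cos0 sin0 mul1r mul0r addr0. Qed.

Lemma dwave0 p q j : dwave p q j 0 = (freq j)%:C * q.
Proof. by rewrite /dwave mulr0 cos0 sin0 mul1r mul0r subr0. Qed.

Definition waves (d : 'cV[C]_n) (b : 'cV[C]_m) : R -> 'cV[C]_m :=
  fun x => \col_j wave (d (e0 j) 0) (b j 0) j x.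

Lemma entry_waves d b j : entry (waves d b) j = wave (d (e0 j) 0) (b j 0) j.
Proof. by apply/funext => x; rewrite /entry mxE. Qed.

Lemma waves_L2 d b : in_X2 (waves d b).
Proof. by move=> j; rewrite entry_waves; exact: L2_cprim (wave_prim _ _ _). Qed.

(* [d] are the vertex values and [b] the sine amplitudes on the edges. *)
Definition wave_conds (d : 'cV[C]_n) (b : 'cV[C]_m) : Prop :=
  (forall j, (cos (freq j))%:C * d (e0 j) 0 + (sin (freq j))%:C * b j 0 = d (e1 j) 0) /\
  (forall i, \sum_(j | e0 j == i) (mu j * c j * freq j)%:C * b j 0 =
    \sum_(j | e1 j == i) (mu j * c j * freq j)%:C *
      ((cos (freq j))%:C * b j 0 - (sin (freq j))%:C * d (e0 j) 0)).

Lemma wave_condsP d b : wave_conds d b <->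
  kirchhoff e0 e1 mu c (fun j => dwave (d (e0 j) 0) (b j 0) j) /\
  node_values e0 e1 (fun j => wave (d (e0 j) 0) (b j 0) j) d.
Proof.
have E1 i : \sum_(j | e0 j == i) (mu j * c j * freq j)%:C * b j 0 =
    \sum_(j | e0 j == i) (mu j * c j)%:C * dwave (d (e0 j) 0) (b j 0) j 0.
  apply: eq_bigr => j _; rewrite dwave0 mulrA; congr (_ * _).
  exact: (rmorphM (real_complex R)).
have E2 i : \sum_(j | e1 j == i) (mu j * c j * freq j)%:C *
      ((cos (freq j))%:C * b j 0 - (sin (freq j))%:C * d (e0 j) 0) =
    \sum_(j | e1 j == i) (mu j * c j)%:C * dwave (d (e0 j) 0) (b j 0) j 1.
  apply: eq_bigr => j _; rewrite /dwave mulr1 mulrA; congr (_ * _).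
  exact: (rmorphM (real_complex R)).
split=> -[h1 h2]; split.
- by move=> i; rewrite -E1 -E2.
- by move=> j; rewrite wave0; split=> //; rewrite /wave mulr1.
- by move=> j; have [_ <-] := h2 j; rewrite /wave mulr1.
- by move=> i; rewrite E1 E2; exact: h1.
Qed.

Lemma waves_netsol f d b : in_X2 f -> eq_X2 f (waves d b) -> wave_conds d b ->
  netsol (- s ^+ 2)%:C (@zero_X2 R m) f (fun j => wave (d (e0 j) 0) (b j 0) j)
    (fun j => dwave (d (e0 j) 0) (b j 0) j).
Proof.
move=> L2f /eq_X2P fw /wave_condsP[kV nU]; split=> //.
- by move=> j; split=> //; have := fw j; rewrite entry_waves.
- by move=> j; exact: wave_prim.
- move=> j; apply: cprim_eq (dwave_prim _ _ _) => // x _.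
  by rewrite /entry mxE subr0 fmorphV; ring.
- by exists d.
Qed.

(** Choosing the amplitude as initial slope over frequency, the difference between the solution and
    the wave has zero initial data, so [ode2_uniq] applies. *)
Lemma netsol_waves f U V : netsol (- s ^+ 2)%:C (@zero_X2 R m) f U V ->
  exists d b, [/\ wave_conds d b, eq_X2 f (waves d b) &
    forall j x, 0 <= x <= 1 -> U j x = wave (d (e0 j) 0) (b j 0) j x].
Proof.
move=> sol; have [fU pU _ kV [d nU]] := sol.
have pV := eigen_ode sol.
have x0 : 0 <= (0 : R) <= 1 by rewrite lexx ler01.
have x1 : 0 <= (1 : R) <= 1 by rewrite lexx ler01.
pose b : 'cV[C]_m := \col_j (V j 0 / (freq j)%:C).
have f0 j : (freq j)%:C != 0 :> C by rewrite fmorph_eq0 freq_neq0.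
have pd j : cprim (fun x => U j x - wave (d (e0 j) 0) (b j 0) j x)
    (fun x => V j x - dwave (d (e0 j) 0) (b j 0) j x).
  exact: cprimB (pU j) (wave_prim _ _ _).
have pd' j : cprim (fun x => V j x - dwave (d (e0 j) 0) (b j 0) j x)
    (fun x => (- s ^+ 2)%:C / (c j)%:C * (U j x - wave (d (e0 j) 0) (b j 0) j x)).
  by apply: cprim_eq (cprimB (pV j) (dwave_prim _ _ _)) => // x _; rewrite mulrBr.
have Ud j x : 0 <= x <= 1 -> U j x - wave (d (e0 j) 0) (b j 0) j x = 0.
  apply: (ode2_uniq (pd j) (pd' j)); first by rewrite wave0 (nU j).1 subrr.
  by rewrite dwave0 mxE mulrCA divff// mulr1 subrr.
have Vd j x : 0 <= x <= 1 -> V j x - dwave (d (e0 j) 0) (b j 0) j x = 0.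
  exact: cprim_eq0 (pd j) (pd' j) (Ud j) x.
have UE j x : 0 <= x <= 1 -> U j x = wave (d (e0 j) 0) (b j 0) j x.
  by move=> x01; apply/eqP; rewrite -subr_eq0 Ud.
have VE j x : 0 <= x <= 1 -> V j x = dwave (d (e0 j) 0) (b j 0) j x.
  by move=> x01; apply/eqP; rewrite -subr_eq0 Vd.
exists d, b; split=> //.
  apply/wave_condsP; split=> [i|j].
    transitivity (\sum_(j | e0 j == i) (mu j * c j)%:C * V j 0).
      by apply: eq_bigr => j _; rewrite VE.
    by rewrite kV; apply: eq_bigr => j _; rewrite VE.
  by rewrite -!UE.
apply/eq_X2P => j; have [_ fUj] := fU j.
apply: filterS fUj => x /= + x01 => ->//; rewrite entry_waves UE//.
by move: x01; rewrite in_itv/= => /andP[h1 h2]; rewrite !ltW.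
Qed.

(** The parameters can be recovered from the function: [d] as vertex values, since every vertex
    meets an edge, and [b] from the initial slopes, since the frequencies are nonzero. *)
Lemma waves_eq0 d b f : wave_conds d b -> eq_X2 f (waves d b) ->
  eq_X2 f (@zero_X2 R m) <-> d = 0 /\ b = 0.
Proof.
move=> wdb fw; split=> [f0|[d0 b0]]; last first.
  apply: filterS fw => x /= + x01 => ->//; rewrite /waves d0 b0.
  by apply/colP => j; rewrite !mxE /wave !mulr0 addr0.
have w0 : eq_X2 (waves d b) (@zero_X2 R m).
  by apply: filterS2 f0 fw => x /= + + x01 => -> // <-.
have sol := waves_netsol (waves_L2 d b) (ae_eq_refl _ _ _) wdb.
have U0 := netsol_ae0 sol w0.
have /wave_condsP[_ nU] := wdb.
have x0 : 0 <= (0 : R) <= 1 by rewrite lexx ler01.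
have x1 : 0 <= (1 : R) <= 1 by rewrite lexx ler01.
split; apply/colP.
  move=> i; rewrite mxE; have [j [<-|<-]] := covered i.
    by have [<- _] := nU j; rewrite U0.
  by have [_ <-] := nU j; rewrite U0.
move=> j; have := cprim_eq0 (wave_prim _ _ j) (dwave_prim _ _ j) (U0 j) x0.
by move=> /eqP; rewrite dwave0 mulf_eq0 fmorph_eq0 (negPf (freq_neq0 j))/= mxE => /eqP.
Qed.

Lemma waves_eigenspaceP f : eigenspace D A (- s ^+ 2)%:C f <->
  in_X2 f /\ exists d b, wave_conds d b /\ eq_X2 f (waves d b).
Proof.
split.
  move=> /(eigenspaceP e0 e1 mu c_gt0)[U [V sol]]; split.
    by move=> j; have [fU _ _ _ _] := sol; case: (fU j).
  by have [d [b [wdb fw _]]] := netsol_waves sol; exists d, b.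
move=> [L2f [d [b [wdb fw]]]]; apply/(eigenspaceP e0 e1 mu c_gt0).
by eexists; eexists; exact: waves_netsol L2f fw wdb.
Qed.

Lemma waves_eigenvectorP f : is_eigenvector D A (- s ^+ 2)%:C f <->
  in_X2 f /\ exists d b, [/\ wave_conds d b, eq_X2 f (waves d b) & b != 0 \/ d != 0].
Proof.
split=> [[/waves_eigenspaceP[L2f [d [b [wdb fw]]]] f0]|[L2f [d [b [wdb fw db]]]]].
  split=> //; exists d, b; split=> //.
  have [d0|] := eqVneq d 0; last by right.
  left; apply/eqP => b0; apply: f0; exact/(waves_eq0 wdb fw).
split; first by apply/waves_eigenspaceP; split=> //; exists d, b.
by move=> /(waves_eq0 wdb fw)[d0 b0]; case: db; rewrite ?d0 ?b0 eqxx.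
Qed.

End TrigSolutions.

(** * Sine and cosine at multiples of pi *)

Section Trigonometry.
Variable R : realType.
Implicit Types (x y t : R) (k : int).

Lemma sin_intpi k : sin (k%:~R * pi) = 0 :> R.
Proof.
have sn p : sin (p%:R * pi) = 0 :> R.
  elim: p => [|p IH]; first by rewrite mul0r sin0.
  by rewrite -natr1 mulrDl mul1r sinDpi IH oppr0.
case: k => p; first exact: sn.
by rewrite NegzE intrN mulNr sinN sn oppr0.
Qed.

Lemma cos_intpi k : (cos (k%:~R * pi))%:C = (-1) ^ k :> R[i].
Proof.
have cn p : (cos (p%:R * pi))%:C = (-1) ^+ p :> R[i].
  elim: p => [|p IH]; first by rewrite mul0r cos0.
  rewrite -natr1 mulrDl mul1r cosDpi exprS -IH mulN1r.
  exact: (rmorphN (real_complex R)).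
case: k => p; first exact: cn.
rewrite [in LHS]NegzE intrN mulNr cosN cn.
exact/esym/invr_sign.
Qed.

(** Subtracting $\lfloor y/\pi\rfloor\pi$ moves $y$ into $[0,\pi[$, where the sine is positive
    except at 0. *)
Lemma sin_eq0 y : sin y = 0 -> exists k : int, y = k%:~R * pi.
Proof.
move=> sy; pose k := Num.floor (y / pi); exists k.
have pi0 := pi_gt0 R.
have /andP[k1 k2] := real_floor_itv (num_real (y / pi)).
have r0 : 0 <= y - k%:~R * pi by rewrite subr_ge0 -ler_pdivlMr.
have r1 : y - k%:~R * pi < pi.
  rewrite ltrBlDr -[X in X + _]mul1r -mulrDl addrC -ltr_pdivrMr//.
  by rewrite intrD in k2.
have : sin (y - k%:~R * pi) = 0 by rewrite sinB sy sin_intpi mul0r mulr0 subrr.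
apply: contra_eq => yk.
rewrite gt_eqF// sin_gt0_pi// r1 andbT lt_neqAle r0 andbT eq_sym subr_eq0.
exact: yk.
Qed.

Lemma sin_pi_neq0 t : t \isn't a Num.int -> sin (t * pi) != 0.
Proof.
apply: contra => /eqP/sin_eq0[k /mulIf -> //]; last by rewrite gt_eqF ?pi_gt0.
Qed.

End Trigonometry.

(** * Dimensions of spaces parameterized by the kernel of a matrix *)

Section Dimension.
Variables (R : realType) (n m : nat).
Local Notation C := R[i].
Local Notation X := (R -> 'cV[C]_m).

Lemma has_dim_iff (P Q : X -> Prop) N : (forall f, P f <-> Q f) ->
  has_dim P N -> has_dim Q N.
Proof.
move=> PQ [F [PF Fi Fs]]; exists F; split=> //.
  by move=> i; apply/PQ.
by move=> f /PQ; exact: Fs.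
Qed.

(** [Psi] is linear and injective on the kernel of [L], so it carries a basis to a basis. The
    transpose appears because [kermx] is a left kernel of row vectors. *)
Lemma has_dim_kernel (P : X -> Prop) (L : 'M[C]_n) (Psi : 'cV[C]_n -> X) :
  (forall a u v x, Psi (a *: u + v) x = a *: Psi u x + Psi v x) ->
  (forall d, L *m d = 0 -> P (Psi d)) ->
  (forall d, L *m d = 0 -> eq_X2 (Psi d) (@zero_X2 R m) -> d = 0) ->
  (forall f, P f -> exists2 d, L *m d = 0 & eq_X2 f (Psi d)) ->
  has_dim P (\rank (kermx L^T)).
Proof.
move=> Psil PPsi Psi0 PsiP.
pose B := row_base (kermx L^T).
have Psi00 x : Psi 0 x = 0.
  have := Psil 1 0 0 x; rewrite scaler0 addr0 scale1r => h.
  by apply: (addrI (Psi 0 x)); rewrite addr0 -h.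
have PsiD u v x : Psi (u + v) x = Psi u x + Psi v x.
  by have := Psil 1 u v x; rewrite !scale1r.
have PsiZ a u x : Psi (a *: u) x = a *: Psi u x.
  by have := Psil a u 0 x; rewrite Psi00 !addr0.
have PsiS a x : Psi (a *m B)^T x = \sum_i a 0 i *: Psi (row i B)^T x.
  rewrite mulmx_sum_row (raddf_sum trmx).
  rewrite (big_morph (Psi^~ x) (fun u v => PsiD u v x) (Psi00 x)).
  by apply: eq_bigr => i _; rewrite -PsiZ; congr Psi; apply/matrixP => k l; rewrite !mxE.
have LB a : L *m (a *m B)^T = 0.
  have BL : B *m L^T = 0 by apply/sub_kermxP; rewrite eq_row_base.
  by apply: trmx_inj; rewrite trmx_mul trmxK trmx0 -mulmxA BL mulmx0.
exists (fun i => Psi (row i B)^T); split.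
- move=> i; apply: PPsi; rewrite rowE; exact: LB.
- move=> a a0 i; pose u := \row_i a i.
  have : (u *m B)^T = 0.
    apply: Psi0 => //; apply: filterS a0 => x /= /[apply] <-.
    by rewrite PsiS; apply: eq_bigr => j _; rewrite mxE.
  move=> /(congr1 trmx); rewrite trmxK trmx0 => /eqP.
  by rewrite mulmx_free_eq0 ?row_base_free// => /eqP/rowP/(_ i); rewrite !mxE.
move=> f /PsiP[d Ld fd].
have /submxP[a da] : (d^T <= B)%MS.
  by rewrite eq_row_base; apply/sub_kermxP; rewrite -trmx_mul Ld trmx0.
exists (fun i => a 0 i); apply: filterS fd => x /= /[apply] ->.
by rewrite -PsiS -da trmxK.
Qed.

End Dimension.

(** * From the wave conditions to the vertex matrix *)

Section VertexMatrices.
Variables (R : realType) (n m : nat) (e0 e1 : 'I_m -> 'I_n) (mu c : 'I_m -> R).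
Local Notation C := R[i].
Hypothesis G_simple : simple_graph e0 e1.
Hypothesis mu_gt0 : forall j, 0 < mu j.
Hypothesis c_gt0 : forall j, 0 < c j.

Lemma joins_inj i k j j' : joins e0 e1 j i k -> joins e0 e1 j' i k -> j = j'.
Proof.
have [_ inj] := G_simple; move=> h h'; apply: inj.
by case/orP: h => /andP[/eqP-> /eqP->] //; rewrite /joins orbC.
Qed.

(** Without loops no edge both starts and ends at [i], so the incident edges split into two disjoint
    families. *)
Lemma sum_Gamma (F : 'I_m -> R) i : \sum_(j in Gamma e0 e1 i) F j =
  \sum_(j | e0 j == i) F j + \sum_(j | e1 j == i) F j.
Proof.
have [loop _] := G_simple.
rewrite (bigID (fun j => e0 j == i))/=; congr (_ + _); apply: eq_bigl => j.
  by rewrite inE; case: (e0 j == i); rewrite ?andbT ?andbF.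
rewrite inE; have [e0i|] := eqVneq (e0 j) i; last by rewrite andbT.
by have := loop j; rewrite e0i eq_sym => /negPf->.
Qed.

(** In a simple graph at most one edge joins [i] and [k], in one of the two orientations, so the
    sums have at most one term in all and [pick] finds it; on the diagonal they are empty since
    there are no loops. *)
Lemma sum_joins (a : 'I_m -> C) i k :
  (if i == k then 0 else if [pick j | joins e0 e1 j i k] is Some j then a j else 0) =
  \sum_(j | (e0 j == i) && (e1 j == k)) a j + \sum_(j | (e1 j == i) && (e0 j == k)) a j.
Proof.
have [loop _] := G_simple.
have [->|ik] := eqVneq i k.
  have nojk j : (e0 j == k) && (e1 j == k) = false.
    by apply/negP => /andP[/eqP h /eqP h']; have := loop j; rewrite h h' eqxx.
  by rewrite !big_pred0 ?addr0// => j; rewrite 1?andbC nojk.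
case: pickP => [j jik|noj]; last first.
  have n1 j : (e0 j == i) && (e1 j == k) = false.
    by have := noj j; rewrite /joins => /norP[/negPf].
  have n2 j : (e1 j == i) && (e0 j == k) = false.
    by rewrite andbC; have := noj j; rewrite /joins => /norP[_ /negPf].
  by rewrite !big_pred0 ?addr0// => j; rewrite ?n1 ?n2.
have uniq j' : joins e0 e1 j' i k -> j' = j by move=> h; exact: joins_inj h jik.
case/orP: (jik) => /andP[/eqP e0j /eqP e1j].
  rewrite (bigD1 j) ?e0j ?e1j ?eqxx//= big1 ?addr0 => [|j' /andP[/andP[h1 h2] h3]].
    rewrite big_pred0 ?addr0// => j'; apply/negP => /andP[h1 h2].
    have jj : j' = j by apply: uniq; rewrite /joins h2 h1 orbT.
    by move: h1; rewrite jj e1j eq_sym (negPf ik).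
  by move: h3; rewrite (uniq j') ?eqxx// /joins h1 h2.
rewrite addrC (bigD1 j) ?e0j ?e1j ?eqxx//= big1 ?addr0 => [|j' /andP[/andP[h1 h2] h3]].
  rewrite big_pred0 ?addr0// => j'; apply/negP => /andP[h1 h2].
  have jj : j' = j by apply: uniq; rewrite /joins h1 h2.
  by move: h1; rewrite jj e0j eq_sym (negPf ik).
by move: h3; rewrite (uniq j') ?eqxx// /joins h1 h2 orbT.
Qed.

Lemma sum_A_C (lam : R) (d : 'cV[C]_n) i :
  (A_C e0 e1 mu c lam *m d) i 0 =
  \sum_(j | e0 j == i) (mu j * Num.sqrt (c j) / sin (Num.sqrt (lam / c j)))%:C * d (e1 j) 0 +
  \sum_(j | e1 j == i) (mu j * Num.sqrt (c j) / sin (Num.sqrt (lam / c j)))%:C * d (e0 j) 0.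
Proof.
rewrite mxE; under eq_bigr do rewrite mxE sum_joins mulrDl.
rewrite big_split/=; congr (_ + _).
  rewrite [RHS](partition_big e1 predT)//=; apply: eq_bigr => k _.
  by rewrite mulr_suml; apply: eq_bigr => j /andP[_ /eqP ->].
rewrite [RHS](partition_big e0 predT)//=; apply: eq_bigr => k _.
by rewrite mulr_suml; apply: eq_bigr => j /andP[_ /eqP ->].
Qed.

Lemma sum_D_C (lam : R) (d : 'cV[C]_n) i :
  (D_C e0 e1 mu c lam *m d) i 0 =
  \sum_(j | e0 j == i) (mu j * Num.sqrt (c j) * cot (Num.sqrt (lam / c j)))%:C * d (e0 j) 0 +
  \sum_(j | e1 j == i) (mu j * Num.sqrt (c j) * cot (Num.sqrt (lam / c j)))%:C * d (e1 j) 0.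
Proof.
rewrite /D_C mul_diag_mx !mxE sum_Gamma (rmorphD (real_complex R)) mulrDl.
rewrite !(rmorph_sum (real_complex R)) !mulr_suml.
by congr (_ + _); apply: eq_bigr => j /eqP ->.
Qed.

Section AwayFromPoles.
Variable lam : R.
Hypothesis lam_gt0 : 0 < lam.
Hypothesis lam_out : forall (i : 'I_m) (k : int), lam != c i * k%:~R ^+ 2 * pi ^+ 2.
Let s := Num.sqrt lam.
Let w j := freq c s j.

Lemma sqrt_lam_neq0 : s != 0.
Proof. by rewrite gt_eqF// sqrtr_gt0. Qed.

Lemma sqrt_lamE j : Num.sqrt (lam / c j) = w j.
Proof. by rewrite sqrtrM ?(ltW lam_gt0)// sqrtrV ?(ltW (c_gt0 _)). Qed.

Lemma sin_freq_neq0 j : sin (w j) != 0.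
Proof.
apply/eqP => /sin_eq0[k wk]; have /eqP := lam_out j k; apply.
have : w j ^+ 2 = lam / c j.
  by rewrite -sqrt_lamE sqr_sqrtr// divr_ge0 ?ltW.
rewrite wk => h; rewrite -mulrA -exprMn h mulrCA divff ?mulr1// gt_eqF//.
Qed.

(** The sine coefficients forced by the value at $x=1$: the solution $b_j$ of
    $\cos(w_j)\,d_s+\sin(w_j)\,b_j=d_r$. *)
Definition amplitudes (d : 'cV[C]_n) : 'cV[C]_m :=
  \col_j (((sin (w j))^-1)%:C * (d (e1 j) 0 - (cos (w j))%:C * d (e0 j) 0)).

(** The matching conditions are equivalent to prescribing [b]; the Kirchhoff condition then involves
    [d] alone, and its defect is $-\sqrt\lambda$ times $\mathcal L_C(\lambda)d$. *)
Lemma wave_conds_L d b : wave_conds e0 e1 mu c s d b <->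
  b = amplitudes d /\ L_C e0 e1 mu c lam *m d = 0.
Proof.
have sC j : (sin (w j))%:C != 0 :> C by rewrite fmorph_eq0 sin_freq_neq0.
have RM (x y : R) : (x * y)%:C = x%:C * y%:C :> C := rmorphM (real_complex R) x y.
have RN (x : R) : (- x)%:C = - x%:C :> C := rmorphN (real_complex R) x.
have RV (x : R) : (x^-1)%:C = (x%:C)^-1 :> C := fmorphV (real_complex R) x.
have bE : (forall j, (cos (w j))%:C * d (e0 j) 0 + (sin (w j))%:C * b j 0 = d (e1 j) 0) <->
    b = amplitudes d.
  split=> [h|-> j].
    by apply/colP => j; rewrite mxE -h fmorphV addrC addKr mulKf//; exact: sC.
  by rewrite mxE fmorphV mulVKf ?sC// addrC subrK.
(* The factor $\sqrt\lambda$ comes from $\mu_jc_jw_j=\sqrt\lambda\,\mu_j\sqrt{c_j}$, the rest being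
   the entries of $\mathcal L_C$. *)
have LE : b = amplitudes d -> forall i,
    \sum_(j | e0 j == i) (mu j * c j * w j)%:C * b j 0 -
    \sum_(j | e1 j == i) (mu j * c j * w j)%:C *
      ((cos (w j))%:C * b j 0 - (sin (w j))%:C * d (e0 j) 0) =
    (- s)%:C * (L_C e0 e1 mu c lam *m d) i 0.
  move=> -> i.
  have cw j : mu j * c j * w j = s * (mu j * Num.sqrt (c j)).
    have sc : Num.sqrt (c j) != 0 by rewrite gt_eqF// sqrtr_gt0.
    rewrite -[in X in mu j * X](sqr_sqrtr (ltW (c_gt0 j))) /w /freq.
    by field.
  rewrite /L_C mulmxBl mxE [(- (A_C _ _ _ _ _ *m _)) _ _]mxE sum_A_C sum_D_C.
  rewrite opprD addrACA -!sumrB mulrDr !mulr_sumr -sumrN.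
  congr (_ + _); apply: eq_bigr => j _; rewrite cw sqrt_lamE /cot mxE.
    rewrite RN !RM !RV; have := sC j.
    by move: (sin _)%:C (cos _)%:C => S K S0; field.
  (* At the far end of an edge $\cos^2$ and $\sin^2$ recombine to give the $1/\sin$ of the
     off-diagonal entry. *)
  have cs : (cos (w j))%:C * (cos (w j))%:C = 1 - (sin (w j))%:C * (sin (w j))%:C :> C.
    by rewrite -!RM -!expr2 cos2sin2 (rmorphB (real_complex R)).
  rewrite RN !RM !RV; move: (sC j) cs; move: (sin _)%:C (cos _)%:C => S K S0 cs.
  move: (d _ _) (d _ _) => d0 d1.
  have -> : K * (S^-1 * (d1 - K * d0)) - S * d0 = (K / S) * d1 - d0 / S.
    transitivity (K / S * d1 - (K * K) / S * d0 - S * d0); first by ring.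
    by rewrite cs; field.
  by ring.
split=> [[h1 h2]|[bd Ld]].
  have bd := bE.1 h1; split=> //; apply/colP => i; rewrite [RHS]mxE.
  have := LE bd i; rewrite h2 subrr => /esym/eqP; rewrite mulf_eq0 => /orP[|/eqP//].
  by rewrite fmorph_eq0 oppr_eq0 (negPf sqrt_lam_neq0).
split; first exact/bE.
by move=> i; apply/eqP; rewrite -subr_eq0 (LE bd) Ld mxE mulr0.
Qed.

Lemma eigenfun_L_waves d : eigenfun_L e0 e1 c lam d = waves e0 c s d (amplitudes d).
Proof.
apply/funext => x; apply/colP => j.
have invS : invmx (Sin c s) = diag_mx (\row_j ((sin (w j))^-1)%:C).
  have SS : diag_mx (\row_j ((sin (w j))^-1)%:C) *m Sin c s = 1%:M.
    rewrite mulmx_diag; apply/matrixP => i k; rewrite !mxE; congr (_ *+ _).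
    rewrite -(rmorphM (real_complex R)) mulVf ?sin_freq_neq0//.
  have uS : Sin c s \in unitmx by case/mulmx1_unit: SS.
  by rewrite -[LHS]mul1mx -SS -mulmxA mulmxV// mulmx1.
have diagE (r : 'rV[C]_m) (v : 'cV[C]_m) : (diag_mx r *m v) j 0 = r 0 j * v j 0.
  by rewrite mul_diag_mx mxE.
rewrite /eigenfun_L -/s invS -!mulmxA mulmxBl -mulmxA [LHS]mxE !diagE.
rewrite [(_ *m _ - _ *m _) _ _]mxE [(- (_ *m _)) _ _]mxE diagE.
rewrite trPhi_plusE trPhi_minusE [RHS]mxE /wave !mxE.
have fx : freq c s j * x = s * x / Num.sqrt (c j) by rewrite /freq mulrAC.
by rewrite fx /w /freq; ring.
Qed.

End AwayFromPoles.
End VertexMatrices.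

(** * Classification of the eigenvalues *)

Section Eigenvalues.
Variables (R : realType) (n m : nat) (e0 e1 : 'I_m -> 'I_n) (mu c : 'I_m -> R).
Local Notation leb := (@lebesgue_measure R).
Local Notation C := R[i].
Local Notation I01 := (`]0, 1[%classic : set R).
Local Notation D := (domA e0 e1 mu c).
Local Notation A := (opA c).
Local Notation netsol := (netsol e0 e1 mu c).
Implicit Types (f g : R -> 'cV[C]_m) (z : C) (x : R) (U V : 'I_m -> R -> C).
Hypothesis G_simple : simple_graph e0 e1.
Hypothesis G_connected : connected_graph e0 e1.
Hypothesis covered : forall i, exists j, e0 j = i \/ e1 j = i.
Hypothesis mu_gt0 : forall j, 0 < mu j.
Hypothesis c_gt0 : forall j, 0 < c j.

Lemma eigenvalue_spectrum z : is_eigenvalue D A z -> spectrum mu D A z.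
Proof.
move=> [f [[Df Af] f0]] [inj _ _]; apply: f0; apply: inj => //.
by apply: filterS Af => x /= /[apply] h; rewrite /shifted h subrr.
Qed.

(** Induction on the exponent: $(z-A)f$ is an eigenvector or null by the induction hypothesis, and
    [kernel_shift] makes it null. *)
Lemma generalized_eigenspaceP z f : z^* = z ->
  eigenspace D A z f <-> generalized_eigenspace D A z f.
Proof.
move=> zz; split=> [[Df Af]|[k]].
  exists 1%N; split=> //; split; first exact: shifted_L2 Df.
  by apply: filterS Af => x /= /[apply] h; rewrite /shifted h subrr.
elim: k f => [|k IH] f /=.
  (* The zeroth power has the null class as kernel; any of its representatives lies in the domain,
     witnessed by zero functions. *)
  move=> [L2f f0]; apply/(eigenspaceP e0 e1 mu c_gt0).
  exists (fun _ _ => 0), (fun _ _ => 0); split.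
  - move=> j; split; first exact: L2f.
    by have /eq_X2P/(_ j) := f0; apply: filterS => x /= /[apply] ->; rewrite /entry mxE.
  - by move=> j; exact: cprim_cst.
  - move=> j; apply: cprim_eq (cprim_cst 0) => // x _.
    by rewrite /entry mxE mulr0 subrr mulr0.
  - by move=> i; rewrite !big1// => j _; rewrite mulr0.
  - by exists 0 => j; rewrite !mxE.
move=> [Df /IH /(eigenspaceP e0 e1 mu c_gt0)[U' [V' sg]]].
have L2g := shifted_L2 z Df.
have [U [V sf]] := (netsolP e0 e1 mu c_gt0 f z L2g).1 (conj Df (ae_eq_refl _ _ _)).
have U0 := kernel_shift mu_gt0 c_gt0 zz L2g sf sg.
split=> //; apply: filterS (netsol_U0 sg U0) => x /= /[apply] /eqP.
by rewrite /shifted subr_eq0 => /eqP.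
Qed.

Lemma const_ae (a b : C) : ae_eq leb I01 (fun=> a) (fun=> b) -> a = b.
Proof.
move=> ab; have x0 : 0 <= (0 : R) <= 1 by rewrite lexx ler01.
have := continuous_rep_eq (cprim_cst b) ab x0.
by rewrite (continuous_rep_eq (cprim_cst a) (ae_eq_refl _ _ _) x0).
Qed.

Lemma const_L2 (a : C) : in_X2 (fun _ : R => const_mx a : 'cV[C]_m).
Proof.
move=> j; have := L2_cprim (cprim_cst a).
by congr is_L2; apply/funext => x; rewrite /entry mxE.
Qed.

Lemma connected_const (d : 'cV[C]_n) : (forall j, d (e0 j) 0 = d (e1 j) 0) ->
  forall u v, d u 0 = d v 0.
Proof.
move=> de u v; have [_ /(_ u v)/connectP[p]] := G_connected.
elim: p u => [|w p IH] u /=; first by move=> _ ->.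
move=> /andP[/existsP[j /orP[]/andP[/eqP<- /eqP<-]] pw] vl.
  by rewrite de; apply: IH.
by rewrite -de; apply: IH.
Qed.

(** The energy identity makes the derivative vanish, so $f$ is constant on each edge; the constants
    agree at common vertices and connectedness spreads the common value. *)
Lemma eigenspace0P f : eigenspace D A 0 f <->
  in_X2 f /\ exists a : C, eq_X2 f (fun=> const_mx a).
Proof.
split=> [/(eigenspaceP e0 e1 mu c_gt0)[U [V sol]]|[L2f [a fa]]].
  have V0 := eigen0_derivative mu_gt0 c_gt0 sol erefl.
  have [fU pU _ _ [d nU]] := sol.
  have Uc j x : 0 <= x <= 1 -> U j x = U j 0.
    apply: (cprim0_const (pU j)) => y /andP[y0 y1].
    by apply: V0; rewrite !ltW.
  have [n0 _] := G_connected; pose i0 := Ordinal n0.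
  have de j : d (e0 j) 0 = d (e1 j) 0.
    by have [<- <-] := nU j; rewrite (Uc j 1)// lexx ler01.
  split; first by move=> j; case: (fU j).
  exists (d i0 0); apply/eq_X2P => j; have [_ fUj] := fU j.
  apply: filterS fUj => x /= + x01 => ->//.
  rewrite /entry mxE Uc ?(nU j).1; first exact: connected_const.
  by move: x01; rewrite in_itv/= => /andP[h1 h2]; rewrite !ltW.
apply/(eigenspaceP e0 e1 mu c_gt0).
exists (fun _ _ => a), (fun _ _ => 0); split.
- move=> j; split; first exact: L2f.
  by have /eq_X2P/(_ j) := fa; apply: filterS => x /= /[apply] ->; rewrite /entry mxE.
- by move=> j; exact: cprim_cst.
- move=> j; apply: cprim_eq (cprim_cst 0) => // x _.
  by rewrite /entry mxE mul0r subrr mulr0.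
- by move=> i; rewrite !big1// => j _; rewrite mulr0.
- by exists (const_mx a) => j; rewrite !mxE.
Qed.

(** Ensures that $X_2$ is nonzero, so that the constant 1 is not a null function. *)
Lemma edge_exists : exists j : 'I_m, true.
Proof.
by have [n0 _] := G_connected; have [j _] := covered (Ordinal n0); exists j.
Qed.

Lemma eigenspace0_dim : has_dim (eigenspace D A 0) 1.
Proof.
have [j _] := edge_exists.
exists (fun _ _ => const_mx 1); split.
- by move=> _; apply/eigenspace0P; split; [exact: const_L2|by exists 1; exact: ae_eq_refl].
- move=> a a0 i; apply: const_ae.
  have /eq_X2P/(_ j) := a0; apply: filterS => x /= /[apply].
  by rewrite /entry big_ord1 !mxE mulr1 (ord1 i).
move=> f /eigenspace0P[_ [a fa]]; exists (fun=> a).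
apply: filterS fa => x /= /[apply] ->; rewrite big_ord1.
by apply/colP => k; rewrite !mxE mulr1.
Qed.

Lemma eigenvector0 : is_eigenvector D A 0 (fun=> const_mx 1).
Proof.
have [j _] := edge_exists; split.
  by apply/eigenspace0P; split; [exact: const_L2|by exists 1; exact: ae_eq_refl].
move=> /eq_X2P/(_ j) h; have : (1 : C) = 0.
  by apply: const_ae; apply: filterS h => x /= /[apply]; rewrite /entry !mxE.
by move/eqP; rewrite oner_eq0.
Qed.

Lemma sigma_LP (lam : R) : sigma_L e0 e1 mu c (- lam)%:C <->
  [/\ 0 < lam, forall (i : 'I_m) (k : int), lam != c i * k%:~R ^+ 2 * pi ^+ 2 &
    exists2 d : 'cV[C]_n, d != 0 & L_C e0 e1 mu c lam *m d = 0].
Proof.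
split=> [[lam' [/complexI/oppr_inj <- lam0 out /eqP]]|[lam0 out [d d0 Ld]]].
  rewrite -det_tr => /det0P[v v0 vL]; split=> //; exists v^T.
    by apply: contra v0 => /eqP/(congr1 trmx); rewrite trmxK trmx0 => ->.
  by apply: trmx_inj; rewrite trmx_mul trmxK trmx0.
exists lam; split=> //; apply/eqP; rewrite -det_tr; apply/det0P; exists d^T.
  by apply: contra d0 => /eqP/(congr1 trmx); rewrite trmxK trmx0 => ->.
by rewrite -trmx_mul Ld trmx0.
Qed.

Section AtPole.
Variables (i : 'I_m) (k : int).
Hypothesis k_neq0 : k != 0.
Let s := Num.sqrt (c i) * k%:~R * pi.

Lemma pole_neq0 : s != 0.
Proof.
have c0 : Num.sqrt (c i) != 0 by rewrite gt_eqF// sqrtr_gt0.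
have p0 : pi != 0 :> R by rewrite gt_eqF// pi_gt0.
by rewrite !mulf_neq0// intr_eq0.
Qed.

Lemma pole_sqr : - (c i * k%:~R ^+ 2 * pi ^+ 2) = - s ^+ 2.
Proof. by rewrite /s !exprMn sqr_sqrtr// ltW. Qed.

Lemma pole_freq j : freq c s j = Num.sqrt (c i / c j) * k%:~R * pi.
Proof.
by rewrite sqrtrM ?(ltW (c_gt0 _))// sqrtrV ?(ltW (c_gt0 _))// /freq /s; ring.
Qed.

Lemma eigenfun_C_waves b d : eigenfun_C e0 c i k b d = waves e0 c s d b.
Proof.
apply/funext => x; apply/colP => j.
have diagE (r : 'rV[C]_m) (v : 'cV[C]_m) : (diag_mx r *m v) j 0 = r 0 j * v j 0.
  by rewrite mul_diag_mx mxE.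
rewrite /eigenfun_C -/s -mulmxA [LHS]mxE !diagE trPhi_plusE [RHS]mxE /wave !mxE.
by have -> : freq c s j * x = s * x / Num.sqrt (c j) by rewrite /freq mulrAC.
Qed.

(** On an edge both cases are the matching condition at $x=1$ with frequency $t\pi$: for integer $t$
    the sine vanishes, the cosine is $(-1)^t$ and $b_j$ drops out; otherwise it can be solved for
    $b_j$. *)
Lemma solves_C_waves b d :
  solves_C e0 e1 mu c i k b d <-> wave_conds e0 e1 mu c s d b.
Proof.
have edge j : (let t := Num.sqrt (c i / c j) * k%:~R in
    if t \is a Num.int then d (e1 j) 0 = (-1) ^ Num.floor t * d (e0 j) 0
    else b j 0 = ((sin (t * pi))^-1)%:C * d (e1 j) 0 - (cot (t * pi))%:C * d (e0 j) 0) <->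
  (cos (freq c s j))%:C * d (e0 j) 0 + (sin (freq c s j))%:C * b j 0 = d (e1 j) 0.
  rewrite pole_freq /=; set t := Num.sqrt _ * _.
  case: ifPn => tint.
    have /= tE : (Num.floor t)%:~R = t by apply/eqP; rewrite -intrEfloor.
    rewrite -{2 3}tE sin_intpi cos_intpi mul0r addr0.
    by split=> ->.
  have S0 : (sin (t * pi))%:C != 0 :> C by rewrite fmorph_eq0 sin_pi_neq0.
  have -> : (cot (t * pi))%:C = (cos (t * pi))%:C * (sin (t * pi))%:C^-1 :> C.
    by rewrite /cot (rmorphM (real_complex R)) (fmorphV (real_complex R)).
  have -> : ((sin (t * pi))^-1)%:C = (sin (t * pi))%:C^-1 :> C.
    exact: (fmorphV (real_complex R)).
  move: S0; move: (sin _)%:C (cos _)%:C => S K S0.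
  by split=> [->|<-]; field.
(* Since $\mu_jc_j\cdot\mathrm{freq}_j=s\,\mu_jc_j/\sqrt{c_j}$, the matrix equation is the Kirchhoff
   condition divided by the nonzero $s$. *)
have node l : (Phiw_minus e1 mu c *m Cmx c *m Sin c s *m (Phi_plus R e0)^T *m d) l 0 -
    ((Phiw_minus e1 mu c *m Cmx c *m Cos c s - Phiw_plus e0 mu c *m Cmx c) *m b) l 0 =
  (s%:C)^-1 * (\sum_(j | e0 j == l) (mu j * c j * freq c s j)%:C * b j 0 -
    \sum_(j | e1 j == l) (mu j * c j * freq c s j)%:C *
      ((cos (freq c s j))%:C * b j 0 - (sin (freq c s j))%:C * d (e0 j) 0)).
  have diagE (r : 'rV[C]_m) (v : 'cV[C]_m) j : (diag_mx r *m v) j 0 = r 0 j * v j 0.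
    by rewrite mul_diag_mx mxE.
  have RM (x y : R) : (x * y)%:C = x%:C * y%:C :> C := rmorphM (real_complex R) x y.
  have RV (x : R) : (x^-1)%:C = (x%:C)^-1 :> C := fmorphV (real_complex R) x.
  have sC : s%:C != 0 :> C by rewrite fmorph_eq0 pole_neq0.
  rewrite -!mulmxA mulmxBl -!mulmxA [X in _ - X]mxE [(- (_ *m _)) _ _]mxE.
  rewrite !Phiw_minusE mulrBr opprB addrCA !mulr_sumr -!sumrB.
  congr (_ + _); [|rewrite -sumrN]; apply: eq_bigr => j _.
    have qC : (Num.sqrt (c j))%:C != 0 :> C by rewrite fmorph_eq0 gt_eqF// sqrtr_gt0.
    rewrite /Cmx diagE mxE (RM (mu j * c j)) (RM s) RV.
    by move: s%:C sC (Num.sqrt (c j))%:C qC => S S0 Q Q0; field; rewrite ?Q0 ?S0.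
  have qC : (Num.sqrt (c j))%:C != 0 :> C by rewrite fmorph_eq0 gt_eqF// sqrtr_gt0.
  rewrite /Cmx /Sin /Cos !diagE trPhi_plusE !mxE (RM (mu j * c j)) (RM s) RV -/(freq c s j).
  by move: s%:C sC (Num.sqrt (c j))%:C qC => S S0 Q Q0; field; rewrite ?Q0 ?S0.
split=> -[h1 h2]; split.
- by move=> j; apply/edge; exact: h1.
- move=> l; apply/eqP; rewrite -subr_eq0; have := node l; rewrite h2 subrr => /esym/eqP.
  by rewrite mulf_eq0 invr_eq0 fmorph_eq0 (negPf pole_neq0).
- by move=> j; apply/edge; exact: h1.
- apply/colP => l; apply/eqP; rewrite -subr_eq0 node h2 subrr mulr0//.
Qed.

End AtPole.

Lemma eigenvalue_cases z : is_eigenvalue D A z ->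
  [\/ z = 0, candidates_C c z | sigma_L e0 e1 mu c z].
Proof.
move=> [f [ef f0]]; have := ef => /(eigenspaceP e0 e1 mu c_gt0)[U [V sol]].
have Ux : exists j x, 0 <= x <= 1 /\ U j x != 0.
  apply: contrapT => nU; apply: f0; apply: (netsol_U0 sol) => j x x01.
  by apply: contrapT => /eqP Ujx; apply: nU; exists j, x.
have := eigen_le0 mu_gt0 c_gt0 sol Ux; rewrite lecE /= => /andP[/eqP zI zR].
have zE : z = (complex.Re z)%:C by apply: complex_eqP => //=.
have [z0|z0] := eqVneq (complex.Re z) 0; first by apply: Or31; rewrite zE z0.
pose lam := - complex.Re z.
have lam0 : 0 < lam by rewrite oppr_gt0 lt_neqAle z0.
have zlam : z = (- lam)%:C by rewrite opprK.
have [out|] := pselect (forall (i : 'I_m) (k : int), lam != c i * k%:~R ^+ 2 * pi ^+ 2).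
  apply: Or33; rewrite zlam; apply/sigma_LP; split=> //.
  have s0 := sqrt_lam_neq0 lam0.
  have : is_eigenvector D A (- Num.sqrt lam ^+ 2)%:C f.
    by rewrite sqr_sqrtr ?(ltW lam0)// -zlam.
  move=> /(waves_eigenvectorP mu c_gt0 covered s0)[_ [d [b [wdb _ db]]]].
  have [bE Ld] := (wave_conds_L mu G_simple c_gt0 lam0 out d b).1 wdb.
  exists d => //; case: db => // b0; apply: contra b0 => /eqP d0.
  by apply/eqP/colP => j; rewrite bE d0 !mxE mulr0 subrr mulr0.
move=> /existsNP[i /existsNP[k /negP/negPn/eqP lamE]]; apply: Or32.
exists i, k; rewrite -lamE -zlam; split=> //.
(* The index is nonzero because $\lambda>0$. *)
apply/eqP => k0; move: lam0; rewrite lamE k0 expr0n/= mulr0 mul0r ltxx//.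
Qed.

End Eigenvalues.

Theorem theorem4p3 (R : realType) (n m : nat) (e0 e1 : 'I_m -> 'I_n)
    (mu c : 'I_m -> R)
    (G_simple : simple_graph e0 e1)
    (G_connected : connected_graph e0 e1)
    (G_degree : forall v : 'I_n, (2 <= #|Gamma e0 e1 v|)%N)
    (mu_gt0 : forall j, 0 < mu j)
    (c_gt0 : forall j, 0 < c j) :
  let D := domA e0 e1 mu c in
  let A := opA c in
  (exists sigma_C : set R[i],
     sigma_C `<=` candidates_C c /\
     spectrum mu D A = [set 0] `|` sigma_C `|` sigma_L e0 e1 mu c) /\
  [/\ spectrum mu D A 0,
      is_eigenvector D A 0 (fun=> const_mx 1),
      geometric_multiplicity D A 0 1 &
      algebraic_multiplicity D A 0 1] /\
  (forall lam : R, sigma_L e0 e1 mu c (- lam)%:C ->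
     [/\ is_eigenvalue D A (- lam)%:C,
         (forall f : R -> 'cV[R[i]]_m, in_X2 f ->
            (is_eigenvector D A (- lam)%:C f <->
             exists d : 'cV[R[i]]_n,
               [/\ d != 0, L_C e0 e1 mu c lam *m d = 0 &
                   eq_X2 f (eigenfun_L e0 e1 c lam d)])),
         geometric_multiplicity D A (- lam)%:C (\rank (kermx (L_C e0 e1 mu c lam)^T)) &
         algebraic_multiplicity D A (- lam)%:C (\rank (kermx (L_C e0 e1 mu c lam)^T))]) /\
  (forall (i : 'I_m) (k : int), k != 0 ->
     let z : R[i] := (- (c i * k%:~R ^+ 2 * pi ^+ 2))%:C in
     (is_eigenvalue D A z <->
      exists (b : 'cV[R[i]]_m) (d : 'cV[R[i]]_n),
        (b != 0 \/ d != 0) /\ solves_C e0 e1 mu c i k b d) /\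
     (forall f, is_eigenvector D A z f ->
        exists (b : 'cV[R[i]]_m) (d : 'cV[R[i]]_n),
          [/\ b != 0 \/ d != 0, solves_C e0 e1 mu c i k b d &
              eq_X2 f (eigenfun_C e0 c i k b d)])).
Proof.
move=> D A.
(* The degree condition provides an edge at each vertex, so that vertex values can be read off from
   functions on the edges. *)
have covered i : exists j, e0 j = i \/ e1 j = i.
  have /card_gt0P[j] : (0 < #|Gamma e0 e1 i|)%N by apply: leq_trans (G_degree i).
  by rewrite inE => /orP[/eqP ji|/eqP ji]; exists j; [left|right].
have e10 : is_eigenvector D A 0 (fun=> const_mx 1).
  exact: eigenvector0 G_connected covered mu_gt0 c_gt0.
have spec z : is_eigenvalue D A z -> spectrum mu D A z.
  exact: eigenvalue_spectrum.
have part2 lam : sigma_L e0 e1 mu c (- lam)%:C ->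
    [/\ is_eigenvalue D A (- lam)%:C,
      (forall f : R -> 'cV[R[i]]_m, in_X2 f ->
        (is_eigenvector D A (- lam)%:C f <->
          exists d : 'cV[R[i]]_n,
            [/\ d != 0, L_C e0 e1 mu c lam *m d = 0 &
                eq_X2 f (eigenfun_L e0 e1 c lam d)])),
      geometric_multiplicity D A (- lam)%:C (\rank (kermx (L_C e0 e1 mu c lam)^T)) &
      algebraic_multiplicity D A (- lam)%:C (\rank (kermx (L_C e0 e1 mu c lam)^T))].
  move=> /sigma_LP[lam0 out [d d0 Ld]].
  have s0 := sqrt_lam_neq0 lam0.
  have lamE : - lam = - Num.sqrt lam ^+ 2 by rewrite sqr_sqrtr// ltW.
  have wL := wave_conds_L mu G_simple c_gt0 lam0 out.
  have ew := eigenfun_L_waves e0 e1 c_gt0 lam0 out.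
  have amp0 d' : d' = 0 -> amplitudes e0 e1 c lam d' = 0.
    by move=> ->; apply/colP => j; rewrite !mxE mulr0 subrr mulr0.
  have eigP f : is_eigenvector D A (- lam)%:C f <->
      in_X2 f /\ exists d : 'cV[R[i]]_n,
        [/\ d != 0, L_C e0 e1 mu c lam *m d = 0 & eq_X2 f (eigenfun_L e0 e1 c lam d)].
    rewrite lamE; split=> [/(waves_eigenvectorP mu c_gt0 covered s0)|].
      move=> [L2f [d' [b [/wL[bE Ld'] fw db]]]]; split=> //; exists d'.
      rewrite ew -bE; split=> //; case: db => // b0.
      by apply: contra b0 => /eqP/amp0; rewrite bE => ->.
    move=> [L2f [d' [d0' Ld']]]; rewrite ew => fw.
    apply/(waves_eigenvectorP mu c_gt0 covered s0); split=> //.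
    by exists d', (amplitudes e0 e1 c lam d'); split=> //; [exact/wL|right].
  have eigL2 d' : in_X2 (eigenfun_L e0 e1 c lam d').
    by rewrite ew; exact: waves_L2.
  have espP f : eigenspace D A (- lam)%:C f <-> in_X2 f /\ exists2 d : 'cV[R[i]]_n,
      L_C e0 e1 mu c lam *m d = 0 & eq_X2 f (eigenfun_L e0 e1 c lam d).
    rewrite lamE; split=> [/(waves_eigenspaceP e0 e1 mu c_gt0 s0)|].
      by move=> [L2f [d' [b [/wL[bE Ld'] fw]]]]; split=> //; exists d'; rewrite // ew -bE.
    move=> [L2f [d' Ld']]; rewrite ew => fw.
    apply/(waves_eigenspaceP e0 e1 mu c_gt0 s0); split=> //.
    by exists d', (amplitudes e0 e1 c lam d'); split=> //; exact/wL.
  have dimE : has_dim (eigenspace D A (- lam)%:C) (\rank (kermx (L_C e0 e1 mu c lam)^T)).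
    apply: (has_dim_kernel (Psi := eigenfun_L e0 e1 c lam)).
    - by move=> a u v x; rewrite !ew; apply/colP => j; rewrite !mxE /wave; ring.
    - by move=> d' Ld'; apply/espP; split=> //; exists d' => //; exact: ae_eq_refl.
    - move=> d' Ld' z0; rewrite ew in z0.
      have wd' : wave_conds e0 e1 mu c (Num.sqrt lam) d' (amplitudes e0 e1 c lam d').
        exact/wL.
      by have [] := (waves_eq0 c_gt0 covered s0 wd' (ae_eq_refl _ _ _)).1 z0.
    - by move=> f /espP[].
  split.
  - exists (eigenfun_L e0 e1 c lam d); apply/eigP; split=> //.
    by exists d; split=> //; exact: ae_eq_refl.
  - by move=> f L2f; split=> [/eigP[]|h] //; apply/eigP.
  - exact: dimE.
  - apply: has_dim_iff dimE => f; apply: generalized_eigenspaceP => //.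
    exact: conjc_real.
split; [|split; [|split]].
(* The witness for $\sigma_C$ is the part of the spectrum among the candidates. *)
- exists (spectrum mu D A `&` candidates_C c); split=> [z []//|].
  apply/seteqP; split=> z; last first.
    move=> [[->|[]//]|zL]; first by apply: spec; eexists; exact: e10.
    have [lam [zE _ _ _]] := zL; rewrite zE in zL *.
    by apply: spec; have [] := part2 lam zL.
  (* The spectrum consists of eigenvalues alone, by contraposition of [resolventP]; the
     classification of eigenvalues then applies. *)
  move=> zs; have : is_eigenvalue D A z.
    apply: contrapT => nz; apply: zs.
    by apply: resolventP.
  move=> /(eigenvalue_cases G_simple covered mu_gt0 c_gt0)[->|zC|zL].
  - by left; left.
  - by left; right.
  - by right.
- have dim0 := eigenspace0_dim G_connected covered mu_gt0 c_gt0.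
  split=> //; first by apply: spec; eexists; exact: e10.
  apply: has_dim_iff dim0 => f; apply: generalized_eigenspaceP => //.
  exact: conjc0.
- exact: part2.
move=> i k k0 z.
have s0 := pole_neq0 c_gt0 i k0.
have eigP f : is_eigenvector D A z f <-> in_X2 f /\
    exists (b : 'cV[R[i]]_m) (d : 'cV[R[i]]_n),
      [/\ b != 0 \/ d != 0, solves_C e0 e1 mu c i k b d & eq_X2 f (eigenfun_C e0 c i k b d)].
  rewrite /z pole_sqr//; split=> [/(waves_eigenvectorP mu c_gt0 covered s0)|].
    move=> [L2f [d [b [wdb fw db]]]]; split=> //; exists b, d; split=> //.
      exact/solves_C_waves.
    by rewrite eigenfun_C_waves.
  move=> [L2f [b [d [db /solves_C_waves sC]]]]; rewrite eigenfun_C_waves => fw.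
  apply/(waves_eigenvectorP mu c_gt0 covered s0); split=> //.
  by exists d, b; split=> //; exact: sC.
split; last by move=> f /eigP[].
split=> [[f /eigP[_ [b [d [db sC _]]]]]|[b [d [db sC]]]]; first by exists b, d.
exists (eigenfun_C e0 c i k b d); apply/eigP; split.
  by rewrite eigenfun_C_waves; exact: waves_L2.
by exists b, d; split=> //; exact: ae_eq_refl.
Qed.
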